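(* Let $(X,d,\mu)$, $\Omega$, $\theta\in[0,1)$, the boundary measure $\mathscr H$ on $\partial\Omega$, the double-phase function $\mathcal H$, the trace operator $T$ and the functional $\mathcal J_f$ be as in the context. Assume that $\Omega$ is bounded, that $\mathcal H$ satisfies the local comparability condition on $\overline\Omega$, that $\Omega$ supports the weak $(1,1)$-Poincaré inequality, that $\Omega$ satisfies the global $\mathcal H$-Poincaré inequality, and that $N^{1,\mathcal H}(\Omega)$ is reflexive. Let $f\in L^{\widetilde{\mathcal H}}(\partial\Omega)$ satisfy $\int_{\partial\Omega}f\,d\mathscr H=0$. Then there exists $u_0\in N^{1,\mathcal H}_*(\Omega)$ such that $$\mathcal J_f(u_0)=\inf_{u\in N^{1,\mathcal H}_*(\Omega)}\mathcal J_f(u).$$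
   Context: Setting. $(X,d,\mu)$ is a complete metric measure space, where $\mu$ is a $\sigma$-finite Borel regular measure with $0<\mu(B(x,r))<\infty$ for every open ball. $\Omega\subset X$ is a domain such that $0<\mu(B(x,r)\cap\Omega)<\infty$ for all $x\in\overline\Omega$, $r>0$, and $\mu$ satisfies the restricted doubling condition on $\Omega$: there is $C\ge1$ with $\mu(B(x,2r)\cap\Omega)\le C\mu(B(x,r)\cap\Omega)$ for all $x\in\overline\Omega$, $r>0$. $\mathscr H$ is a $\sigma$-finite Borel regular measure on $\partial\Omega$ satisfying, for a fixed $0\le\theta<1$, the upper codimension-$\theta$ condition: there is $C_\theta>0$ with $\mathscr H(B(x,r)\cap\partial\Omega)\le C_\theta\, r^{-\theta}\mu(B(x,r)\cap\Omega)$ for all $x\in\partial\Omega$, $r>0$. Double-phase function. $\mathcal H(x,\xi)=\xi^{p(x)}+a(x)\xi^{q(x)}$ for $x\in\overline\Omega$, $\xi\ge0$, where $p,q,a$ are measurable on $\overline\Omega$, $1<p(x)<q(x)<\infty$ for all $x$, $1<p^-:=\operatorname{ess\,inf}p\le p^+:=\operatorname{ess\,sup}p<\infty$, $1<q^-:=\operatorname{ess\,inf}q\le q^+:=\operatorname{ess\,sup}q<\infty$, and $0\le a\in L^\infty$. These conditions are assumed on $\overline\Omega$ with respect to $\mu$, and on $\partial\Omega$ with respect to $\mathscr H$. The complementary function is $\widetilde{\mathcal H}(x,\xi)=\sup_{s\ge0}\{s\xi-\mathcal H(x,s)\}$. Spaces. $L^{\mathcal H}(\Omega)$ is the space of measurable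 $u$ on $\Omega$ with $\varrho_{\mathcal H}(u)=\int_\Omega\mathcal H(x,|u|)\,d\mu<\infty$, with Luxemburg norm $\|u\|=\inf\{\tau>0:\varrho_{\mathcal H}(u/\tau)\le1\}$; $L^{\mathcal H}(\partial\Omega)$ and $L^{\widetilde{\mathcal H}}(\partial\Omega)$ are defined in the same way on $\partial\Omega$ with measure $\mathscr H$ and functions $\mathcal H$, $\widetilde{\mathcal H}$ respectively. Rectifiable curves are nonconstant, continuous, of finite length $\ell_\gamma$ and parametrized on $[0,\ell_\gamma]$. The $\mathcal H$-modulus of a family $\Gamma$ of rectifiable curves in $\Omega$ is $\inf\int_\Omega\mathcal H(x,h)\,d\mu$ over Borel $h\ge0$ (values in $[0,\infty]$) with $\int_\gamma h\,ds\ge1$ for all $\gamma\in\Gamma$ ($\infty$ if there is no such $h$). A nonnegative Borel function $g$ on $\Omega$ is an $\mathcal H$-weak upper gradient of a measurable $u:\Omega\to[-\infty,\infty]$ if $|u(\gamma(0))-u(\gamma(\ell_\gamma))|\le\int_\gamma g\,ds$ for all rectifiable curves $\gamma$ in $\Omega$ outside a family of $\mathcal H$-modulus zero (with $|(\pm\infty)-(\pm\infty)|=\infty$). If $u$ has an $\mathcal H$-weak upper gradient in $L^{\mathcal H}(\Omega)$, then $g_u$ denotes the minimal one ($g_u\le g$ $\mu$-a.e. for every $\mathcal H$-weak upper gradient $g\in L^{\mathcal H}(\Omega)$ of $u$), which exists and is $\mu$-a.e. unique. $N^{1,\mathcal H}(\Omega)$ is the (Banach) space of everywhere-defined $u\in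 L^{\mathcal H}(\Omega)$ having an $\mathcal H$-weak upper gradient in $L^{\mathcal H}(\Omega)$, with norm $\|u\|_{N^{1,\mathcal H}(\Omega)}=\|u\|_{L^{\mathcal H}(\Omega)}+\|g_u\|_{L^{\mathcal H}(\Omega)}$, modulo $u\sim v$ iff $\|u-v\|=0$. $N^{1,\mathcal H}_*(\Omega)=\{u\in N^{1,\mathcal H}(\Omega):\int_\Omega u\,d\mu=0\}$. Local comparability. $\mathcal H$ satisfies the local comparability condition on $E$ if there exist $C\ge1$ and $R_0>0$ such that for every ball $B\subset X$ of radius less than $R_0$, all $x,y\in B\cap E$ and all $\xi\in[0,\infty)$, $\mathcal H(x,\xi)\le C\,\mathcal H(y,C\xi)$. Weak $(1,1)$-Poincaré inequality. $\Omega$ supports it if there are $C>0$, $\lambda>1$ such that for every $u\in L^1_{\mathrm{loc}}(\Omega)$ (integrable on bounded subsets of $\Omega$) with minimal $\mathcal H$-weak upper gradient $g_u$, $\frac1{\mu(B)}\int_B|u-u_B|\,d\mu\le C r\frac1{\mu(\lambda B\cap\Omega)}\int_{\lambda B\cap\Omega}g_u\,d\mu$ for every ball $B=B(x,r)\subset\Omega$; by convention, this assumption includes the same inequality with $B$ replaced by $B\cap\Omega$ on the left-hand side (averages over $B\cap\Omega$) for every ball $B=B(x,r)$ with $x\in\overline\Omega$. Here $u_A=\frac1{\mu(A)}\int_A u\,d\mu$ and $\lambda B=B(x,\lambda r)$. Global $\mathcal H$-Poincaré inequality. There is $C>0$ with $\|u-u_\Omega\|_{L^{\mathcal H}(\Omega)}\le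 C\|g_u\|_{L^{\mathcal H}(\Omega)}$ for every $u\in N^{1,\mathcal H}(\Omega)$. Trace and energy. Under boundedness of $\Omega$, local comparability on $\overline\Omega$ and the weak $(1,1)$-Poincaré inequality, there is a bounded linear trace operator $T:N^{1,\mathcal H}(\Omega)\to L^{\mathcal H}(\partial\Omega)$ characterized by $\lim_{r\to0}\frac1{\mu(B(z,r)\cap\Omega)}\int_{B(z,r)\cap\Omega}|u-Tu(z)|\,d\mu=0$ for $\mathscr H$-a.e. $z\in\partial\Omega$. With $\mathcal A(x,\xi)=\frac{\xi^{p(x)}}{p(x)}+a(x)\frac{\xi^{q(x)}}{q(x)}$, set $$\mathcal J_f(u)=\int_\Omega\mathcal A(x,g_u)\,d\mu+\int_{\partial\Omega}f\,Tu\,d\mathscr H,\quad u\in N^{1,\mathcal H}(\Omega).$$ *)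

(* Defs.v *)
From HB Require Import structures.
From mathcomp Require Import all_boot all_order all_algebra.
From mathcomp Require Import all_classical all_reals all_analysis.
From mathcomp Require Import measurable_realfun.
Set Implicit Arguments.
Unset Strict Implicit.
Unset Printing Implicit Defensive.
Import Order.TTheory GRing.Theory Num.Theory.
Import numFieldNormedType.Exports.
Local Open Scope classical_set_scope.
Local Open Scope ring_scope.

(* Library measurable types and complete uniform spaces are pointed; this is
   harmless here since the spaces considered contain a nonempty domain. *)
#[short(type="completeMetricType")]
HB.structure Definition CompleteMetric (R : numDomainType) :=
  {T of Metric R T & Complete T}.

Section seminormed_spaces.
Local Open Scope ereal_scope.
Context {R : realType}.

(* A space of functions considered modulo a seminorm is handled through its
   representatives: the vectors are the elements of [snmem], and two of
   them stand for the same vector when their difference has seminorm 0. *)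
Record seminormed := Seminormed {
  snvec : Type ;
  snmem : set snvec ;
  snadd : snvec -> snvec -> snvec ;
  snscale : R -> snvec -> snvec ;
  snorm : snvec -> \bar R }.

(* Boundedness makes a functional constant on classes, so [dual_space V] is the
   dual of the quotient space; its norm is again a seminorm on representatives,
   as values outside [snmem V] are irrelevant. *)
Definition bounded_functional (V : seminormed) (L : snvec V -> R) : Prop :=
  [/\ forall u v, snmem u -> snmem v -> L (snadd u v) = (L u + L v)%R,
      forall c u, snmem u -> L (snscale c u) = (c * L u)%R
    & exists C : R, forall u, snmem u -> `|L u|%:E <= C%:E * snorm u].

Definition dual_space (V : seminormed) : seminormed := Seminormed
  (@bounded_functional V)
  (fun L L' u => (L u + L' u)%R)
  (fun c L u => (c * L u)%R)
  (fun L => ereal_sup [set `|L u|%:E | u in [set u | snmem u /\ snorm u <= 1]]).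

Definition reflexive_space (V : seminormed) : Prop :=
  forall Phi : snvec (dual_space (dual_space V)), snmem Phi ->
    exists2 u : snvec V, snmem u &
      forall L : snvec (dual_space V), snmem L -> Phi L = L u.

End seminormed_spaces.

Section measures.
Local Open Scope ereal_scope.
Context {R : realType} {X : completeMetricType R}.
Implicit Types (m : {outer_measure set X -> \bar R}) (A D E : set X)
  (Phi : X -> \bar R -> \bar R) (u f : X -> \bar R).

Definition boundary A : set X := closure A `\` A°.

Definition bounded_in_metric A : Prop := exists x (r : R), A `<=` ball x r.

Definition domain A : Prop := [/\ A !=set0, open A & connected A].

Definition borel A : Prop := <<s @open X >> A.

Definition borel_fun D f : Prop :=
  measurable_fun (D : set (g_sigma_algebraType (@open X))) f.

(* A Borel regular measure is an outer measure defined on all subsets;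
   measurability is Caratheodory measurability. *)
Definition borel_regular m : Prop :=
  (forall A, borel A -> m.-cara.-measurable A) /\
  forall A, exists B, [/\ borel B, A `<=` B & m B = m A].

Definition measurable_on m D f : Prop :=
  measurable_fun (D : set (caratheodory_type m)) f.

Definition sigma_finite_on m D : Prop :=
  sigma_finite (D : set (caratheodory_type m)) m.

Definition integral_on m D f : \bar R :=
  \int[m : {measure set (caratheodory_type m) -> \bar R}]_(x in D) f x.

Definition integrable_on m D f : Prop :=
  (m : {measure set (caratheodory_type m) -> \bar R}).-integrable D f.

Definition ae_on m D (P : X -> Prop) : Prop :=
  \forall x \ae (m : {measure set (caratheodory_type m) -> \bar R}), D x -> P x.

Definition ess_sup_on m D f : \bar R :=
  ereal_inf [set y | ae_on m D (fun x => f x <= y)].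

Definition ess_inf_on m D f : \bar R :=
  ereal_sup [set y | ae_on m D (fun x => y <= f x)].

Definition average m A u : \bar R := ((fine (m A))^-1)%:E * integral_on m A u.

Definition modular m D Phi u : \bar R :=
  integral_on m D (fun x => Phi x `|u x|).

Definition luxemburg_norm m D Phi u : \bar R :=
  ereal_inf [set t%:E | t in [set t : R |
    (0 < t)%R /\ modular m D Phi (fun x => (t^-1)%:E * u x) <= 1]].

Definition orlicz_space m D Phi : set (X -> \bar R) :=
  [set u | measurable_on m D u /\ modular m D Phi u < +oo].

End measures.

Section double_phase.
Local Open Scope ereal_scope.
Context {R : realType} {X : completeMetricType R}.
Implicit Types (p q a : X -> R) (x : X) (xi : \bar R).

Definition double_phase p q a x xi : \bar R :=
  xi `^ (p x) + (a x)%:E * xi `^ (q x).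

Definition energy_density p q a x xi : \bar R :=
  xi `^ (p x) * ((p x)^-1)%:E + (a x)%:E * (xi `^ (q x) * ((q x)^-1)%:E).

Definition complementary (Phi : X -> \bar R -> \bar R) x xi : \bar R :=
  ereal_sup [set s%:E * xi - Phi x s%:E | s in [set s : R | (0 <= s)%R]].

(* On a null set [D] the bounds on [ess_inf_on] and [ess_sup_on] hold
   trivially; otherwise [ess_inf_on <= ess_sup_on] is automatic. *)
Definition double_phase_data (m : {outer_measure set X -> \bar R}) (D : set X)
    p q a : Prop :=
  [/\ [/\ measurable_on m D (EFin \o p), measurable_on m D (EFin \o q)
        & measurable_on m D (EFin \o a)],
      forall x, D x -> (1 < p x)%R /\ (p x < q x)%R,
      1 < ess_inf_on m D (EFin \o p) /\ ess_sup_on m D (EFin \o p) < +oo,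
      1 < ess_inf_on m D (EFin \o q) /\ ess_sup_on m D (EFin \o q) < +oo
    & (forall x, D x -> (0 <= a x)%R) /\
      ess_sup_on m D (fun x => `|a x|%:E) < +oo].

Definition local_comparability (Phi : X -> \bar R -> \bar R) (E : set X) :
    Prop :=
  exists C R0 : R, [/\ (1 <= C)%R, (0 < R0)%R &
    forall (z : X) (r : R), (0 < r)%R -> (r < R0)%R ->
    forall x y, (ball z r `&` E) x -> (ball z r `&` E) y ->
    forall s : R, (0 <= s)%R -> Phi x s%:E <= C%:E * Phi y (C * s)%:E].

End double_phase.

Section curves.
Local Open Scope ereal_scope.
Context {R : realType} {X : completeMetricType R}.

(* Only the values of [curve_param] on [0, curve_len] matter. *)
Record curve := Curve { curve_len : R ; curve_param : R -> X }.

Definition polygonal_length (c : R -> X) (s t : R) (l : seq R) : R :=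
  (\sum_(0 <= n < size l)
    mdist (c (nth t (s :: l) n)) (c (nth t (s :: l) n.+1)))%R.

Definition arc_length (c : R -> X) (s t : R) : \bar R :=
  ereal_sup [set (polygonal_length c s t l)%:E | l in itv_partition s t].

(* Parametrization by arc length on [0, curve_len]; [0 < curve_len] excludes
   constant curves. *)
Definition rectifiable_curve_in (Omega : set X) : set curve :=
  [set c | [/\ (0 < curve_len c)%R,
    {within `[0%R, curve_len c], continuous (curve_param c)},
    forall t, t \in `[0%R, curve_len c] -> Omega (curve_param c t)
  & forall t, t \in `[0%R, curve_len c] ->
      arc_length (curve_param c) 0%R t = t%:E]].

Definition curve_integral (c : curve) (h : X -> \bar R) : \bar R :=
  \int[lebesgue_measure]_(t in `[0%R, curve_len c]) h (curve_param c t).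

End curves.
Arguments curve : clear implicits.

Section newtonian.
Local Open Scope ereal_scope.
Context {R : realType} {X : completeMetricType R}.
Variables (mu : {outer_measure set X -> \bar R}) (Omega : set X)
  (Phi : X -> \bar R -> \bar R).
Implicit Types (Gamma : set (curve R X)) (u g h : X -> \bar R).

Definition nonneg_borel g : Prop :=
  borel_fun Omega g /\ forall x, Omega x -> 0 <= g x.

Definition modulus Gamma : \bar R :=
  ereal_inf [set integral_on mu Omega (fun x => Phi x (h x)) | h in
    [set h | nonneg_borel h /\ forall c, Gamma c -> 1 <= curve_integral c h]].

(* In the library +oo - +oo = -oo and -oo - -oo = -oo, so the difference of two
   infinite values has absolute value +oo, as required. *)
Definition weak_upper_gradient u g : Prop :=
  nonneg_borel g /\
  exists Gamma, [/\ Gamma `<=` rectifiable_curve_in Omega, modulus Gamma = 0 &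
    forall c, rectifiable_curve_in Omega c -> ~ Gamma c ->
      `|u (curve_param c 0%R) - u (curve_param c (curve_len c))| <=
      curve_integral c g].

Definition weak_upper_gradient_in_space u g : Prop :=
  weak_upper_gradient u g /\ orlicz_space mu Omega Phi g.

Definition is_minimal_gradient u g : Prop :=
  weak_upper_gradient_in_space u g /\
  forall g', weak_upper_gradient_in_space u g' ->
    ae_on mu Omega (fun x => g x <= g' x).

Definition minimal_gradient u : X -> \bar R :=
  xget (cst 0) (is_minimal_gradient u).

Definition newtonian : set (X -> \bar R) :=
  [set u | orlicz_space mu Omega Phi u /\
           exists g, weak_upper_gradient_in_space u g].

Definition newtonian_norm u : \bar R :=
  luxemburg_norm mu Omega Phi u +
  luxemburg_norm mu Omega Phi (minimal_gradient u).

Definition newtonian_space : seminormed := Seminormed newtonian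
  (fun u v x => u x + v x) (fun (c : R) u x => c%:E * u x) newtonian_norm.

Definition newtonian_mean0 : set (X -> \bar R) :=
  [set u | newtonian u /\ integral_on mu Omega u = 0].

Definition locally_integrable u : Prop :=
  forall A, mu.-cara.-measurable A -> A `<=` Omega -> bounded_in_metric A ->
    integrable_on mu A u.

(* The balls contained in [Omega] are among those centered in [closure Omega],
   and for them [ball x r `&` Omega] is [ball x r]. *)
Definition weak_11_poincare : Prop :=
  exists C lambda : R, [/\ (0 < C)%R, (1 < lambda)%R &
    forall u, locally_integrable u ->
      (exists g, weak_upper_gradient_in_space u g) ->
    forall (x : X) (r : R), closure Omega x -> (0 < r)%R ->
      let B := ball x r `&` Omega in
      average mu B (fun y => `|u y - average mu B u|) <=
      (C * r)%:E *
        average mu (ball x (lambda * r)%R `&` Omega) (minimal_gradient u)].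

Definition global_poincare : Prop :=
  exists2 C : R, (0 < C)%R & forall u, newtonian u ->
    luxemburg_norm mu Omega Phi (fun x => u x - average mu Omega u) <=
    C%:E * luxemburg_norm mu Omega Phi (minimal_gradient u).

(* The trace is a map on representatives, with values in functions on the
   boundary up to [nu]-null sets. *)
Definition trace_operator (nu : {outer_measure set X -> \bar R})
    (T : (X -> \bar R) -> (X -> \bar R)) : Prop :=
  let bd := boundary Omega in
  [/\ forall u, newtonian u -> orlicz_space nu bd Phi (T u),
      (forall u v, newtonian u -> newtonian v ->
        ae_on nu bd (fun z => T (fun x => u x + v x) z = T u z + T v z)) /\
      (forall (c : R) u, newtonian u ->
        ae_on nu bd (fun z => T (fun x => c%:E * u x) z = c%:E * T u z)),
      exists C : R, forall u, newtonian u ->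
        luxemburg_norm nu bd Phi (T u) <= C%:E * newtonian_norm u
    & forall u, newtonian u -> ae_on nu bd (fun z =>
        average mu (ball z r `&` Omega) (fun x => `|u x - T u z|)
          @[r --> 0%R^'+] --> 0)].

End newtonian.

Section setting.
Local Open Scope ereal_scope.
Context {R : realType} {X : completeMetricType R}.
Implicit Types (mu nu : {outer_measure set X -> \bar R}) (Omega : set X).

Definition ambient_measure mu : Prop :=
  [/\ borel_regular mu, sigma_finite_on mu setT &
    forall (x : X) (r : R), (0 < r)%R -> 0 < mu (ball x r) < +oo].

Definition restricted_doubling mu Omega : Prop :=
  (forall (x : X) (r : R), closure Omega x -> (0 < r)%R ->
    0 < mu (ball x r `&` Omega) < +oo) /\
  exists2 C : R, (1 <= C)%R &
    forall (x : X) (r : R), closure Omega x -> (0 < r)%R ->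
      mu (ball x (2 * r)%R `&` Omega) <= C%:E * mu (ball x r `&` Omega).

(* A measure on [boundary Omega] is represented by its extension to [X] which
   vanishes off [boundary Omega]. *)
Definition boundary_measure nu Omega : Prop :=
  [/\ borel_regular nu, sigma_finite_on nu (boundary Omega)
    & nu (~` boundary Omega) = 0].

Definition upper_codimension mu nu Omega (theta : R) : Prop :=
  exists2 C : R, (0 < C)%R &
    forall (x : X) (r : R), boundary Omega x -> (0 < r)%R ->
      nu (ball x r `&` boundary Omega) <=
      (C * r `^ (- theta))%:E * mu (ball x r `&` Omega).

Definition energy mu nu Omega (p q a : X -> R)
    (T : (X -> \bar R) -> (X -> \bar R)) (f u : X -> \bar R) : \bar R :=
  integral_on mu Omega (fun x => energy_density p q a x
    (minimal_gradient mu Omega (double_phase p q a) u x)) +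
  integral_on nu (boundary Omega) (fun z => f z * T u z).

End setting.

(* Main.v *)
(**
  The direct method. The global Poincare inequality, the bound on the trace and
  the lower exponent bound [p0 > 1] make the functional coercive on functions of
  mean zero, so a minimizing sequence is bounded in the Newtonian norm. Its limit
  along an ultrafilter, evaluated on bounded functionals, is a bounded functional
  on the dual space; by reflexivity it is evaluation at some [u0], and the mean
  and the boundary term pass to the limit because they are bounded functionals.
  By the Hahn-Banach theorem [u0] lies in the norm closure of each (convex)
  sublevel set of the gradient energy that contains the sequence frequently,
  which gives lower semicontinuity.

  That the energy is convex needs minimal weak upper gradients to exist: among
  the weak upper gradients in the Orlicz space one takes the infimum of a
  decreasing sequence minimizing the integral. The minimum of two weak upper
  gradients is again one, because on a.e. curve the two line integrals bound the
  oscillation on every subarc, so one may switch between them on the intervals of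
  an open set approximating the set where the first gradient is the smaller one.
*)
Require Import Defs.
From HB Require Import structures.
From mathcomp Require Import all_boot all_order all_algebra.
From mathcomp Require Import all_classical all_reals all_analysis.
From mathcomp Require Import measurable_realfun.
From mathcomp Require Import ring lra.
Set Implicit Arguments.
Unset Strict Implicit.
Unset Printing Implicit Defensive.
Import Order.TTheory GRing.Theory Num.Theory.
Import numFieldNormedType.Exports.
Local Open Scope classical_set_scope.
Local Open Scope ring_scope.

(** Two obstacles shape the text. First, Newtonian functions take extended real values, so pointwise
    addition does not turn them into a module. The Hahn-Banach theorem is therefore proved relative
    to a subspace [W] of an lmodType and applied to real-valued functions [X -> R^o]; [fine]
    replaces a function by a real-valued one with a.e. the same minimal gradient, and functionals
    are carried back along it. Second, switching gradients along a curve requires that all subarcs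
    of a good curve are good. So an exceptional family is enlarged to the set of curves along which
    one function of finite modular has infinite integral: finiteness of that integral passes to
    subarcs, two such control functions are added, and countably many are scaled and merged by a
    supremum. Growth enters through a natural number [P] that bounds [q] a.e.: a factor [k >= 1] in
    the argument costs at most [k ^+ P]. Convergence is along an ultrafilter because then the values
    of all bounded functionals converge at once, whatever their number. *)

(** * Sublinear functionals, Hahn-Banach and separation from a convex set *)

Section hahn_banach.
Context {R : realType} {V : lmodType R} (W : set V).
Hypotheses (W0 : W 0) (WD : forall u v, W u -> W v -> W (u + v))
  (WZ : forall (c : R) u, W u -> W (c *: u)).
Implicit Types (p q : V -> R) (C : set V) (u v c : V).

Let WN u : W u -> W (- u).
Proof. by rewrite -scaleN1r; exact: WZ. Qed.

(** Everything is required on [W] only: the Newtonian seminorm, made real by [fine], is meaningful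
    only on the Newtonian functions inside [X -> R^o]. *)
Definition sublinear_on q : Prop :=
  (forall u v, W u -> W v -> q (u + v) <= q u + q v) /\
  (forall (t : R) u, 0 <= t -> W u -> q (t *: u) = t * q u).

Definition convex_subset C : Prop :=
  forall (t : R) u v, 0 <= t <= 1 -> C u -> C v -> C (t *: u + (1 - t) *: v).

Lemma sublinear_on0 q : sublinear_on q -> q 0 = 0.
Proof. by move=> [_ qZ]; rewrite -(scale0r 0) qZ ?mul0r. Qed.

Lemma sublinear_on_opp q u : sublinear_on q -> W u -> - q (- u) <= q u.
Proof.
move=> sq Wu; have := sq.1 u (- u) Wu (WN Wu).
rewrite subrr (sublinear_on0 sq); lra.
Qed.

(** The inequality for [t^-1] and the vector [t *: u] is the reverse inequality for [t] and [u]. *)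
Lemma sublinear_onZ q : q 0 = 0 ->
  (forall (t : R) u, 0 < t -> W u -> q (t *: u) <= t * q u) ->
  forall (t : R) u, 0 <= t -> W u -> q (t *: u) = t * q u.
Proof.
move=> q0 qZ t u; rewrite le_eqVlt => /predU1P[<- _|t0 Wu].
  by rewrite scale0r mul0r.
apply/eqP; rewrite eq_le qZ//= mulrC -ler_pdivlMr// mulrC.
have := qZ t^-1 (t *: u); rewrite scalerA mulVf ?gt_eqF// scale1r.
by apply; rewrite ?invr_gt0//; exact: WZ.
Qed.

(* The infimum of [q (x + t c) - t d] over [t >= 0] and [c] in [C]. *)
Lemma sublinear_on_shift q C (d : R) : sublinear_on q -> C `<=` W ->
  C !=set0 -> convex_subset C -> (forall c, C c -> d <= q c) ->
  exists p, [/\ sublinear_on p, forall u, W u -> p u <= q u &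
    forall c, C c -> p (- c) <= - d].
Proof.
move=> sq CW [c0 Cc0] convC dq.
pose S x := [set q (x + tc.1 *: tc.2) - tc.1 * d |
  tc in [set tc : R * V | 0 <= tc.1 /\ C tc.2]].
have Slb x : W x -> lbound (S x) (- q (- x)).
  move=> Wx _ [[t c]/= [t0 Cc] <-].
  have Wc := CW _ Cc.
  (* The infimum is finite because [t * d <= q (t *: c) <= q (x + t *: c) + q (- x)]. *)
  have -> : - q (- x) = t * d - q (- x) - t * d by lra.
  rewrite lerD2r lerBlDr (le_trans (ler_wpM2l t0 (dq _ Cc)))//.
  rewrite -sq.2//.
  have := sq.1 (x + t *: c) (- x) (WD Wx (WZ t Wc)) (WN Wx).
  by rewrite addrC addKr.
have Sinf x : W x -> has_inf (S x).
  by move=> Wx; split; [exists (q (x + 0 *: c0) - 0 * d), (0, c0)|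
    exists (- q (- x)); exact: Slb].
pose p x := inf (S x).
have p_le x t c : W x -> 0 <= t -> C c -> p x <= q (x + t *: c) - t * d.
  by move=> Wx t0 Cc; apply: ge_inf; [exact: (Sinf x Wx).2|exists (t, c)].
have le_p x y : W x -> (forall t c, 0 <= t -> C c ->
    y <= q (x + t *: c) - t * d) -> y <= p x.
  move=> Wx h; apply: lb_le_inf; first exact: (Sinf x Wx).1.
  by move=> _ [[t c]/= [t0 Cc] <-]; exact: h.
have p0 : p 0 = 0.
  apply/eqP; rewrite eq_le; apply/andP; split.
    have := p_le 0 0 c0 W0 (lexx _) Cc0.
    by rewrite scale0r mul0r subr0 addr0 (sublinear_on0 sq).
  apply: (le_p) => // t c t0 Cc.
  by rewrite add0r sq.2//; [rewrite -mulrBr mulr_ge0// subr_ge0 dq|exact: CW].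
have pq u : W u -> p u <= q u.
  by move=> Wu; have := p_le u 0 c0 Wu (lexx _) Cc0;
    rewrite scale0r mul0r subr0 addr0.
exists p; split => //; first split.
- move=> u v Wu Wv.
  rewrite -lerBlDl; apply: (le_p _ _ Wv) => s c s0 Cc.
  rewrite lerBlDl -lerBlDr; apply: (le_p _ _ Wu) => t e t0 Ce.
  rewrite lerBlDr.
  have Wc := CW _ Cc; have We := CW _ Ce.
  apply: (@le_trans _ _ (q (u + t *: e + (v + s *: c)) - (t + s) * d)); last first.
    have := sq.1 (u + t *: e) (v + s *: c)
      (WD Wu (WZ _ We)) (WD Wv (WZ _ Wc)); lra.
  move: s0; rewrite le_eqVlt => /predU1P[<-|s0].
    rewrite scale0r !addr0 addrAC; apply: (p_le) => //; exact: WD.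
  have ts0 : 0 < t + s by lra.
  (* The competitors [(t, e)] for [u] and [(s, c)] for [v] merge into one for [u + v] with parameter
     [t + s], at a convex combination of [e] and [c]. The case [s = 0] was split off so that [t + s]
     is invertible. *)
  have -> : u + t *: e + (v + s *: c) = u + v +
      (t + s) *: ((t / (t + s)) *: e + (1 - t / (t + s)) *: c).
    rewrite addrACA; congr +%R; rewrite scalerDr !scalerA; congr (_ *: _ + _ *: _).
      by rewrite mulrC divfK ?gt_eqF.
    by rewrite mulrBr mulr1 mulrC divfK ?gt_eqF// addrAC subrr add0r.
  apply: (p_le); [exact: WD|exact: ltW|apply: convC => //].
  by rewrite divr_ge0//= ?(ltW ts0)// ler_pdivrMr// mul1r; lra.
- apply: sublinear_onZ => // t u t0 Wu.
  rewrite -ler_pdivrMl//; apply: (le_p) => // s c s0 Cc.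
  rewrite ler_pdivrMl//.
  have := p_le (t *: u) (t * s) c (WZ _ Wu) (mulr_ge0 (ltW t0) s0) Cc.
  rewrite -scalerA -scalerDr sq.2//; last 2 first.
  - exact: ltW.
  - by apply: WD => //; apply: WZ; exact: CW.
  by rewrite mulrBr mulrA.
- move=> c Cc; have := p_le (- c) 1 c (WN (CW _ Cc)) ler01 Cc.
  by rewrite scale1r addNr (sublinear_on0 sq) mul1r sub0r.
Qed.

(* A minimal sublinear functional is additive: shift it by a singleton. *)
Lemma hahn_banach p : sublinear_on p -> exists L : V -> R,
  [/\ forall u v, W u -> W v -> L (u + v) = L u + L v,
      forall (c : R) u, W u -> L (c *: u) = c * L u &
      forall u, W u -> L u <= p u].
Proof.
move=> sp.
pose P q := sublinear_on q /\ forall u, W u -> q u <= p u.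
pose T := {q | P q}.
(* The order is reversed, so that a maximal element in Zorn's lemma is a pointwise minimal sublinear
   functional. *)
pose le (r s : T) := `[< forall u, W u -> sval s u <= sval r u >].
have Pp : P p by [].
have [|||[q [sq qp]] qmin] := @ZL_preorder T (exist _ p Pp) le.
- by move=> t; apply/asboolP.
- move=> r s t /asboolP sr /asboolP ts; apply/asboolP => u Wu.
  by rewrite (le_trans (ts _ Wu))// sr.
- move=> A Atot.
  have [->|/set0P[a0 Aa0]] := eqVneq A set0; first by exists (exist _ p Pp).
  pose S u := [set sval a u | a in A].
  have Sinf u : W u -> has_inf (S u).
    move=> Wu; split; first by exists (sval a0 u), a0.
    exists (- p (- u)) => _ [a Aa <-].
    rewrite (le_trans _ (sublinear_on_opp (svalP a).1 Wu))// lerN2.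
    exact: ((svalP a).2 _ (WN Wu)).
  pose m u := inf (S u).
  have m_le a u : A a -> W u -> m u <= sval a u.
    by move=> Aa Wu; apply: ge_inf; [exact: (Sinf _ Wu).2|exists a].
  have le_m y u : W u -> (forall a, A a -> y <= sval a u) -> y <= m u.
    move=> Wu h; apply: lb_le_inf; first exact: (Sinf _ Wu).1.
    by move=> _ [a Aa <-]; exact: h.
  have Pm : P m.
    split; first split.
    + move=> u v Wu Wv; rewrite -lerBlDl; apply: (le_m _ _ Wv) => b Ab.
      rewrite lerBlDl -lerBlDr; apply: (le_m _ _ Wu) => a Aa; rewrite lerBlDr.
      have Wuv := WD Wu Wv.
      (* The smaller of [a] and [b] serves for both arguments; this is why infima over chains stay
         subadditive. *)
      have [/asboolP ba|/asboolP ab] := Atot _ _ Aa Ab.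
        apply: (le_trans (m_le _ _ Ab Wuv)).
        by rewrite (le_trans ((svalP b).1.1 _ _ Wu Wv))// lerD2r ba.
      apply: (le_trans (m_le _ _ Aa Wuv)).
      by rewrite (le_trans ((svalP a).1.1 _ _ Wu Wv))// lerD2l ab.
    + apply: sublinear_onZ.
        apply/eqP; rewrite eq_le; apply/andP; split.
          by rewrite (le_trans (m_le _ _ Aa0 W0))// (sublinear_on0 (svalP a0).1).
        by apply: (le_m _ _ W0) => a _; rewrite (sublinear_on0 (svalP a).1).
      move=> t u t0 Wu; rewrite -ler_pdivrMl//; apply: (le_m _ _ Wu) => a Aa.
      rewrite ler_pdivrMl// -(svalP a).1.2//; last exact: ltW.
      by apply: (m_le) => //; exact: WZ.
    + move=> u Wu; rewrite (le_trans (m_le _ _ Aa0 Wu))//.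
      exact: (svalP a0).2.
  by exists (exist _ m Pm) => s As; apply/asboolP => u Wu; exact: (m_le).
have qD u v : W u -> W v -> q (u + v) = q u + q v.
  move=> Wu Wv; apply/eqP; rewrite eq_le sq.1//=.
  (* The shift by [v] at level [q v] lies below [q], hence equals it on [W] by minimality. So [q u
     <= p' (u + v) + p' (- v) <= q (u + v) - q v]. *)
  have [||||p' [sp' p'q p'c]] := @sublinear_on_shift q [set v] (q v) sq.
 - by move=> x ->; exact: Wv.
  - by exists v.
  - move=> t x y _ -> ->.
    by rewrite -scalerDl addrC subrK scale1r.
  - by move=> x ->.
  have Pp' : P p' by split => // w Ww; rewrite (le_trans (p'q _ Ww))// qp.
  have /asboolP/= qp' : le (exist _ p' Pp') (exist _ q (conj sq qp)).
    by apply: qmin; apply/asboolP.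
  have := sp'.1 (u + v) (- v) (WD Wu Wv) (WN Wv); rewrite addrK.
  have := p'c v erefl; have := qp' _ Wu; have := p'q _ (WD Wu Wv); lra.
have qN u : W u -> q (- u) = - q u.
  move=> Wu; have := qD u (- u) Wu (WN Wu).
  rewrite subrr (sublinear_on0 sq); lra.
exists q; split; [exact: qD| |exact: qp] => c u Wu.
have [c0|/ltW c0] := leP 0 c; first exact: sq.2.
rewrite -[c]opprK scaleNr qN; last exact: WZ.
by rewrite sq.2 ?oppr_ge0// !mulNr.
Qed.

(** Shifting [q] by the convex set [C - u] at level [d] gives a sublinear [p] with
    [p (u - c) <= - d] for all [c] in [C]; a linear functional below [p] then separates. *)
Lemma convex_separation q C u : sublinear_on q -> C `<=` W -> C !=set0 ->
  convex_subset C -> W u -> forall d, (forall c, C c -> d <= q (c - u)) ->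
  exists L : V -> R,
  [/\ forall u v, W u -> W v -> L (u + v) = L u + L v,
      forall (c : R) u, W u -> L (c *: u) = c * L u,
      forall u, W u -> L u <= q u &
      forall c, C c -> L u + d <= L c].
Proof.
move=> sq CW [c0 Cc0] convC Wu d dq.
have [||||p [sp pq pc]] := @sublinear_on_shift q [set c - u | c in C] d sq.
- by move=> _ [c Cc <-]; apply: WD (CW _ Cc) (WN Wu).
- by exists (c0 - u), c0.
- move=> t _ _ t01 [x Cx <-] [y Cy <-]; exists (t *: x + (1 - t) *: y).
    exact: convC.
  rewrite !scalerBr addrACA -opprD -scalerDl; congr (_ - _).
  by rewrite addrC subrK scale1r.
- by move=> _ [c Cc <-]; exact: dq.
have [L [LD LZ Lp]] := hahn_banach sp.
exists L; split; [exact: LD|exact: LZ|move=> v Wv|move=> c Cc]; first exact: le_trans (Lp _ Wv) (pq _ Wv).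
have Wc := CW _ Cc.
have := pc (c - u) (ex_intro2 _ _ c Cc erefl).
have := Lp _ (WN (WD Wc (WN Wu))).
have -> : L (- (c - u)) = L u - L c; last by lra.
rewrite opprB LD//; last exact: WN.
by rewrite -scaleN1r LZ// mulN1r.
Qed.

End hahn_banach.

(** * Sums of two powers: convexity and growth *)

Section power_sum.
Local Open Scope ereal_scope.
Context {R : realType}.
Implicit Types (b c p q t : R) (x y : \bar R).

Lemma ge0_le_poweR p x y : (0 <= p)%R -> 0 <= x -> x <= y ->
  x `^ p <= y `^ p.
Proof.
move=> p0 x0 xy; apply: gt0_ler_poweR => //;
  by rewrite in_itv/= ?x0 ?(le_trans x0)//= leey.
Qed.

Lemma poweR_ge1 p t : (1 <= p)%R -> (1 <= t)%R -> t%:E <= t%:E `^ p.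
Proof.
move=> p1 t1; rewrite poweR_EFin lee_fin.
by rewrite -[X in (X <= _)%R]powRr1 ?(le_trans ler01)// ler_powR.
Qed.

(** For finite values this is convexity of the real power. An infinite value with positive weight
    makes the right side infinite; the weights 0 and 1 are treated apart because [0 * +oo = 0]. *)
Lemma poweR_convex p t x y : (1 <= p)%R -> (0 <= t <= 1)%R ->
  0 <= x -> 0 <= y ->
  (t%:E * x + (1 - t)%:E * y) `^ p <= t%:E * x `^ p + (1 - t)%:E * y `^ p.
Proof.
move=> p1 /andP[t0 t1].
have p0 : (0 < p)%R by rewrite (lt_le_trans _ p1).
have pN0 : p != 0%R by rewrite gt_eqF.
have [->|tN0] := eqVneq t 0%R.
  by rewrite subr0 !mul0e !add0e !mul1e.
have [->|tN1] := eqVneq t 1%R.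
  by rewrite subrr !mul0e !adde0 !mul1e.
have {tN0}t0 : (0 < t)%R by rewrite lt_neqAle eq_sym tN0.
have {tN1}t1 : (0 < 1 - t)%R by rewrite subr_gt0 lt_neqAle tN1.
move: x y => [x| |] [y| |]// x0 y0.
- rewrite -!EFinM -!EFinD !poweR_EFin lee_fin.
  rewrite !lee_fin in x0 y0.
  have t01 : (0 <= t <= 1)%R by apply/andP; split; lra.
  have := @convex_powR R p p1 (Itv01 (ltW t0) (andP t01).2) x y.
  by rewrite !inE/= !in_itv/= !andbT => /(_ x0 y0); rewrite !convRE/=.
- rewrite [+oo `^ p]poweRyr// [X in _ <= _ + X]gt0_muley ?lte_fin//.
  by rewrite [X in _ <= X]addey ?leey// poweR_EFin -EFinM.
- rewrite [+oo `^ p]poweRyr// [X in _ <= X + _]gt0_muley ?lte_fin//.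
  by rewrite [X in _ <= X]addye ?leey// poweR_EFin -EFinM.
- by rewrite !gt0_muley ?lte_fin// !poweRyr//= !gt0_muley ?lte_fin.
Qed.

(** On [[0, +oo]] the power [p] is an increasing bijection with inverse the power [p^-1], so the
    bound can be moved through the supremum. *)
Lemma le_ereal_sup_poweR p (u : nat -> \bar R) y : (0 < p)%R ->
  (forall n, 0 <= u n) -> (forall n, u n `^ p <= y) ->
  ereal_sup (range u) `^ p <= y.
Proof.
move=> p0 u0 uy.
have y0 : 0 <= y by rewrite (le_trans _ (uy 0%N)) ?poweR_ge0.
have pV z : 0 <= z -> (z `^ p) `^ p^-1 = z.
  by move=> z0; rewrite -poweRrM divff ?gt_eqF// poweRe1.
have Vp z : 0 <= z -> (z `^ p^-1) `^ p = z.
  by move=> z0; rewrite -poweRrM mulVf ?gt_eqF// poweRe1.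
rewrite -(Vp _ y0); apply: ge0_le_poweR; first exact: ltW.
  by rewrite (le_trans (u0 0%N))//; apply: ereal_sup_ubound; exists 0%N.
apply: ge_ereal_sup => _ [n _ <-]; rewrite -(pV _ (u0 n)).
by apply: ge0_le_poweR (uy n); rewrite ?poweR_ge0 ?invr_ge0 ?(ltW p0).
Qed.

(** The common shape, at a fixed point, of the double-phase function ([b = 1]) and of the energy
    density ([b] and [c] divided by the exponents). *)
Definition power_sum b c p q x : \bar R := b%:E * x `^ p + c%:E * x `^ q.

Context {b c p q : R}.
Hypotheses (b0 : (0 < b)%R) (c0 : (0 <= c)%R) (p1 : (1 < p)%R) (pq : (p < q)%R).
Local Notation G := (power_sum b c p q).

Let q1 : (1 < q)%R. Proof. exact: lt_trans pq. Qed.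
Let p_ge1 := ltW p1.
Let q_ge1 := ltW q1.
Let p_gt0 : (0 < p)%R. Proof. exact: lt_trans p1. Qed.
Let q_gt0 : (0 < q)%R. Proof. exact: lt_trans q1. Qed.
Let p_ge0 := ltW p_gt0.
Let q_ge0 := ltW q_gt0.
Let bE0 : 0 <= b%:E. Proof. by rewrite lee_fin ltW. Qed.
Let cE0 : 0 <= c%:E. Proof. by rewrite lee_fin. Qed.

Lemma power_sum_ge0 x : 0 <= G x.
Proof. by rewrite adde_ge0// mule_ge0// poweR_ge0. Qed.

Lemma power_sum0 : G 0 = 0.
Proof. by rewrite /power_sum !poweR0r ?gt_eqF// !mule0 adde0. Qed.

Lemma power_sumy : G +oo = +oo.
Proof.
rewrite /power_sum !poweRyr ?gt_eqF// gt0_muley ?lte_fin// addye//.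
by rewrite gt_eqF// (@lt_le_trans _ _ 0)// mule_ge0.
Qed.

Lemma power_sum_lty t : G t%:E < +oo.
Proof. by rewrite /power_sum !poweR_EFin -!EFinM -EFinD ltry. Qed.

Lemma le_power_sum x y : 0 <= x -> x <= y -> G x <= G y.
Proof.
by move=> x0 xy; rewrite leeD// lee_wpmul2l// ge0_le_poweR.
Qed.

Lemma power_sum_convex t x y : (0 <= t <= 1)%R -> 0 <= x -> 0 <= y ->
  G (t%:E * x + (1 - t)%:E * y) <= t%:E * G x + (1 - t)%:E * G y.
Proof.
move=> t01 x0 y0; have [t0 t1] := andP t01.
have tE0 : 0 <= t%:E by rewrite lee_fin.
have tE1 : 0 <= (1 - t)%:E by rewrite lee_fin subr_ge0.
rewrite /power_sum !ge0_muleDr ?mule_ge0 ?poweR_ge0//.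
rewrite addeACA !(muleCA _ b%:E) !(muleCA _ c%:E).
rewrite -!ge0_muleDr ?mule_ge0 ?poweR_ge0//.
by rewrite leeD// lee_wpmul2l// poweR_convex.
Qed.

(** The doubling property: both exponents are at most [P], and [k >= 1]. *)
Lemma power_sumZ_le (k : R) (P : nat) x : (1 <= k)%R -> (q <= P%:R)%R ->
  0 <= x -> G (k%:E * x) <= (k ^+ P)%:E * G x.
Proof.
move=> k1 qP x0; have k0 : (0 <= k)%R by rewrite (le_trans _ k1).
have kP r : (r <= P%:R)%R -> k%:E `^ r <= (k ^+ P)%:E.
  by move=> rP; rewrite poweR_EFin lee_fin -powR_mulrn// ler_powR.
rewrite /power_sum ge0_muleDr ?mule_ge0 ?poweR_ge0//.
rewrite !(muleCA (k ^+ P)%:E) !poweRM ?lee_fin//.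
by rewrite leeD// lee_wpmul2l// lee_wpmul2r ?poweR_ge0// kP// ltW// (lt_le_trans pq).
Qed.

(** The counterpart from below; with [r > 1] it is the source of coercivity. *)
Lemma power_sumZ_ge (k r : R) x : (1 <= k)%R -> (r <= p)%R ->
  0 <= x -> (k `^ r)%:E * G x <= G (k%:E * x).
Proof.
move=> k1 rp x0; have k0 : (0 <= k)%R by rewrite (le_trans _ k1).
have kP s : (r <= s)%R -> (k `^ r)%:E <= k%:E `^ s.
  by move=> rs; rewrite poweR_EFin lee_fin ler_powR.
rewrite /power_sum ge0_muleDr ?mule_ge0 ?poweR_ge0//.
rewrite !(muleCA (k `^ r)%:E) !poweRM ?lee_fin//.
rewrite leeD// lee_wpmul2l// lee_wpmul2r ?poweR_ge0// kP//.
by rewrite (le_trans rp) ?ltW.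
Qed.

(** Each power of the supremum is at most the sum of the powers. This lets a supremum of countably
    many functions keep a finite modular. *)
Lemma power_sum_sup (u : nat -> \bar R) : (forall n, 0 <= u n) ->
  G (ereal_sup (range u)) <= \sum_(0 <= n <oo) G (u n).
Proof.
move=> u0.
have h (d r : R) : (0 <= d)%R -> (0 < r)%R ->
    d%:E * ereal_sup (range u) `^ r <= \sum_(0 <= n <oo) d%:E * u n `^ r.
  move=> d0 r0; rewrite nneseriesZl; last by move=> n _; rewrite poweR_ge0.
  rewrite lee_wpmul2l ?lee_fin//; apply: le_ereal_sup_poweR => // n.
  apply: le_trans (nneseries_lim_ge n.+1 _) => [|k _ _]; last exact: poweR_ge0.
  by rewrite big_nat_recr//= leeDr// sume_ge0// => k _; exact: poweR_ge0.
rewrite /power_sum nneseriesD; last 2 first.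
- by move=> n _ _; rewrite mule_ge0// poweR_ge0.
- by move=> n _ _; rewrite mule_ge0// poweR_ge0.
by rewrite leeD ?h// ltW.
Qed.

End power_sum.

(** * Measurability of powers with variable exponents *)

Section measurable_variable_exponent.
Context d (T : measurableType d) {R : realType}.

Lemma measurable_fun_powR_exponent (D : set T) (f g : T -> R) :
  measurable D -> measurable_fun D f -> measurable_fun D g ->
  measurable_fun D (fun x => f x `^ g x).
Proof.
move=> mD mf mg; rewrite /powR.
have mc (c : R) : measurable_fun D (cst c) by exact: measurable_cst.
apply: measurable_fun_if => //.
- exact: measurable_fun_eqr.
- apply: (@measurable_funS _ _ _ _ D) => //.
  rewrite (_ : (fun _ => _) = fun x => if g x == 0 then 1%R else 0%R); last first.
    by apply/funext => x; case: ifPn.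
  by apply: measurable_fun_if => //; exact: measurable_fun_eqr.
- apply: (@measurable_funS _ _ _ _ D) => //.
  apply: measurableT_comp; first exact: measurable_expR.
  by apply: measurable_funM => //; exact: measurableT_comp.
Qed.

Lemma measurable_fun_poweR_exponent (D : set T) (f : T -> \bar R) (g : T -> R) :
  measurable D -> measurable_fun D f -> measurable_fun D g ->
  (forall x, D x -> g x != 0) ->
  measurable_fun D (fun x => (f x `^ g x)%E).
Proof.
move=> mD mf mg g0.
have mc (c : \bar R) : measurable_fun D (cst c) by exact: measurable_cst.
apply: (@eq_measurable_fun _ _ _ _ _ (fun x =>
    if f x == +oo%E then +oo%E else if f x == -oo%E then 0%E else
    (fine (f x) `^ g x)%:E)).
  by move=> x /[!inE] /g0 gx0; rewrite poweRE (negbTE gx0).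
apply: measurable_fun_if => //; first exact: measurable_fun_eqe.
apply: (@measurable_funS _ _ _ _ D) => //.
apply: measurable_fun_if => //; first exact: measurable_fun_eqe.
apply: (@measurable_funS _ _ _ _ D) => //.
apply/measurable_EFinP; apply: measurable_fun_powR_exponent => //.
by apply: (measurable_comp (F := setT)) => //; exact: fine_measurable.
Qed.

(* The integral of a nonnegative function is a supremum over simple functions
   below it, hence monotone even when the functions are not measurable. *)
Lemma ge0_le_lower_integral (mu : {measure set T -> \bar R}) (D : set T)
  (f g : T -> \bar R) : (forall x, D x -> 0%E <= f x)%E ->
  (forall x, D x -> f x <= g x)%E ->
  (\int[mu]_(x in D) f x <= \int[mu]_(x in D) g x)%E.
Proof.
move=> f0 fg; rewrite !ge0_integralE//; last first.
  by move=> x Dx; rewrite (le_trans (f0 _ Dx)) ?fg.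
apply: ereal_sup_le => _ [h hf <-]; exists h => // x.
rewrite (le_trans (hf x))// /patch; case: ifPn => // xD; apply: fg.
by rewrite inE in xD.
Qed.

End measurable_variable_exponent.

(** * Generalized Orlicz functions, modulars and Luxemburg norms *)

Section musielak_orlicz.
Local Open Scope ereal_scope.
Context {R : realType} {X : completeMetricType R}.
Implicit Types (m : {outer_measure set X -> \bar R}) (D : set X)
  (Phi : X -> \bar R -> \bar R) (u v w f : X -> \bar R).

Lemma ae_onS m D (A B : X -> Prop) : (forall x, D x -> A x -> B x) ->
  ae_on m D A -> ae_on m D B.
Proof.
have FF := ae_filter_ringOfSetsType
  (m : {measure set (caratheodory_type m) -> \bar R}).
by move=> AB; rewrite /ae_on; apply: filterS => x Ax Dx; apply: AB => //; exact: Ax.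
Qed.

Lemma ae_onS2 m D (A B C : X -> Prop) :
  (forall x, D x -> A x -> B x -> C x) ->
  ae_on m D A -> ae_on m D B -> ae_on m D C.
Proof.
have FF := ae_filter_ringOfSetsType
  (m : {measure set (caratheodory_type m) -> \bar R}).
move=> ABC; rewrite /ae_on; apply: filterS2 => x Ax Bx Dx.
by apply: ABC => //; [exact: Ax|exact: Bx].
Qed.

Lemma ae_onW m D (A : X -> Prop) : (forall x, D x -> A x) -> ae_on m D A.
Proof. by move=> A_; apply: aeW => x; exact: A_. Qed.

(** An interface shared by the double-phase function and the energy density. The growth bound is
    only a.e. because the exponents are only essentially bounded. *)
Record orlicz_function m D Phi (P : nat) : Prop := OrliczFunction {
  orlicz_function0 : forall x, D x -> Phi x 0 = 0 ;
  orlicz_function_le : forall x xi eta, D x -> 0 <= xi -> xi <= eta ->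
    Phi x xi <= Phi x eta ;
  orlicz_function_convex : forall x (t : R) xi eta, D x -> (0 <= t <= 1)%R ->
    0 <= xi -> 0 <= eta ->
    Phi x (t%:E * xi + (1 - t)%:E * eta) <=
    t%:E * Phi x xi + (1 - t)%:E * Phi x eta ;
  orlicz_function_lty : forall x (t : R), D x -> Phi x t%:E < +oo ;
  orlicz_functiony : forall x, D x -> Phi x +oo = +oo ;
  orlicz_function_measurable : forall u, measurable_on m D u ->
    (forall x, D x -> 0 <= u x) -> measurable_on m D (fun x => Phi x (u x)) ;
  orlicz_function_growth : ae_on m D (fun x => forall (k : R) xi, (1 <= k)%R ->
    0 <= xi -> Phi x (k%:E * xi) <= (k ^+ P)%:E * Phi x xi) ;
  orlicz_function_sup : forall x (s : nat -> \bar R), D x ->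
    (forall n, 0 <= s n) ->
    Phi x (ereal_sup (range s)) <= \sum_(0 <= n <oo) Phi x (s n) }.

Context {m : {outer_measure set X -> \bar R}} {D : set X}
  {Phi : X -> \bar R -> \bar R} {P : nat}.
Hypotheses (mD : m.-cara.-measurable D) (oPhi : orlicz_function m D Phi P).

Local Notation rho := (modular m D Phi).
Local Notation lux := (luxemburg_norm m D Phi).

Lemma orlicz_function_ge0 x xi : D x -> 0 <= xi -> 0 <= Phi x xi.
Proof.
by move=> Dx xi0; rewrite -(orlicz_function0 oPhi Dx) (orlicz_function_le oPhi).
Qed.

Lemma measurable_modular u : measurable_on m D u ->
  measurable_on m D (fun x => Phi x `|u x|).
Proof.
move=> mu'; apply: (orlicz_function_measurable oPhi) => //.
exact: measurableT_comp.
Qed.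

Lemma modular_ge0 u : 0 <= rho u.
Proof. by apply: integral_ge0 => x Dx; exact: orlicz_function_ge0. Qed.

Lemma modular_le_ae u v : measurable_on m D u -> measurable_on m D v ->
  ae_on m D (fun x => `|u x| <= `|v x|) -> rho u <= rho v.
Proof.
move=> mu' mv uv; apply: ae_ge0_le_integral => //.
- by move=> x Dx; exact: orlicz_function_ge0.
- exact: measurable_modular.
- by move=> x Dx; exact: orlicz_function_ge0.
- exact: measurable_modular.
by apply: ae_onS uv => x Dx uv; apply: (orlicz_function_le oPhi) => //.
Qed.

(** The bound on [w] is an a.e. inequality rather than an equality because minimal gradients of
    convex combinations satisfy no more than that. *)
Lemma modular_convex_ae (t : R) u v w : measurable_on m D u ->
  measurable_on m D v -> measurable_on m D w -> (0 <= t <= 1)%R ->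
  ae_on m D (fun x => `|w x| <= t%:E * `|u x| + (1 - t)%:E * `|v x|) ->
  rho w <= t%:E * rho u + (1 - t)%:E * rho v.
Proof.
move=> mu' mv mw t01 wuv; have [t0 t1] := andP t01.
have t1' : (0 <= 1 - t)%R by rewrite subr_ge0.
have Phi0 f x : D x -> 0 <= Phi x `|f x|.
  by move=> Dx; exact: orlicz_function_ge0.
rewrite /modular /integral_on -!ge0_integralZl_EFin//; last 4 first.
- by move=> x Dx; exact: Phi0.
- exact: measurable_modular.
- by move=> x Dx; exact: Phi0.
- exact: measurable_modular.
have mZ (c : R) f : measurable_on m D f ->
    measurable_fun (D : set (caratheodory_type m)) (fun x => c%:E * Phi x `|f x|).
  by move=> mf; apply: measurable_funeM; exact: measurable_modular.
rewrite -ge0_integralD//; last 4 first.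
- by move=> x Dx; rewrite mule_ge0// ?lee_fin// Phi0.
- exact: mZ.
- by move=> x Dx; rewrite mule_ge0// ?lee_fin// Phi0.
- exact: mZ.
apply: ae_ge0_le_integral => //.
- by move=> x Dx; exact: Phi0.
- exact: measurable_modular.
- by move=> x Dx; rewrite adde_ge0// mule_ge0// ?lee_fin// Phi0.
- by apply: emeasurable_funD; exact: mZ.
apply: ae_onS wuv => x Dx wuv.
apply: le_trans (orlicz_function_convex oPhi Dx t01 _ _) => //.
by apply: (orlicz_function_le oPhi) => //.
Qed.

Lemma measurable_scale (c : R) u : measurable_on m D u ->
  measurable_on m D (fun x => c%:E * u x).
Proof. by move=> mu'; apply: measurable_funeM. Qed.

(** Convexity against the zero function, whose modular vanishes. *)
Lemma modularZ_le (t : R) u w : measurable_on m D u -> measurable_on m D w ->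
  (0 <= t <= 1)%R -> ae_on m D (fun x => `|w x| <= t%:E * `|u x|) ->
  rho w <= t%:E * rho u.
Proof.
move=> mu' mw t01 wu.
have -> : t%:E * rho u = t%:E * rho u + (1 - t)%:E * rho (cst 0).
  rewrite /modular /integral_on [X in _ + _ * X]integral0_eq ?mule0 ?adde0//.
  by move=> x Dx; rewrite abse0 (orlicz_function0 oPhi).
apply: modular_convex_ae => //; first exact: measurable_cst.
by apply: ae_onS wu => x Dx wu; rewrite abse0 mule0 adde0 .
Qed.

Lemma modular_growth (k : R) u w : measurable_on m D u -> measurable_on m D w ->
  (1 <= k)%R -> ae_on m D (fun x => `|w x| <= k%:E * `|u x|) ->
  rho w <= (k ^+ P)%:E * rho u.
Proof.
move=> mu' mw k1 wu; have k0 : (0 <= k)%R by rewrite (le_trans _ k1).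
have Phi0 f x : D x -> 0 <= Phi x `|f x|.
  by move=> Dx; exact: orlicz_function_ge0.
rewrite /modular /integral_on -ge0_integralZl_EFin//; last 3 first.
- by move=> x Dx; exact: Phi0.
- exact: measurable_modular.
- exact: exprn_ge0.
apply: ae_ge0_le_integral => //.
- by move=> x Dx; exact: Phi0.
- exact: measurable_modular.
- by move=> x Dx; rewrite mule_ge0// ?lee_fin ?exprn_ge0// Phi0.
- by apply: measurable_funeM; exact: measurable_modular.
apply: ae_onS2 wu (orlicz_function_growth oPhi) => x Dx wu gr.
apply: le_trans (gr k _ k1 _) => //.
by apply: (orlicz_function_le oPhi) => //.
Qed.

Lemma luxemburg_ge0 u : 0 <= lux u.
Proof. by apply: le_ereal_inf_tmp => _ [t [t0 _] <-]; rewrite lee_fin ltW. Qed.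

Lemma luxemburg_le u (t : R) : (0 < t)%R -> rho (fun x => (t^-1)%:E * u x) <= 1 ->
  lux u <= t%:E.
Proof. by move=> t0 ut; apply: ereal_inf_lbound; exists t. Qed.

Lemma luxemburg_lt u (t : R) : measurable_on m D u -> lux u < t%:E ->
  (0 < t)%R /\ rho (fun x => (t^-1)%:E * u x) <= 1.
Proof.
move=> mu' /ereal_inf_lt[_ [s [s0 us] <-]]; rewrite lte_fin => st.
have t0 : (0 < t)%R by exact: lt_trans st.
split => //; apply: le_trans us; apply: modular_le_ae.
- exact: measurable_scale.
- exact: measurable_scale.
apply: ae_onW => x Dx; rewrite !abseM lee_wpmul2r// !abse_EFin lee_fin.
by rewrite !gtr0_norm ?invr_gt0// lef_pV2// ?posrE// ltW.
Qed.

Lemma luxemburg_lty u : measurable_on m D u -> rho u < +oo -> lux u < +oo.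
Proof.
move=> mu' urho; pose t := Num.max 1%R (fine (rho u)).
have t1 : (1 <= t)%R by rewrite le_max lexx.
have t0 : (0 < t)%R by rewrite (lt_le_trans _ t1).
apply: le_lt_trans (luxemburg_le t0 _) (ltry t).
apply: (@le_trans _ _ ((t^-1)%:E * rho u)).
  apply: modularZ_le => //; first exact: measurable_scale.
    by rewrite invr_ge0 (ltW t0)/= invf_le1.
  by apply: ae_onW => x Dx; rewrite abseM abse_EFin gtr0_norm// invr_gt0.
rewrite lee_pdivrMl// mule1 -[leLHS]fineK ?lee_fin ?le_max ?lexx ?orbT//.
by rewrite ge0_fin_numE ?modular_ge0.
Qed.

Lemma luxemburg_fin_num u : measurable_on m D u -> rho u < +oo ->
  lux u \is a fin_num.
Proof. by move=> mu' ru; rewrite ge0_fin_numE ?luxemburg_ge0// luxemburg_lty. Qed.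

Lemma le_mul_luxemburg u (M : R) (y : \bar R) : (0 <= M)%R ->
  lux u \is a fin_num ->
  (forall t : R, lux u < t%:E -> y <= M%:E * t%:E) -> y <= M%:E * lux u.
Proof.
move=> M0 ufin uy; apply/lee_addgt0Pr => e e0.
have M1 : (0 < M + 1)%R by lra.
(* Dividing by [M + 1] instead of [M] covers [M = 0]. *)
apply: le_trans (uy (fine (lux u) + e / (M + 1))%R _) _.
  by rewrite -[ltLHS]fineK// lte_fin ltrDl divr_gt0.
rewrite -[in leRHS](fineK ufin) -!EFinM -EFinD lee_fin mulrDr lerD2l.
by rewrite mulrA ler_pdivrMr// mulrC ler_pM2l//; lra.
Qed.

Lemma luxemburg_scale_ae (c : R) u w : measurable_on m D u ->
  measurable_on m D w -> (0 <= c)%R -> lux u \is a fin_num ->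
  ae_on m D (fun x => `|w x| <= c%:E * `|u x|) -> lux w <= c%:E * lux u.
Proof.
move=> mu' mw c0 ufin wu; apply: le_mul_luxemburg => // t ut.
have [t0 urho] := luxemburg_lt mu' ut.
apply/lee_addgt0Pr => e e0; rewrite -EFinM -EFinD.
(* The summand [e] keeps the scaling factor positive when [c = 0]. *)
have cte : (0 < c * t + e)%R by rewrite ltr_wpDl// mulr_ge0// ltW.
apply: luxemburg_le => //; apply: le_trans urho; apply: modular_le_ae.
- exact: measurable_scale.
- exact: measurable_scale.
apply: ae_onS wu => x Dx wu; rewrite !abseM !abse_EFin !gtr0_norm ?invr_gt0//.
apply: le_trans (lee_wpmul2l _ wu) _; first by rewrite lee_fin invr_ge0 ltW.
rewrite muleA lee_wpmul2r// -EFinM lee_fin mulrC ler_pdivrMr// mulrC.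
by rewrite -ler_pdivrMr ?invr_gt0// invrK; lra.
Qed.

Lemma luxemburg_triangle_ae u v w : measurable_on m D u ->
  measurable_on m D v -> measurable_on m D w ->
  lux u \is a fin_num -> lux v \is a fin_num ->
  ae_on m D (fun x => `|w x| <= `|u x| + `|v x|) -> lux w <= lux u + lux v.
Proof.
move=> mu' mv mw ufin vfin wuv.
have le1 (a b : \bar R) (r : R) : a \is a fin_num ->
    (forall t : R, a < t%:E -> b <= t%:E + r%:E) -> b <= a + r%:E.
  move=> afin h; apply/lee_addgt0Pr => e e0.
  apply: le_trans (h (fine a + e)%R _) _.
    by rewrite -[ltLHS]fineK// lte_fin ltrDl.
  by rewrite -[in leRHS](fineK afin) -!EFinD lee_fin; lra.
rewrite -(fineK vfin); apply: (le1 _ _ _ ufin) => s us.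
rewrite fineK// addeC; apply: (le1 _ _ _ vfin) => t vt.
have [s0 urho] := luxemburg_lt mu' us.
have [t0 vrho] := luxemburg_lt mv vt.
have st0 : (0 < t + s)%R by rewrite addr_gt0.
rewrite -EFinD; apply: luxemburg_le => //.
(* With this weight, [(u + v) / (t + s)] is the convex combination of [u / s] and [v / t], both of
   modular at most 1. *)
pose l := (s / (t + s))%R.
have l01 : (0 <= l <= 1)%R.
  by rewrite divr_ge0 ?(ltW s0) ?(ltW st0)//= ler_pdivrMr// mul1r; lra.
have l1 : (1 - l = t / (t + s))%R.
  by rewrite /l -[in LHS](@divff _ (t + s)%R) ?gt_eqF// -mulrBl addrK.
apply: (@le_trans _ _ (l%:E * rho (fun x => (s^-1)%:E * u x) +
    (1 - l)%:E * rho (fun x => (t^-1)%:E * v x))).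
  apply: modular_convex_ae => //; rewrite ?l1; try exact: measurable_scale.
  apply: ae_onS wuv => x Dx wuv.
  rewrite !abseM !abse_EFin !gtr0_norm ?invr_gt0// !muleA -!EFinM.
  have -> : (l / s = (t + s)^-1)%R.
    by rewrite /l mulrAC divff ?gt_eqF// mul1r.
  have -> : (t / (t + s) / t = (t + s)^-1)%R.
    by rewrite mulrAC divff ?gt_eqF// mul1r.
  rewrite -ge0_muleDr// lee_wpmul2l // lee_fin invr_ge0 ltW//.
have [l0 l_le1] := andP l01.
have -> : 1 = l%:E * 1 + (1 - l)%:E * 1 :> \bar R.
  by rewrite !mule1 -EFinD addrC subrK.
by rewrite leeD// lee_wpmul2l// lee_fin ?subr_ge0.
Qed.

(* A Hoelder inequality: [k x] plays the role of the complementary function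
   evaluated at [f x]. *)
Lemma integrable_orlicz_dual (k : X -> \bar R) f u : measurable_on m D f ->
  (forall x, D x -> 0 <= k x) -> integral_on m D k < +oo ->
  (forall x xi, D x -> 0 <= xi -> `|f x| * xi <= k x + Phi x xi) ->
  orlicz_space m D Phi u ->
  integrable_on m D (fun x => f x * u x) /\
  integral_on m D (fun x => `|f x * u x|) <= integral_on m D k + rho u.
Proof.
move=> mf k0 kfin young [mu' urho].
(* [k] carries no measurability: for the trace it is a supremum over all [s >= 0]. The measurable
   [h] lies below [k], still satisfies the Young inequality, and its integral is compared with that
   of [k] as a lower integral. *)
pose h x := maxe 0 (`|f x * u x| - Phi x `|u x|).
have mfu : measurable_on m D (fun x => f x * u x) by exact: emeasurable_funM.
have mafu : measurable_on m D (fun x => `|f x * u x|) by exact: measurableT_comp.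
have mPhi := measurable_modular mu'.
have mh : measurable_on m D h.
  by apply: measurable_maxe; [exact: measurable_cst|exact: emeasurable_funB].
have Phi0 x : D x -> 0 <= Phi x `|u x| by move=> Dx; exact: orlicz_function_ge0.
have h0 x : 0 <= h x by rewrite le_max lexx.
have hk x : D x -> h x <= k x.
  move=> Dx; rewrite ge_max k0//=; have := young x `|u x| Dx (abse_ge0 _).
  rewrite -abseM; move: (Phi0 _ Dx); case: (Phi x `|u x|) => [r| |]// _.
    by move=> ?; rewrite leeBlDr.
  by rewrite addeNy => _; rewrite leNye.
have fu x : D x -> `|f x * u x| <= h x + Phi x `|u x|.
  move=> Dx; rewrite /h; move: (Phi0 _ Dx); case: (Phi x `|u x|) => [r| |]// _.
    by rewrite -leeBlDr// le_max lexx orbT.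
  by rewrite addey ?leey// gt_eqF// (@lt_le_trans _ _ 0)// le_max lexx.
have bound : integral_on m D (fun x => `|f x * u x|) <= integral_on m D k + rho u.
  apply: (@le_trans _ _ (integral_on m D (fun x => h x + Phi x `|u x|))).
    by apply: ge0_le_integral => //; exact: emeasurable_funD.
  rewrite /integral_on ge0_integralD//; rewrite leeD2r//.
  exact: ge0_le_lower_integral.
split => //; apply/integrableP; split => //.
by rewrite (le_lt_trans bound)// lte_add_pinfty.
Qed.

(** For [t] above the norm, [u / t] has modular at most 1, so the Young inequality bounds the
    integral of [|f * u|] by [t] times the integral of [k] plus 1; then [t] decreases to the
    norm. *)
Lemma orlicz_dual_bound (k : X -> \bar R) f u : measurable_on m D f ->
  (forall x, D x -> 0 <= k x) -> integral_on m D k < +oo ->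
  (forall x xi, D x -> 0 <= xi -> `|f x| * xi <= k x + Phi x xi) ->
  orlicz_space m D Phi u ->
  `|integral_on m D (fun x => f x * u x)| <=
  (fine (integral_on m D k) + 1)%:E * lux u.
Proof.
move=> mf k0 kfin young uL; have [mu' urho] := uL.
have kint0 : 0 <= integral_on m D k by exact: integral_ge0.
have kfin' : integral_on m D k \is a fin_num by rewrite ge0_fin_numE.
have M0 : (0 <= fine (integral_on m D k) + 1)%R by rewrite addr_ge0// fine_ge0.
apply: le_mul_luxemburg => //; first exact: luxemburg_fin_num.
move=> t ut; have [t0 utrho] := luxemburg_lt mu' ut.
have utL : orlicz_space m D Phi (fun x => (t^-1)%:E * u x).
  by split; [exact: measurable_scale|exact: le_lt_trans utrho (ltry _)].
have [fuint _] := integrable_orlicz_dual mf k0 kfin young uL.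
have [_ b] := integrable_orlicz_dual mf k0 kfin young utL.
apply: le_trans (le_abse_integral _ _ _) _ => //.
  by have /integrableP[] := fuint.
rewrite muleC -lee_pdivrMl// -ge0_integralZl_EFin//; last 2 first.
  by apply: measurableT_comp => //; have /integrableP[] := fuint.
  by rewrite invr_ge0 ltW.
rewrite EFinD fineK//; apply: le_trans (le_trans b _); last by rewrite leeD2l.
rewrite /integral_on le_eqVlt; apply/orP; left; apply/eqP.
apply: eq_integral => x _.
by rewrite [in RHS]muleCA [in RHS]abseM abse_EFin gtr0_norm ?invr_gt0.
Qed.

Lemma orlicz_space_ae_fin_num u : orlicz_space m D Phi u ->
  ae_on m D (fun x => u x \is a fin_num).
Proof.
move=> [mu' urho].
have : integrable_on m D (fun x => Phi x `|u x|).
  apply/integrableP; split; first exact: measurable_modular.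
  apply: le_lt_trans urho; rewrite /modular /integral_on le_eqVlt; apply/orP.
  left; apply/eqP/eq_integral => x /[!inE] Dx.
  by rewrite gee0_abs// orlicz_function_ge0.
move=> /(integrable_ae mD); apply: filterS => x h Dx; have := h Dx.
by case: (u x) => //=; rewrite (orlicz_functiony oPhi).
Qed.

End musielak_orlicz.

(** * The double-phase function, the energy density and the complementary function *)

Section double_phase_orlicz.
Local Open Scope ereal_scope.
Context {R : realType} {X : completeMetricType R}.
Implicit Types (m : {outer_measure set X -> \bar R}) (D E : set X)
  (p q a b c : X -> R).

(** The essential bounds in usable form: a real [p0 > 1] below [p], which drives coercivity, and a
    natural number [P] above [q], which drives the growth bounds. *)
Record double_phase_on m D p q a (p0 : R) (P : nat) : Prop := DoublePhaseOn {
  double_phase_measurable_p : measurable_fun (D : set (caratheodory_type m)) p ;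
  double_phase_measurable_q : measurable_fun (D : set (caratheodory_type m)) q ;
  double_phase_measurable_a : measurable_fun (D : set (caratheodory_type m)) a ;
  double_phase_gt1 : forall x, D x -> (1 < p x)%R ;
  double_phase_lt : forall x, D x -> (p x < q x)%R ;
  double_phase_ge0 : forall x, D x -> (0 <= a x)%R ;
  double_phase_lower_gt1 : (1 < p0)%R ;
  double_phase_lower : ae_on m D (fun x => (p0 <= p x)%R) ;
  double_phase_upper : ae_on m D (fun x => (q x <= P%:R)%R) }.

Lemma double_phase_dataW m E D p q a : m.-cara.-measurable E ->
  m.-cara.-measurable D -> D `<=` E -> double_phase_data m E p q a ->
  exists (p0 : R) (P : nat), double_phase_on m D p q a p0 P.
Proof.
move=> mE mD DE [[/measurable_EFinP mp /measurable_EFinP mq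
  /measurable_EFinP ma] pq [pinf _] [_ qsup] [a0 _]].
have aeDE A : ae_on m E A -> ae_on m D A.
  have FF := ae_filter_ringOfSetsType
    (m : {measure set (caratheodory_type m) -> \bar R}).
  by rewrite /ae_on; apply: filterS => x Ax Dx; apply: Ax; exact: DE.
have [y pE y1] : exists2 y, ae_on m E (fun x => y <= (p x)%:E) & 1 < y.
  by move: pinf => /ereal_sup_gt[y]; exists y.
have [z qE zy] : exists2 z, ae_on m E (fun x => (q x)%:E <= z) & z < +oo.
  by move: qsup => /ereal_inf_lt[z]; exists z.
have [p0 p01 p0y] : exists2 p0 : R, (1 < p0)%R & p0%:E <= y.
  (* An infinite [y] can only occur when [E] is negligible; then any exponent above 1 serves. *)
  case: y y1 {pE} => [r| |]//; first by rewrite lte_fin; exists r.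
  by exists 2%R; rewrite ?leey// ltr1n.
have [P zP] : exists P : nat, z <= P%:R%:E.
  case: z zy {qE} => [r| |]// _; last by exists 0%N; rewrite leNye.
  by exists (Num.bound `|r|); rewrite lee_fin (le_trans (ler_norm _))// ltW// archi_boundP.
exists p0, P; split.
- exact: measurable_funS mp.
- exact: measurable_funS mq.
- exact: measurable_funS ma.
- by move=> x /DE/pq[].
- by move=> x /DE/pq[].
- by move=> x /DE/a0.
- by [].
- by apply: ae_onS (aeDE _ pE) => x _ yp; rewrite -lee_fin (le_trans p0y).
- by apply: ae_onS (aeDE _ qE) => x _ qz; rewrite -lee_fin (le_trans qz).
Qed.

Context {m : {outer_measure set X -> \bar R}} {D : set X} {p q a : X -> R}
  {p0 : R} {P : nat}.
Hypotheses (mD : m.-cara.-measurable D) (dp : double_phase_on m D p q a p0 P).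

Lemma orlicz_power_sum b c (Phi : X -> \bar R -> \bar R) :
  (forall x xi, Phi x xi = power_sum (b x) (c x) (p x) (q x) xi) ->
  measurable_fun (D : set (caratheodory_type m)) b ->
  measurable_fun (D : set (caratheodory_type m)) c ->
  (forall x, D x -> (0 < b x)%R) -> (forall x, D x -> (0 <= c x)%R) ->
  orlicz_function m D Phi P.
Proof.
move=> PhiE mb mc b0 c0; case: dp => mp mq _ p1 pq _ _ _ qP.
split.
- by move=> x Dx; rewrite PhiE power_sum0 ?p1 ?pq.
- by move=> x xi eta Dx ? ?; rewrite !PhiE le_power_sum ?b0 ?c0 ?p1 ?pq.
- by move=> x t xi eta Dx *; rewrite !PhiE power_sum_convex ?b0 ?c0 ?p1 ?pq.
- by move=> x t Dx; rewrite PhiE power_sum_lty.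
- by move=> x Dx; rewrite PhiE power_sumy ?b0 ?c0 ?p1 ?pq.
- move=> u mu u0; rewrite (_ : (fun _ => _) = fun x => (b x)%:E * u x `^ p x +
      (c x)%:E * u x `^ q x); last by apply/funext => x; rewrite PhiE.
  apply: emeasurable_funD; apply: emeasurable_funM.
  + exact/measurable_EFinP.
  + apply: measurable_fun_poweR_exponent => // x Dx.
    by rewrite gt_eqF// (lt_trans ltr01)// p1.
  + exact/measurable_EFinP.
  + apply: measurable_fun_poweR_exponent => // x Dx.
    by rewrite gt_eqF// (lt_trans ltr01)// (lt_trans (p1 _ Dx))// pq.
- apply: ae_onS qP => x Dx qP k xi k1 xi0.
  by rewrite !PhiE; apply: power_sumZ_le; rewrite ?b0 ?c0 ?p1 ?pq.
- move=> x s Dx s0; rewrite PhiE.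
  apply: le_trans (power_sum_sup _ _ _ _ _) _; rewrite ?b0 ?c0 ?p1 ?pq//.
  by apply: lee_nneseries => n _ //=; rewrite ?PhiE// power_sum_ge0 ?b0 ?c0 ?p1 ?pq.
Qed.

Lemma double_phaseE x xi :
  double_phase p q a x xi = power_sum 1 (a x) (p x) (q x) xi.
Proof. by rewrite /power_sum mul1e. Qed.

Lemma energy_densityE x xi : energy_density p q a x xi =
  power_sum (p x)^-1 (a x * (q x)^-1) (p x) (q x) xi.
Proof.
rewrite /energy_density /power_sum [in LHS]muleC; congr (_ + _).
by rewrite [in RHS]EFinM -muleA; congr (_ * _); rewrite muleC.
Qed.

Lemma double_phase_orlicz : orlicz_function m D (double_phase p q a) P.
Proof.
apply: orlicz_power_sum double_phaseE _ _ _ _.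
- exact: measurable_cst.
- exact: double_phase_measurable_a dp.
- by [].
- exact: double_phase_ge0 dp.
Qed.

Lemma double_phase_gt0 x : D x -> (0 < p x)%R /\ (0 < q x)%R.
Proof.
move=> Dx; have p1 := double_phase_gt1 dp Dx.
have pq := double_phase_lt dp Dx; split; lra.
Qed.

Let measurable_funV (g : X -> R) :
  measurable_fun (D : set (caratheodory_type m)) g ->
  (forall x, D x -> (0 < g x)%R) ->
  measurable_fun (D : set (caratheodory_type m)) (fun x => (g x)^-1%R).
Proof.
move=> mg g0; apply: (@eq_measurable_fun _ _ (caratheodory_type m) R D (fun x => powR (g x) (- 1)%R)).
  by move=> x /[!inE] Dx; rewrite powRN powRr1// ltW// g0.
exact: (measurable_fun_powR_exponent _ mg (measurable_cst _)).
Qed.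

Lemma energy_density_orlicz : orlicz_function m D (energy_density p q a) P.
Proof.
apply: orlicz_power_sum energy_densityE _ _ _ _.
- apply: measurable_funV => [|x /double_phase_gt0[]//].
  exact: double_phase_measurable_p dp.
- apply: measurable_funM; first exact: double_phase_measurable_a dp.
  apply: measurable_funV => [|x /double_phase_gt0[]//].
  exact: double_phase_measurable_q dp.
- by move=> x /double_phase_gt0[px _]; rewrite invr_gt0.
- move=> x Dx; have [_ qx] := double_phase_gt0 Dx.
  by rewrite divr_ge0// ?(double_phase_ge0 dp)// ltW.
Qed.

(** Above 1, [xi] is at most [xi] to the power [p x]. On sets of finite measure this embeds the
    Orlicz space into the integrable functions. *)
Lemma double_phase_ge x xi : D x -> 0 <= xi -> xi <= 1 + double_phase p q a x xi.
Proof.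
move=> Dx xi0; have [xi1|xi1] := leP xi 1.
  by rewrite (le_trans xi1)// leeDl// (orlicz_function_ge0 double_phase_orlicz).
rewrite (@le_trans _ _ (double_phase p q a x xi))//; last by rewrite leeDr.
rewrite (@le_trans _ _ (xi `^ p x))//; last first.
  rewrite /double_phase leeDl// mule_ge0 ?poweR_ge0// lee_fin.
  exact: (double_phase_ge0 dp Dx).
case: xi xi0 xi1 => [r| |]// r0 r1; last first.
  by rewrite poweRyr// gt_eqF//; have [] := double_phase_gt0 Dx.
by apply: poweR_ge1; [exact/ltW/(double_phase_gt1 dp)|exact: ltW].
Qed.

Lemma energy_density_le x xi : D x -> 0 <= xi ->
  energy_density p q a x xi <= double_phase p q a x xi.
Proof.
move=> Dx xi0; have [px qx] := double_phase_gt0 Dx.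
have p1 := double_phase_gt1 dp Dx; have pq := double_phase_lt dp Dx.
rewrite leeD//.
  by rewrite -[leRHS]mule1 lee_wpmul2l ?poweR_ge0// lee_fin invf_le1// ltW.
rewrite lee_wpmul2l ?lee_fin ?(double_phase_ge0 dp)//.
rewrite -[leRHS]mule1 lee_wpmul2l ?poweR_ge0// lee_fin invf_le1// ltW//.
exact: lt_trans pq.
Qed.

(** Almost everywhere both exponents are at most [P], so dividing by them loses at most a factor
    [P]. *)
Lemma energy_density_ge : ae_on m D (fun x => forall xi, 0 <= xi ->
  double_phase p q a x xi <= P%:R%:E * energy_density p q a x xi).
Proof.
apply: ae_onS (double_phase_upper dp) => x Dx qP xi xi0.
have [px qx] := double_phase_gt0 Dx; have pq := double_phase_lt dp Dx.
have P0 : (0 <= P%:R :> R)%R by [].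
rewrite ge0_muleDr ?mule_ge0 ?poweR_ge0 ?lee_fin ?invr_ge0 ?(ltW px) ?(ltW qx)
  ?(double_phase_ge0 dp)//.
rewrite leeD//.
  rewrite muleCA -[leLHS]mule1 lee_wpmul2l ?poweR_ge0// -EFinM lee_fin.
  by rewrite ler_pdivlMr// mul1r; lra.
rewrite muleCA lee_wpmul2l ?lee_fin ?(double_phase_ge0 dp)//.
rewrite muleCA -[leLHS]mule1 lee_wpmul2l ?poweR_ge0// -EFinM lee_fin.
by rewrite ler_pdivlMr// mul1r.
Qed.

Lemma double_phase_lower_growth : ae_on m D (fun x => forall (k : R) xi,
  (1 <= k)%R -> 0 <= xi ->
  (k `^ p0)%:E * double_phase p q a x xi <= double_phase p q a x (k%:E * xi)).
Proof.
apply: ae_onS (double_phase_lower dp) => x Dx p0p k xi k1 xi0.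
have := double_phase_ge0 dp Dx; have := double_phase_lt dp Dx.
by rewrite !double_phaseE => *; exact: power_sumZ_ge.
Qed.

Lemma complementary_ge0 x xi : D x ->
  0 <= complementary (double_phase p q a) x xi.
Proof.
move=> Dx; have -> : 0 = 0%:E * xi - double_phase p q a x 0%:E.
  by rewrite mul0e (orlicz_function0 double_phase_orlicz Dx) sube0.
by apply: ereal_sup_ubound; exists 0%R => //=.
Qed.

Lemma complementary_young (f : X -> \bar R) x xi : D x -> 0 <= xi ->
  `|f x| * xi <= complementary (double_phase p q a) x `|f x| +
                 double_phase p q a x xi.
Proof.
have oPhi := double_phase_orlicz.
move=> Dx; case: xi => [s| |]//.
  rewrite lee_fin => s0; have := orlicz_function_lty oPhi s Dx.
  have : 0 <= double_phase p q a x s%:E.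
    by apply: (orlicz_function_ge0 oPhi); rewrite ?lee_fin.
  have : s%:E * `|f x| - double_phase p q a x s%:E <=
      complementary (double_phase p q a) x `|f x|.
    by apply: ereal_sup_ubound; exists s.
  case: (double_phase p q a x s%:E) => [r| |]// + _ _.
  by rewrite leeBlDr// muleC.
move=> _; rewrite (orlicz_functiony oPhi)// addey ?leey//.
by rewrite gt_eqF// (@lt_le_trans _ _ 0)// complementary_ge0.
Qed.

End double_phase_orlicz.

(** * Borel functions and their integrals along curves *)

Section borel_functions.
Local Open Scope ereal_scope.
Context {R : realType} {X : completeMetricType R} {Omega : set X}.
Hypothesis oO : open Omega.
Implicit Types (g h : X -> \bar R) (c : curve R X).

Local Notation borel_type := (g_sigma_algebraType (@open X)).

Let sdrop0 (T : Type) (s : nat -> T) : sdrop s 0%N = range s.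
Proof. by apply/seteqP; split => _ [n _ <-]; exists n. Qed.

Lemma measurable_open : measurable (Omega : set borel_type).
Proof. exact: sub_sigma_algebra. Qed.

Lemma nonneg_borelD g h : nonneg_borel Omega g -> nonneg_borel Omega h ->
  nonneg_borel Omega (fun x => g x + h x).
Proof.
move=> [mg g0] [mh h0]; split; first exact: emeasurable_funD.
by move=> x Ox; rewrite adde_ge0 ?g0 ?h0.
Qed.

Lemma nonneg_borelZ (k : R) g : (0 <= k)%R -> nonneg_borel Omega g ->
  nonneg_borel Omega (fun x => k%:E * g x).
Proof.
move=> k0 [mg g0]; split; first exact: measurable_funeM.
by move=> x Ox; rewrite mule_ge0 ?lee_fin ?g0.
Qed.

Lemma nonneg_borel_min g h : nonneg_borel Omega g -> nonneg_borel Omega h ->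
  nonneg_borel Omega (fun x => mine (g x) (h x)).
Proof.
move=> [mg g0] [mh h0]; split; first exact: measurable_mine.
by move=> x Ox; rewrite le_min g0 ?h0.
Qed.

Lemma nonneg_borel_sup (h : nat -> X -> \bar R) :
  (forall n, nonneg_borel Omega (h n)) ->
  nonneg_borel Omega (fun x => ereal_sup (range (h ^~ x))).
Proof.
move=> hb; split.
  have := @measurable_fun_esups _ borel_type R Omega h (fun n => (hb n).1) 0%N.
  by apply: eq_measurable_fun => x _; rewrite /esups/= sdrop0.
move=> x Ox; rewrite (le_trans ((hb 0%N).2 _ Ox))//.
by apply: ereal_sup_ubound; exists 0%N.
Qed.

Lemma nonneg_borel_inf (h : nat -> X -> \bar R) :
  (forall n, nonneg_borel Omega (h n)) ->
  nonneg_borel Omega (fun x => ereal_inf (range (h ^~ x))).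
Proof.
move=> hb; split.
  have := @measurable_fun_einfs _ borel_type R Omega h (fun n => (hb n).1) 0%N.
  by apply: eq_measurable_fun => x _; rewrite /einfs/= sdrop0.
by move=> x Ox; apply: le_ereal_inf_tmp => _ [n _ <-]; by apply: (hb n).2.
Qed.

Lemma nonneg_borel0 : nonneg_borel Omega (cst 0).
Proof. by split => //; exact: measurable_cst. Qed.

Lemma borel_measurable_on (m : {outer_measure set X -> \bar R}) g :
  borel_regular m -> borel_fun Omega g -> measurable_on m Omega g.
Proof.
move=> [bm _] mg mO B mB; apply: bm; exact: mg measurable_open _ mB.
Qed.

Section curve_integral.
Context {c : curve R X}.
Hypothesis rc : rectifiable_curve_in Omega c.
Local Notation I := (`[0%R, curve_len c]%classic : set R).

Lemma measurable_curve_param :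
  measurable_fun I (curve_param c : R -> borel_type).
Proof.
case: rc => _ /continuousP cc _ _.
apply: (@measurability _ _ R borel_type _ _ (@open X)) => // _ [V oV <-].
exact: (open_measurable_subspace _ (cc V oV)).
Qed.

Lemma curve_param_in t : I t -> Omega (curve_param c t).
Proof. by case: rc => _ _ + _; apply. Qed.

Lemma measurable_fun_curve h : borel_fun Omega h ->
  measurable_fun I (h \o curve_param c).
Proof.
move=> mh; apply: (measurable_comp (F := Omega : set borel_type)) => //.
- exact: measurable_open.
- by move=> _ [t It <-]; exact: curve_param_in.
- exact: measurable_curve_param.
Qed.

Lemma curve_integral_ge0 h : nonneg_borel Omega h -> 0 <= curve_integral c h.
Proof. by move=> [_ h0]; apply: integral_ge0 => t /curve_param_in/h0. Qed.

Lemma le_curve_integral g h : nonneg_borel Omega g -> nonneg_borel Omega h ->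
  (forall x, Omega x -> g x <= h x) -> curve_integral c g <= curve_integral c h.
Proof.
move=> [mg g0] [mh h0] gh; apply: ge0_le_integral => //.
- by move=> t /curve_param_in/g0.
- exact: measurable_fun_curve.
- exact: measurable_fun_curve.
- by move=> t /curve_param_in/gh.
Qed.

Lemma curve_integralZ (k : R) h : (0 <= k)%R -> nonneg_borel Omega h ->
  curve_integral c (fun x => k%:E * h x) = k%:E * curve_integral c h.
Proof.
move=> k0 [mh h0]; rewrite /curve_integral ge0_integralZl_EFin//.
- by move=> t /curve_param_in/h0.
- exact: measurable_fun_curve.
Qed.

Lemma curve_integralD g h : nonneg_borel Omega g -> nonneg_borel Omega h ->
  curve_integral c (fun x => g x + h x) = curve_integral c g + curve_integral c h.
Proof.
move=> [mg g0] [mh h0]; rewrite /curve_integral ge0_integralD//.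
- by move=> t /curve_param_in/g0.
- exact: measurable_fun_curve.
- by move=> t /curve_param_in/h0.
- exact: measurable_fun_curve.
Qed.

End curve_integral.

End borel_functions.

(** * Exceptional families of curves through control functions *)

Section exceptional_curves.
Local Open Scope ereal_scope.
Context {R : realType} {X : completeMetricType R}
  {mu : {outer_measure set X -> \bar R}} {Omega : set X}
  {Phi : X -> \bar R -> \bar R} {P : nat}.
Hypotheses (oO : open Omega) (bmu : borel_regular mu)
  (oPhi : orlicz_function mu Omega Phi P).
Implicit Types (g h : X -> \bar R) (c : curve R X) (Gamma : set (curve R X)).

Lemma caratheodory_open : mu.-cara.-measurable Omega.
Proof. by apply: bmu.1; exact: measurable_open. Qed.

Let mO := caratheodory_open.

Definition modular_finite h : Prop :=
  nonneg_borel Omega h /\ modular mu Omega Phi h < +oo.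

Lemma modularE h : nonneg_borel Omega h ->
  integral_on mu Omega (fun x => Phi x (h x)) = modular mu Omega Phi h.
Proof.
move=> [_ h0]; rewrite /modular /integral_on; apply: eq_integral => x /[!inE] Ox.
by rewrite gee0_abs ?h0.
Qed.

Lemma measurable_on_borel h : nonneg_borel Omega h -> measurable_on mu Omega h.
Proof. by move=> [mh _]; exact: borel_measurable_on. Qed.

(** The pointwise bound of a supremum by a series is integrated term by term. *)
Lemma modular_sup (h : nat -> X -> \bar R) :
  (forall n, nonneg_borel Omega (h n)) ->
  modular mu Omega Phi (fun x => ereal_sup (range (h ^~ x))) <=
  \sum_(0 <= n <oo) modular mu Omega Phi (h n).
Proof.
move=> hb; have sb := nonneg_borel_sup hb.
rewrite -modularE// (eq_eseriesr (g := fun n =>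
  integral_on mu Omega (fun x => Phi x (h n x)))); last first.
  by move=> n _; rewrite modularE.
have mPhi n : measurable_on mu Omega (fun x => Phi x (h n x)).
  apply: (orlicz_function_measurable oPhi); first exact: measurable_on_borel.
  by apply: (hb n).2.
have Phi0 n x : Omega x -> 0 <= Phi x (h n x).
  by move=> Ox; apply: (orlicz_function_ge0 oPhi) => //; by apply: (hb n).2.
rewrite /integral_on -integral_nneseries//; apply: ge0_le_integral => //.
- by move=> x Ox; apply: (orlicz_function_ge0 oPhi) => //; exact: sb.2.
- apply: (orlicz_function_measurable oPhi); first exact: measurable_on_borel.
  exact: sb.2.
- by apply: ge0_emeasurable_sum => [n x Ox _|n _]; [exact: Phi0|exact: mPhi].
- by move=> x Ox; apply: (orlicz_function_sup oPhi) => // n; apply: (hb n).2.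
Qed.

Lemma modular_half_pow (h : nat -> X -> \bar R) :
  (forall n, nonneg_borel Omega (h n)) ->
  (forall n, modular mu Omega Phi (h n) <= (2^-1 ^+ n)%:E) ->
  modular_finite (fun x => ereal_sup (range (h ^~ x))).
Proof.
move=> hb hn; split; first exact: nonneg_borel_sup.
apply: le_lt_trans (modular_sup hb) _.
apply: le_lt_trans (ltry 2%R).
(* The series of [2 / 2 ^ n.+1], that is of [2^-1 ^+ n], is at most 2. *)
apply: le_trans (@epsilon_trick0 R 2 xpredT (ler0n _ _)).
apply: lee_nneseries => n _; first by rewrite (modular_ge0 oPhi).
rewrite (le_trans (hn n))// lee_fin exprVn natrX exprS invfM mulrA divff//.
by rewrite mul1r.
Qed.

(* Take the supremum of [2 ^+ n * h n], with [h n] admissible and of modular so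
   small that the modulars of [2 ^+ n * h n] are summable. *)
Lemma modulus0_control Gamma : Gamma `<=` rectifiable_curve_in Omega ->
  modulus mu Omega Phi Gamma = 0 ->
  exists2 h, modular_finite h & forall c, Gamma c -> curve_integral c h = +oo.
Proof.
move=> GO mod0.
have exh n : exists h, [/\ nonneg_borel Omega h,
    forall c, Gamma c -> 1 <= curve_integral c h &
    modular mu Omega Phi h <= (2^-1 ^+ n / (2 ^+ n) ^+ P)%:E].
  have : modulus mu Omega Phi Gamma < (2^-1 ^+ n / (2 ^+ n) ^+ P)%:E.
    by rewrite mod0 lte_fin divr_gt0// exprn_gt0// exprn_gt0.
  move=> /ereal_inf_lt[_ [h [hb h1] <-] hn]; exists h; split => //.
  by rewrite -modularE// ltW.
have [h hP] := choice exh.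
have hb n : nonneg_borel Omega (h n) by case: (hP n).
have p2 n : (1 <= 2 ^+ n :> R)%R by rewrite exprn_ege1// ler1n.
have p20 n : (0 <= 2 ^+ n :> R)%R by rewrite exprn_ge0.
pose k n x := (2 ^+ n)%:E * h n x.
have kb n : nonneg_borel Omega (k n) by exact: nonneg_borelZ.
have kfin := modular_half_pow kb.
exists (fun x => ereal_sup (range (k ^~ x))).
  apply: kfin => n; case: (hP n) => _ _ hn.
  apply: (@le_trans _ _ (((2 ^+ n) ^+ P)%:E * modular mu Omega Phi (h n))).
    apply: (modular_growth mO oPhi) => //.
    - exact: measurable_on_borel.
    - exact: measurable_on_borel.
    by apply: ae_onW => x Ox; rewrite abseM gee0_abs ?lee_fin.
  apply: le_trans (lee_wpmul2l _ hn) _; first by rewrite lee_fin exprn_ge0.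
  by rewrite -EFinM lee_fin mulrC divfK// expf_neq0// expf_neq0.
move=> c Gc; apply: eq_infty => r.
have rc := GO _ Gc.
have [n rn] : exists n, (r <= 2 ^+ n)%R.
  exists (Num.bound `|r|); rewrite (le_trans (ler_norm r))//.
  by rewrite (le_trans (ltW (archi_boundP _)))// -natrX ler_nat ltnW// ltn_expl.
apply: (@le_trans _ _ (curve_integral c (k n))).
  rewrite (curve_integralZ oO rc)//.
  apply: (@le_trans _ _ ((2 ^+ n)%:E * 1)); first by rewrite mule1 lee_fin.
  by rewrite lee_wpmul2l ?lee_fin//; case: (hP n) => _ h1 _; exact: h1.
apply: (le_curve_integral oO rc) => //; first exact: nonneg_borel_sup.
by move=> x Ox; apply: ereal_sup_ubound; exists n.
Qed.

(** Every multiple [t * h] with [t > 0] is admissible, its line integrals being infinite, while by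
    convexity its modular is at most [t] times that of [h]. *)
Lemma control_modulus0 Gamma h : Gamma `<=` rectifiable_curve_in Omega ->
  modular_finite h -> (forall c, Gamma c -> curve_integral c h = +oo) ->
  modulus mu Omega Phi Gamma = 0.
Proof.
move=> GO [hb hfin] hG; apply/eqP; rewrite eq_le; apply/andP; split; last first.
  apply: le_ereal_inf_tmp => _ [k [kb _] <-]; apply: integral_ge0 => x Ox.
  by apply: (orlicz_function_ge0 oPhi) => //; exact: kb.2.
have hfin' : modular mu Omega Phi h \is a fin_num.
  by rewrite ge0_fin_numE ?(modular_ge0 oPhi).
set M := fine (modular mu Omega Phi h).
have M0 : (0 <= M)%R by rewrite fine_ge0// (modular_ge0 oPhi).
apply/lee_addgt0Pr => e e0; rewrite add0e.
(* Convexity needs [t <= 1]; the second entry makes [t * M] at most [e], also when [M = 0]. *)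
pose t := (Num.min 1 (e / (M + 1)))%R.
have t0 : (0 < t)%R by rewrite lt_min ltr01 divr_gt0//; lra.
have t1 : (t <= 1)%R by rewrite ge_min lexx.
have tb : nonneg_borel Omega (fun x => t%:E * h x).
  by apply: nonneg_borelZ => //; exact: ltW.
apply: (@le_trans _ _ (modular mu Omega Phi (fun x => t%:E * h x))).
  rewrite -modularE//; apply: ereal_inf_lbound; exists (fun x => t%:E * h x) => //.
  split => // c Gc; rewrite (curve_integralZ oO (GO _ Gc)) ?(ltW t0)//.
  by rewrite hG// gt0_muley ?lte_fin// leey.
apply: (@le_trans _ _ (t%:E * modular mu Omega Phi h)).
  apply: (modularZ_le mO oPhi) => //; try exact: measurable_on_borel.
    by rewrite (ltW t0) t1.
  by apply: ae_onW => x Ox; rewrite abseM gee0_abs ?lee_fin// ltW.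
rewrite -(fineK hfin') -/M -EFinM lee_fin.
apply: (@le_trans _ _ (e / (M + 1) * M)%R).
  by rewrite ler_wpM2r// ge_min lexx orbT.
by rewrite mulrAC ler_pdivrMr ?ler_pM2l//; lra.
Qed.

(** The sum is twice the midpoint: convexity controls the midpoint, the growth bound the factor
    2. *)
Lemma modular_finiteD g h : modular_finite g -> modular_finite h ->
  modular_finite (fun x => g x + h x).
Proof.
move=> [gb gfin] [hb hfin]; split; first exact: nonneg_borelD.
have mg := measurable_on_borel gb; have mh := measurable_on_borel hb.
have h2 : (2^-1 + 2^-1 = 1 :> R)%R by lra.
pose w x := (2^-1)%:E * (g x + h x).
have mw : measurable_on mu Omega w.
  by apply: measurable_scale; exact: emeasurable_funD.
apply: (@le_lt_trans _ _ ((2 ^+ P)%:E * modular mu Omega Phi w)).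
  apply: (modular_growth mO oPhi) => //; first exact: emeasurable_funD.
    by rewrite ler1n.
  apply: ae_onW => x Ox; rewrite /w abseM abse_EFin gtr0_norm ?invr_gt0//.
  by rewrite muleA -EFinM divff// mul1e.
rewrite lte_mul_pinfty ?lee_fin ?exprn_ge0//.
apply: (@le_lt_trans _ _ ((2^-1)%:E * modular mu Omega Phi g +
  (1 - 2^-1)%:E * modular mu Omega Phi h)).
  apply: (modular_convex_ae mO oPhi) => //; first by apply/andP; split; lra.
  apply: ae_onW => x Ox; have -> : (1 - 2^-1 = 2^-1 :> R)%R by lra.
  rewrite /w abseM abse_EFin gtr0_norm ?invr_gt0// -ge0_muleDr//.
  by rewrite lee_wpmul2l ?lee_fin ?invr_ge0//; exact: lee_abs_add.
by rewrite lte_add_pinfty// lte_mul_pinfty// lee_fin; lra.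
Qed.

(** A countable union of exceptional families is exceptional. The [h n] are scaled by positive
    factors [t n] that make their modulars summable, and [k] is the supremum; along a curve, a
    finite integral of [k] bounds that of each [t n * h n]. *)
Lemma modular_finite_countable (h : nat -> X -> \bar R) :
  (forall n, modular_finite (h n)) ->
  exists2 k, modular_finite k & forall c, rectifiable_curve_in Omega c ->
    curve_integral c k < +oo -> forall n, curve_integral c (h n) < +oo.
Proof.
move=> hfin; have hb n : nonneg_borel Omega (h n) by case: (hfin n).
pose M n := fine (modular mu Omega Phi (h n)).
have M0 n : (0 <= M n)%R by rewrite fine_ge0// (modular_ge0 oPhi).
pose t n := (2^-1 ^+ n / (1 + M n))%R.
have t0 n : (0 < t n)%R by rewrite divr_gt0// ?exprn_gt0// ltr_pwDl.
have t1 n : (t n <= 1)%R.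
  rewrite ler_pdivrMr ?ltr_pwDl// mul1r (@le_trans _ _ 1%R) ?lerDl//.
  by rewrite exprn_ile1// invf_le1// ler1n.
pose k n x := (t n)%:E * h n x.
have kb n : nonneg_borel Omega (k n).
  by apply: nonneg_borelZ => //; exact: ltW.
exists (fun x => ereal_sup (range (k ^~ x))).
  apply: (modular_half_pow kb) => n.
  apply: (@le_trans _ _ ((t n)%:E * modular mu Omega Phi (h n))).
    apply: (modularZ_le mO oPhi) => //; try exact: measurable_on_borel.
      by rewrite (ltW (t0 n)) t1.
    by apply: ae_onW => x Ox; rewrite abseM gee0_abs ?lee_fin// ltW.
  rewrite -[X in _ * X]fineK; last first.
    by rewrite ge0_fin_numE ?(modular_ge0 oPhi)//; case: (hfin n).
  rewrite -EFinM lee_fin -/(M n) /t mulrAC ler_pdivrMr ?ltr_pwDl//.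
  by rewrite ler_pM2l ?exprn_gt0// lerDr.
move=> c rc kc n; have : curve_integral c (k n) < +oo.
  apply: le_lt_trans kc; apply: (le_curve_integral oO rc) => //.
    exact: nonneg_borel_sup.
  by move=> x Ox; apply: ereal_sup_ubound; exists n.
rewrite (curve_integralZ oO rc) ?(ltW (t0 n))//.
have := curve_integral_ge0 rc (hb n).
case: (curve_integral c (h n)) => [r _ _|_|]//; first by rewrite ltry.
by rewrite gt0_muley ?lte_fin.
Qed.

(** Unlike the complement of an arbitrary family of modulus zero, the set of curves with finite
    integral of [h] is stable under passing to subarcs. *)
Lemma weak_upper_gradientP u g : weak_upper_gradient mu Omega Phi u g <->
  nonneg_borel Omega g /\ exists2 h, modular_finite h &
  forall c, rectifiable_curve_in Omega c -> curve_integral c h < +oo ->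
  `|u (curve_param c 0%R) - u (curve_param c (curve_len c))| <=
  curve_integral c g.
Proof.
split=> [[gb [Gamma [GO mod0 hG]]]|[gb [h hfin hc]]]; split => //.
  have [h hfin hoo] := modulus0_control GO mod0.
  exists h => // c rc ch; apply: hG => // Gc.
  by move: ch; rewrite hoo.
exists [set c | rectifiable_curve_in Omega c /\ curve_integral c h = +oo]; split.
- by move=> c [].
- by apply: control_modulus0 hfin _ => c [].
- move=> c rc nG; apply: hc => //; rewrite ltNge leye_eq; apply/eqP => hoo.
  by apply: nG.
Qed.

End exceptional_curves.

(** * Arc length of subarcs *)

Section polygonal_length.
Context {R : realType} {X : completeMetricType R}.
Implicit Types (c : R -> X) (s t : R) (l : seq R).

(** A recursive form of [polygonal_length], suited to induction; the end point [t] there is only the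
    default value of [nth] and disappears. *)
Fixpoint polygon c s l : R :=
  if l is x :: l' then mdist (c s) (c x) + polygon c x l' else 0.

Lemma polygonal_lengthE c s t l : polygonal_length c s t l = polygon c s l.
Proof.
rewrite /polygonal_length; elim: l s => [|x l IH] s /=; first by rewrite big_geq.
by rewrite big_nat_recl//= IH.
Qed.

Lemma polygon_cat c s l l' :
  polygon c s (l ++ l') = polygon c s l + polygon c (last s l) l'.
Proof. by elim: l s => [|x l IH] s /=; rewrite ?add0r// IH addrA. Qed.

Lemma polygon_shift c s t l :
  polygon (fun r => c (s + r)) t l = polygon c (s + t) (map (+%R s) l).
Proof. by elim: l t => [|x l IH] t //=; rewrite IH. Qed.

Lemma itv_partition_shift s a b l :
  itv_partition (s + a) (s + b) (map (+%R s) l) <-> itv_partition a b l.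
Proof.
rewrite /itv_partition last_map (inj_eq (addrI s)).
suff -> : path <%R (s + a) (map (+%R s) l) = path <%R a l by [].
by elim: l a => //= x l IH a; rewrite IH ltrD2l.
Qed.

(** By the triangle inequality, inserting the vertex [t] can only lengthen the polygon. *)
Lemma polygon_split c s t l : path <%R s l -> s < t -> t <= last s l ->
  exists l1 l2, [/\ itv_partition s t l1, itv_partition t (last s l) l2 &
    polygon c s l <= polygon c s l1 + polygon c t l2].
Proof.
elim: l s => [|x l IH] s /=; first by move=> _ /lt_le_trans/[apply]; rewrite ltxx.
move=> /andP[sx pl] st tl.
have [xt|tx|xt] := ltgtP x t.
- have [l1 [l2 [p1 p2 h]]] := IH _ pl xt tl.
  exists (x :: l1), l2; split => //=; last by rewrite -addrA lerD2l.
  by case: p1 => /= p1 l1t; split => //=; rewrite sx.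
- exists [:: t], (x :: l); split => /=.
  + exact: itv_partition1.
  + by split => //=; rewrite tx.
  + by rewrite addr0 addrA lerD2r metric_triangle.
- exists [:: t], l; rewrite -xt; split => /=.
  + by apply: itv_partition1; rewrite xt.
  + by split.
  + by rewrite addr0.
Qed.

(** Additivity of arc length: partitions of [[0, s]] and [[s, s + t]] can be concatenated, which
    bounds the length of the subarc from above, and a partition of [[0, s + t]] can be split at [s],
    which bounds it from below. *)
Lemma arc_length_shift c (L s t : R) :
  (forall r, r \in `[0, L] -> arc_length c 0 r = r%:E) ->
  0 <= s -> 0 <= t -> s + t <= L ->
  arc_length (fun r => c (s + r)) 0 t = t%:E.
Proof.
move=> arc s0 t0 stL.
have arcs r : 0 <= r -> r <= L -> arc_length c 0 r = r%:E.
  by move=> r0 rL; apply: arc; rewrite in_itv/= r0.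
have le_arc r l : 0 <= r -> r <= L -> itv_partition 0 r l -> polygon c 0 l <= r.
  move=> r0 rL pl; rewrite -lee_fin -(arcs r)//; apply: ereal_sup_ubound.
  by exists l => //; rewrite polygonal_lengthE.
apply/eqP; rewrite eq_le; apply/andP; split.
  apply: ge_ereal_sup => _ [l pl <-]; rewrite lee_fin polygonal_lengthE.
  rewrite polygon_shift addr0.
  have pl' : itv_partition s (s + t) (map (+%R s) l).
    by rewrite -[X in itv_partition X]addr0; apply/itv_partition_shift.
  (* The left side is itself a supremum over partitions of [[0, s]], each of which is joined to the
     given partition. *)
  suff : (s%:E <= (s + t - polygon c s (map (+%R s) l))%:E)%E by rewrite lee_fin; lra.
  rewrite -[leLHS](arcs s) ?(le_trans _ stL) ?lerDl//.
  apply: ge_ereal_sup => _ [l0 pl0 <-]; rewrite lee_fin polygonal_lengthE.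
  rewrite lerBrDr; have [_ /eqP l0s] := pl0; rewrite -{1}l0s -polygon_cat.
  apply: le_arc => //; first exact: addr_ge0.
  exact: itv_partition_cat pl0 pl'.
suff : ((s + t)%:E <= s%:E + arc_length (fun r => c (s + r)%R) 0%R t)%E.
  by rewrite EFinD leeD2lE.
rewrite -[leLHS](arcs (s + t)) ?addr_ge0//.
apply: ge_ereal_sup => _ [l pl <-]; rewrite polygonal_lengthE.
have fin l2 : itv_partition s (s + t) l2 ->
    ((polygon c s l2)%:E <= arc_length (fun r => c (s + r)%R) 0%R t)%E.
  move=> pl2; apply: ereal_sup_ubound; exists (map (+%R (- s)) l2).
    apply/(itv_partition_shift s); rewrite addr0 -map_comp.
    by rewrite (eq_map (g := id)) ?map_id// => x /=; rewrite addrA subrr add0r.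
  rewrite polygonal_lengthE polygon_shift addr0 -map_comp.
  by rewrite (eq_map (g := id)) ?map_id// => x /=; rewrite addrA subrr add0r.
have [s00|sN0] := eqVneq s 0.
  by rewrite s00 add0e; move: pl fin; rewrite s00 => pl; apply.
have {sN0}s0 : 0 < s by rewrite lt_neqAle eq_sym sN0.
case: (pl) => pth /eqP lst.
have [|l1 [l2 [p1 p2 h]]] := polygon_split c pth s0.
  by rewrite lst lerDl.
apply: (@le_trans _ _ (s%:E + (polygon c s l2)%:E)%E).
  rewrite -EFinD lee_fin (le_trans h)// lerD2r; apply: (le_arc _ _ (ltW s0) _ p1).
  by rewrite (le_trans _ stL)// lerDl.
by rewrite leeD2l// fin// -lst.
Qed.

End polygonal_length.

(** * Translation invariance of Lebesgue integrals *)

Section lebesgue_shift.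
Local Open Scope ereal_scope.
Context {R : realType}.
Local Notation mu := (@lebesgue_measure R).

(** Lebesgue measure is determined by its values on half-open intervals, where the pushforward
    agrees with it. *)
Lemma lebesgue_measure_shift (s : R) (A : set R) : measurable A ->
  pushforward mu ((+%R s) : _ -> measurableTypeR R) A = mu A.
Proof.
pose f : R -> measurableTypeR R := +%R s.
have mf : measurable_fun setT f by exact: measurable_funD.
pose mixin := isMeasurableFun.Build _ _ _ _ f mf.
pose F : {mfun R >-> measurableTypeR R} := HB.pack f mixin.
move=> mA; apply/esym.
apply: (lebesgue_measure_unique (mu := pushforward mu F)) => //= _ [[a b]] _ <-.
rewrite /pushforward (_ : _ @^-1` _ = `](a - s)%R, (b - s)%R]%classic); last first.
  apply/seteqP; split => x /=; rewrite !in_itv/= ltrBlDl lerBrDl //.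
rewrite !lebesgue_measure_itv/= !lte_fin ltrD2r.
by case: ifPn => // _; rewrite -!EFinB opprB addrA subrK.
Qed.

Lemma ge0_integral_shift (f : R -> \bar R) (s t : R) :
  measurable_fun `[s, (s + t)%R] f ->
  (forall r, r \in `[s, (s + t)%R] -> 0 <= f r) ->
  \int[mu]_(r in `[0%R, t]) f (s + r)%R = \int[mu]_(r in `[s, (s + t)%R]) f r.
Proof.
move=> mf f0; rewrite (_ : `[0%R, t]%classic =
    ((+%R s) : _ -> measurableTypeR R) @^-1` `[s, (s + t)%R]); last first.
  by apply/seteqP; split => x /=; rewrite !in_itv/= lerDl lerD2l.
have ms : measurable_fun setT ((+%R s) : measurableTypeR R -> measurableTypeR R).
  exact: measurable_funD.
have f0' : {in `[s, (s + t)%R]%classic, forall r : measurableTypeR R, 0 <= f r}.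
  by move=> x /[!inE]; exact: f0.
have /esym E := ge0_integral_pushforward ms mu
  (measurable_itv `[s, (s + t)%R]) mf f0'.
apply: (etrans E).
by apply: eq_measure_integral => A mA AS; exact: lebesgue_measure_shift.
Qed.

End lebesgue_shift.

(** * Open sets of reals as countable unions of intervals *)

Section open_set_intervals.
Context {R : realType}.

Lemma open_bigcup_itvoo (U : set R) : open U -> exists c d : nat -> R,
  U = \bigcup_n `]c n, d n[%classic.
Proof.
move=> oU.
pose good (z : rat * rat) := `[< `](ratr z.1 : R), (ratr z.2)[ `<=` U >].
(* The rational intervals inside [U] are enumerated; an index that codes none of them yields the
   empty interval from 0 to 0. *)
pose e n : R * R := if @unpickle (rat * rat)%type n is Some z then
  if good z then (ratr z.1, ratr z.2) else (0, 0) else (0, 0).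
exists (fun n => (e n).1), (fun n => (e n).2); apply/seteqP; split => x.
  move=> /oU[/= r /= r0 rU].
  have [|p] := @rat_in_itvoo R (x - r) x; first by lra.
  rewrite in_itv/= => /andP[xp px].
  have [|q] := @rat_in_itvoo R x (x + r); first by lra.
  rewrite in_itv/= => /andP[xq qx].
  exists (pickle (p, q)); first by [].
  have gpq : good (p, q).
    apply/asboolP => y /=; rewrite in_itv/= => /andP[py yq]; apply: rU => /=.
    by rewrite ltr_norml; apply/andP; split; lra.
  by rewrite /e pickleK gpq /= in_itv/= px xq.
move=> [n _] /=; rewrite /e; case: unpickle => [z|]/=; last first.
  by rewrite in_itv/= => /andP[/lt_trans/[apply]]; rewrite ltxx.
case: ifPn => [/asboolP zU /zU//|_] /=.
by rewrite in_itv/= => /andP[/lt_trans/[apply]]; rewrite ltxx.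
Qed.

End open_set_intervals.

(** * Two integral bounds on an oscillation imply the bound by their minimum *)

Section minimum_of_bounds.
Local Open Scope ereal_scope.
Context {R : realType}.
Local Notation mu := (@lebesgue_measure R).
Implicit Types (g h : R -> \bar R) (s r t : R).

Lemma ge0_integral_itv_split g s r t : measurable_fun `[s, t] g ->
  (forall x, x \in `[s, t] -> 0 <= g x) -> (s <= r)%R -> (r <= t)%R ->
  \int[mu]_(x in `[s, t]) g x =
  \int[mu]_(x in `[s, r]) g x + \int[mu]_(x in `[r, t]) g x.
Proof.
move=> mg g0 sr rt.
have E : (`[s, t] = `[s, r] `|` `]r, t])%classic.
  by rewrite -itv_bndbnd_setU// bnd_simp.
have mg' := mg; have g0' x : (`[s, t]%classic x) -> 0 <= g x by exact: g0.
rewrite E in mg' g0' *; rewrite ge0_integral_setU//=; last first.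
  apply/disj_setPS => x [] /=; rewrite !in_itv/= => /andP[_ xr] /andP[rx _].
  by move: (le_lt_trans xr rx); rewrite ltxx.
rewrite integral_itv_obnd_cbnd//; apply: measurable_funS mg'.
  exact: measurableU.
exact: subsetUr.
Qed.

Lemma eq_integral_itv_cc g h s t : measurable_fun `]s, t[ g ->
  measurable_fun `]s, t[ h -> (forall x, x \in `]s, t[ -> g x = h x) ->
  \int[mu]_(x in `[s, t]) g x = \int[mu]_(x in `[s, t]) h x.
Proof.
move=> mg mh gh; rewrite !integral_itv_bndoo//; apply: eq_integral => x.
by rewrite inE; exact: gh.
Qed.

Context {L : R} {f : R -> R} {a b : R -> \bar R}.
Local Notation D := (`[0%R, L]%classic : set R).
Hypotheses (L0 : (0 < L)%R)
  (ma : measurable_fun D a) (mb : measurable_fun D b)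
  (a0 : forall x, D x -> 0 <= a x) (b0 : forall x, D x -> 0 <= b x)
  (afin : \int[mu]_(x in D) a x < +oo) (bfin : \int[mu]_(x in D) b x < +oo)
  (fa : forall s t, (0 <= s)%R -> (s < t)%R -> (t <= L)%R ->
    `|f s - f t|%:E <= \int[mu]_(x in `[s, t]) a x)
  (fb : forall s t, (0 <= s)%R -> (s < t)%R -> (t <= L)%R ->
    `|f s - f t|%:E <= \int[mu]_(x in `[s, t]) b x).

(** The bound for [choose A] starts from [A] empty, where it is the bound by [b], and survives
    adding an interval to [A]. *)
Let choose (A : set R) x := if x \in A then a x else b x.

Let bounded_by (A : set R) := forall s t, (0 <= s)%R -> (s <= t)%R ->
  (t <= L)%R -> `|f s - f t|%:E <= \int[mu]_(x in `[s, t]) choose A x.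

Let sub_itv (e1 e2 : bool) s t : (0 <= s)%R -> (t <= L)%R ->
  [set` Interval (BSide e1 s) (BSide e2 t)] `<=` D.
Proof.
move=> s0 tL x /=; rewrite !itv_boundlr !bnd_simp/= => /andP[sx xt].
apply/andP; split.
  by apply: le_trans s0 _; case: e1 sx; rewrite /Order.le/= => // /ltW.
by apply: le_trans tL; case: e2 xt; rewrite /Order.le/= => // /ltW.
Qed.

Let choose_ge0 A x : D x -> 0 <= choose A x.
Proof. by rewrite /choose; case: ifPn => _; [exact: a0|exact: b0]. Qed.

Let measurable_choose A : measurable A -> measurable_fun D (choose A).
Proof.
move=> mA; apply: measurable_fun_if => //.
- apply: (measurable_fun_bool true).
  rewrite (_ : _ `&` _ = D `&` A); first exact: measurableI.
  by congr (_ `&` _); apply/seteqP; split => x /=; [move/set_mem|move/mem_set].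
- exact: measurable_funS ma.
- exact: measurable_funS mb.
Qed.

(** The segment is cut at the ends of the new interval: the outer pieces use the bound for [A], the
    middle one the bound by [a]. End points are negligible. *)
Let bounded_by_itv A (c d : R) : measurable A -> bounded_by A ->
  bounded_by (A `|` `]c, d[).
Proof.
move=> mA QA s t s0 st tL.
have mAJ : measurable (A `|` `]c, d[) by exact: measurableU.
(* Clamping into [[s, t]] with [c' <= d'] makes the middle piece degenerate when []c, d[] is empty
   or misses the segment. *)
pose c' := Num.min (Num.max c s) t; pose d' := Num.min (Num.max d c') t.
have sc' : (s <= c')%R by rewrite le_min st le_max lexx orbT.
have c'd' : (c' <= d')%R by rewrite le_min le_max lexx orbT ge_min lexx orbT.
have d't : (d' <= t)%R by rewrite ge_min lexx orbT.
have mS A' s' t' : measurable A' -> (0 <= s')%R -> (t' <= L)%R ->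
    measurable_fun `[s', t'] (choose A').
  by move=> mA' s'0 t'L; apply: measurable_funS (measurable_choose mA') => //;
    exact: sub_itv.
have mSo A' s' t' : measurable A' -> (0 <= s')%R -> (t' <= L)%R ->
    measurable_fun `]s', t'[ (choose A').
  by move=> mA' s'0 t'L; apply: measurable_funS (measurable_choose mA') => //;
    exact: sub_itv.
have c'0 : (0 <= c')%R by exact: le_trans sc'.
have d'0 : (0 <= d')%R by exact: le_trans c'd'.
have d'L : (d' <= L)%R by exact: le_trans d't _.
have c'L : (c' <= L)%R by exact: le_trans c'd' _.
have c't : (c' <= t)%R by exact: le_trans c'd' _.
rewrite (@ge0_integral_itv_split _ s c' t)//; last 2 first.
- exact: mS.
- by move=> x xst; apply: choose_ge0; exact: (sub_itv s0 tL xst).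
rewrite (@ge0_integral_itv_split _ c' d' t)//; last 2 first.
- exact: mS.
- by move=> x xst; apply: choose_ge0; exact: (sub_itv c'0 tL xst).
rewrite (@eq_integral_itv_cc _ (choose A) s c'); last 3 first.
- exact: mSo.
- exact: mSo.
- move=> x; rewrite in_itv/= => /andP[sx xc']; rewrite /choose in_setU.
  rewrite (_ : (x \in `]c, d[%classic) = false) ?orbF//.
  apply/negP; rewrite inE/= in_itv/= => /andP[cx _].
  by move: xc'; rewrite lt_min lt_max (ltNge x c) (ltNge x s) (ltW cx) (ltW sx).
rewrite (@eq_integral_itv_cc _ (choose A) d' t); last 3 first.
- exact: mSo.
- exact: mSo.
- move=> x; rewrite in_itv/= => /andP[d'x xt]; rewrite /choose in_setU.
  rewrite (_ : (x \in `]c, d[%classic) = false) ?orbF//.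
  apply/negP; rewrite inE/= in_itv/= => /andP[_ xd].
  by move: d'x; rewrite gt_min (ltNge t) (ltW xt) orbF gt_max (ltNge d) (ltW xd).
rewrite (@eq_integral_itv_cc _ a c' d'); last 3 first.
- exact: mSo.
- by apply: measurable_funS ma => //; exact: sub_itv.
- move=> x; rewrite in_itv/= => /andP[c'x xd']; rewrite /choose in_setU.
  rewrite (_ : (x \in `]c, d[%classic) = true) ?orbT//.
  apply/mem_set; rewrite /= in_itv/=; apply/andP; split.
    move: c'x; rewrite gt_min gt_max => /orP[/andP[]//|tx].
    by move: xd'; rewrite lt_min (ltNge x t) (ltW tx) andbF.
  move: xd'; rewrite lt_min lt_max => /andP[/orP[//|xc'] _].
  by move: (lt_trans c'x xc'); rewrite ltxx.
have fa' : `|f c' - f d'|%:E <= \int[mu]_(x in `[c', d']) a x.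
  have [->|ne] := eqVneq c' d'.
    rewrite subrr normr0; apply: integral_ge0 => x x_; apply: a0.
    exact: (sub_itv d'0 d'L x_).
  by apply: fa => //; rewrite lt_neqAle ne.
apply: (@le_trans _ _ (`|f s - f c'|%:E + (`|f c' - f d'|%:E + `|f d' - f t|%:E))).
  rewrite -!EFinD lee_fin (le_trans (ler_distD (f c') _ _))// lerD2l.
  by rewrite (le_trans (ler_distD (f d') _ _)).
by rewrite leeD ?QA// leeD ?QA.
Qed.

Let bounded_by_finite (c d : nat -> R) n :
  bounded_by (\bigcup_(k in `I_n) `]c k, d k[%classic).
Proof.
elim: n => [|n IH].
  rewrite II0 bigcup_set0 => s t s0; rewrite le_eqVlt => /predU1P[<- tL|st tL].
    rewrite subrr normr0; apply: integral_ge0 => x x_; apply: choose_ge0.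
    exact: (sub_itv s0 tL x_).
  apply: le_trans (fb s0 st tL) _; rewrite le_eqVlt; apply/orP; left; apply/eqP.
  by apply: eq_integral => x _; rewrite /choose in_set0.
rewrite IIS bigcup_setU bigcup_set1; apply: bounded_by_itv => //.
by apply: bigcup_measurable.
Qed.

(** Finite unions of intervals exhaust [U]; at each point the values of [choose] are eventually
    constant, and they are dominated by the integrable [a + b]. *)
Let bounded_by_open U : open U -> `|f 0%R - f L|%:E <= \int[mu]_(x in D) choose U x.
Proof.
move=> /open_bigcup_itvoo[c [d UE]].
pose A n := \bigcup_(k in `I_n) `]c k, d k[%classic.
have mA n : measurable (A n) by apply: bigcup_measurable.
have mU : measurable U by rewrite UE; apply: bigcup_measurable.
have iab : mu.-integrable D (fun x => a x + b x).
  apply/integrableP; split; first exact: emeasurable_funD.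
  under eq_integral => x /[!inE] Dx do rewrite gee0_abs ?adde_ge0 ?a0 ?b0//.
  by rewrite ge0_integralD// lte_add_pinfty.
have cvg_choose x : choose (A n) x @[n --> \oo] --> choose U x.
  have [xU|xU] := pselect (U x).
    have [k _ xk] : (\bigcup_n `]c n, d n[%classic) x by rewrite -UE.
    apply: cvg_near_cst; near=> n.
    rewrite /choose (mem_set xU) ifT//; apply/mem_set; exists k => //=.
    by near: n; exact: nbhs_infty_gt.
  apply: cvg_near_cst; near=> n; rewrite /choose (memNset xU) ifF//.
  apply/negbTE; rewrite notin_setE => -[k _ xk]; apply: xU; rewrite UE.
  by exists k.
have choose_le n x : D x -> `|choose (A n) x| <= a x + b x.
  move=> Dx; rewrite gee0_abs ?choose_ge0// /choose; case: ifPn => _.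
    by rewrite leeDl// b0.
  by rewrite leeDr// a0.
have [||_ _ cv] := @dominated_convergence _ _ R mu D (measurable_itv _)
  (fun n => choose (A n)) (choose U) (fun x => a x + b x)
  (fun n => measurable_choose (mA n)) (measurable_choose mU) _ iab _.
- by apply: aeW => x Dx; exact: cvg_choose.
- by apply: aeW => x n Dx; exact: choose_le.
rewrite -(cvg_lim _ cv)//; apply: lime_ge; first by apply/cvg_ex; eexists; exact: cv.
by near=> n; apply: bounded_by_finite => //; exact: ltW.
Unshelve. all: by end_near. Qed.

(** The ideal switching set is the set [E] where [a <= b]. For an open [U] containing [E],
    [choose U] differs from the minimum only on [U] minus [E], and there by at most [a], whose
    integral is small by absolute continuity. *)
Lemma bounded_by_min :
  `|f 0%R - f L|%:E <= \int[mu]_(x in D) mine (a x) (b x).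
Proof.
pose T := measurableTypeR R.
have mmin : measurable_fun (D : set T) (fun x => mine (a x) (b x)) by exact: measurable_mine.
have min0 x : D x -> 0 <= mine (a x) (b x) by move=> Dx; rewrite le_min a0 ?b0.
pose E : set T := D `&` [set x | a x <= b x].
have mD : measurable (D : set T) by exact: measurable_itv.
have mE : measurable E by exact: emeasurable_fun_le.
have ia : mu.-integrable (D : set T) a.
  apply/integrableP; split => //.
  by under eq_integral => x /[!inE] Dx do rewrite gee0_abs ?a0//.
have iaD := (integrable_mkcond (a : T -> \bar R) mD).1 ia.
have maD := measurable_int _ iaD.
(* Absolute continuity is applied to a real-valued function on the whole line; [a] is finite a.e. on
   [D], so no integral changes. *)
pose a' (x : T) : R := fine ((a \_ D) x).
have ma' : measurable_fun (setT : set T) a' by exact: measurableT_comp maD.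
have ia' : mu.-integrable (setT : set T) (EFin \o a').
  apply/integrableP; split; first exact/measurable_EFinP.
  have /integrableP[_] := iaD; apply: le_lt_trans.
  apply: ge0_le_integral => //.
  - by apply: measurableT_comp => //; exact/measurable_EFinP.
  - exact: measurableT_comp maD.
  - by move=> x _ /=; rewrite /a'; case: (_ x) => [r| |]//=; rewrite ?normr0 ?leey.
apply/lee_addgt0Pr => e e0.
have [d [d0 hd]] := integral_normr_continuous ia' e0.
have Efin : mu E < +oo.
  apply: (@le_lt_trans _ _ (mu D)); first by rewrite le_measure ?inE//; exact: subIsetl.
  by rewrite lebesgue_measure_itv/= lte_fin L0 -EFinB ltry.
have [U [oU EU UE]] := lebesgue_regularity_outer mE Efin d0.
have mU : measurable (U : set T) by exact: open_measurable.
apply: le_trans (bounded_by_open oU) _.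
pose V : set T := D `&` (U `\` E).
have mV : measurable V by apply: measurableI => //; exact: measurableD.
have VD : V `<=` D by exact: subIsetl.
have aVE : \int[mu]_(x in V) a x = \int[mu]_(x in V) (`|a' x|%R)%:E.
  apply: ae_eq_integral => //.
  - exact: measurable_funS ma.
  - by apply/measurable_EFinP/measurableT_comp => //; exact: measurable_funTS.
  - have := integrable_ae mD ia; apply: filterS => x afx Vx.
    have Dx := VD _ Vx.
    by rewrite /a' patchT ?inE// ger0_norm ?fineK ?afx// fine_ge0 ?a0.
have aV : \int[mu]_(x in V) a x <= e%:E.
  have aVfin : \int[mu]_(x in V) a x \is a fin_num.
    rewrite ge0_fin_numE; last by apply: integral_ge0 => x /VD/a0.
    by apply: le_lt_trans afin; exact: ge0_subset_integral.
  rewrite -(fineK aVfin) lee_fin aVE ltW//; apply: hd => //.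
  apply: le_lt_trans UE; apply: le_measure; rewrite ?inE//.
  - exact: measurableD.
  - exact: subIsetr.
apply: (@le_trans _ _ (\int[mu]_(x in D) (mine (a x) (b x) + (a \_ V) x))).
  apply: ge0_le_integral => //.
  - by move=> x; exact: choose_ge0.
  - exact: measurable_choose.
  - apply: emeasurable_funD => //; apply: measurable_funTS.
    by apply/(measurable_restrictT _ mV); exact: measurable_funS ma.
  - move=> x Dx; rewrite /choose; case: ifPn => [/set_mem xU|/negP xU].
      have [xE|xE] := pselect (E x).
        rewrite min_l ?xE.2// leeDl// /patch; case: ifPn => // _; exact: a0.
      by rewrite [(a \_ V) x]patchT ?inE// leeDr// min0.
    rewrite min_r.
      by rewrite leeDl// /patch; case: ifPn => // _; exact: a0.
    have [//|ab] := leP (b x) (a x); exfalso; apply/xU/mem_set/EU; split => //.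
    exact: ltW.
rewrite ge0_integralD//; last 2 first.
- by move=> x Dx; rewrite /patch; case: ifPn => // _; exact: a0.
- by apply: measurable_funTS; apply/(measurable_restrictT _ mV); exact: measurable_funS ma.
rewrite leeD2l//; apply: le_trans aV.
by rewrite -integral_mkcondr setIidr.
Qed.

End minimum_of_bounds.

(** * Subarcs of rectifiable curves *)

Section subcurves.
Local Open Scope ereal_scope.
Context {R : realType} {X : completeMetricType R} {Omega : set X}.
Hypothesis oO : open Omega.
Implicit Types (c : curve R X) (s t : R) (h : X -> \bar R).

Definition subcurve c s t : curve R X :=
  Curve (t - s)%R (fun r => curve_param c (s + r)%R).

Lemma subcurve_rectifiable c s t : rectifiable_curve_in Omega c ->
  (0 <= s)%R -> (s < t)%R -> (t <= curve_len c)%R ->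
  rectifiable_curve_in Omega (subcurve c s t).
Proof.
move=> [L0 cc cO arc] s0 st tL.
have sub r : (r \in `[0, t - s] -> s + r \in `[0, curve_len c])%R.
  by rewrite !in_itv/= => /andP[r0 rts]; apply/andP; split; lra.
split => /=; first by rewrite subr_gt0.
- apply/subspace_continuousP => r rts U /= nU.
  move/subspace_continuousP : cc => /(_ (s + r)%R (sub _ rts) U nU).
  move=> /nbhs_ballP[e /= e0 eU]; apply/nbhs_ballP.
  exists e => //= y; rewrite /ball/= => ry yts; apply: eU; last exact: sub.
  by rewrite /ball/= (_ : s + r - (s + y) = r - y)%R//; lra.
- by move=> r /sub/cO.
- move=> r; rewrite in_itv/= => /andP[r0 rts].
  by apply: (arc_length_shift arc) => //; lra.
Qed.

Lemma curve_integral_subcurve c s t h : rectifiable_curve_in Omega c ->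
  nonneg_borel Omega h -> (0 <= s)%R -> (s < t)%R -> (t <= curve_len c)%R ->
  curve_integral (subcurve c s t) h =
  \int[lebesgue_measure]_(r in `[s, t]) (h \o curve_param c) r.
Proof.
move=> rc [mh h0] s0 st tL.
have sub : `[s, t]%classic `<=` (`[0%R, curve_len c]%classic : set R).
  by move=> r /=; rewrite !in_itv/= => /andP[sr rt]; apply/andP; split; lra.
have stE : t = (s + (t - s))%R by rewrite addrC subrK.
rewrite [in RHS]stE -ge0_integral_shift// -stE.
- by apply: measurable_funS (measurable_fun_curve oO rc mh) => //.
- by move=> r /sub/(curve_param_in rc)/h0.
Qed.

Lemma curve_integral_subcurve_lty c s t h : rectifiable_curve_in Omega c ->
  nonneg_borel Omega h -> (0 <= s)%R -> (s < t)%R -> (t <= curve_len c)%R ->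
  curve_integral c h < +oo -> curve_integral (subcurve c s t) h < +oo.
Proof.
move=> rc hb s0 st tL; apply: le_lt_trans.
rewrite curve_integral_subcurve//; case: hb => mh h0.
apply: ge0_subset_integral => //.
- exact: (measurable_fun_curve oO rc mh).
- by move=> r /(curve_param_in rc)/h0.
- by move=> r /=; rewrite !in_itv/= => /andP[sr rt]; apply/andP; split; lra.
Qed.

End subcurves.

(** * Lattice properties and existence of minimal weak upper gradients *)

Section minimal_gradient.
Local Open Scope ereal_scope.
Context {R : realType} {X : completeMetricType R}
  {mu : {outer_measure set X -> \bar R}} {Omega : set X}
  {Phi : X -> \bar R -> \bar R} {P : nat}.
Hypotheses (oO : open Omega) (bmu : borel_regular mu)
  (oPhi : orlicz_function mu Omega Phi P) (muO : mu Omega < +oo)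
  (Phi_ge : forall x xi, Omega x -> 0 <= xi -> xi <= 1 + Phi x xi).
Implicit Types (u g h : X -> \bar R) (c : curve R X).

Let mO : mu.-cara.-measurable Omega. Proof. exact: caratheodory_open. Qed.

(** The difference of two infinite values has absolute value [+oo] even when they are equal. *)
Lemma abse_sub_lty (x y : \bar R) : `|x - y| < +oo ->
  x \is a fin_num /\ y \is a fin_num.
Proof. by case: x y => [x| |] [y| |]. Qed.

(** Adding [g] itself to the control function makes the integral of [g] finite on all good curves,
    so [u] is finite at their end points. *)
Lemma weak_upper_gradient_in_spaceP u g :
  weak_upper_gradient_in_space mu Omega Phi u g <->
  modular_finite (mu := mu) (Omega := Omega) (Phi := Phi) g /\
  exists2 h, modular_finite (mu := mu) (Omega := Omega) (Phi := Phi) h &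
  forall c, rectifiable_curve_in Omega c -> curve_integral c h < +oo ->
  `|u (curve_param c 0%R) - u (curve_param c (curve_len c))| <=
  curve_integral c g /\ curve_integral c g < +oo.
Proof.
split.
  move=> [/(weak_upper_gradientP oO bmu oPhi)[gb [h hfin hc]] [mg gfin]].
  split => //; exists (fun x => h x + g x).
    exact: (modular_finiteD oO bmu oPhi).
  move=> c rc; rewrite (curve_integralD oO rc)//; last by case: hfin.
  move=> hg; have h0 := curve_integral_ge0 rc hfin.1.
  have g0 := curve_integral_ge0 rc gb; split.
    by apply: hc => //; rewrite (le_lt_trans _ hg)// leeDl.
  by rewrite (le_lt_trans _ hg)// leeDr.
move=> [[gb gfin] [h hfin hc]]; split.
  apply/(weak_upper_gradientP oO bmu oPhi); split => //; exists h => //.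
  by move=> c rc /(hc _ rc)[].
by split => //; exact: (measurable_on_borel oO bmu).
Qed.

Lemma weak_upper_gradient_min u g1 g2 :
  weak_upper_gradient_in_space mu Omega Phi u g1 ->
  weak_upper_gradient_in_space mu Omega Phi u g2 ->
  weak_upper_gradient_in_space mu Omega Phi u (fun x => mine (g1 x) (g2 x)).
Proof.
move=> /weak_upper_gradient_in_spaceP[[g1b g1fin] [h1 h1fin hc1]].
move=> /weak_upper_gradient_in_spaceP[[g2b g2fin] [h2 h2fin hc2]].
have gb := nonneg_borel_min g1b g2b.
apply/weak_upper_gradient_in_spaceP; split.
  split => //; apply: le_lt_trans g1fin.
  apply: (modular_le_ae mO oPhi); try exact: (measurable_on_borel oO bmu).
  apply: ae_onW => x Ox; rewrite !gee0_abs ?ge_min ?lexx//; first exact: g1b.2.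
  exact: gb.2.
exists (fun x => h1 x + h2 x); first exact: (modular_finiteD oO bmu oPhi).
move=> c rc; rewrite (curve_integralD oO rc) => [hfin||]; last 2 first.
- by case: h1fin.
- by case: h2fin.
have ch1 : curve_integral c h1 < +oo.
  by rewrite (le_lt_trans _ hfin)// leeDl// (curve_integral_ge0 rc h2fin.1).
have ch2 : curve_integral c h2 < +oo.
  by rewrite (le_lt_trans _ hfin)// leeDr// (curve_integral_ge0 rc h1fin.1).
have [_ cg1] := hc1 _ rc ch1; have [_ cg2] := hc2 _ rc ch2.
have L0 : (0 < curve_len c)%R by case: rc.
pose phi t := u (curve_param c t).
have sub1 s t : (0 <= s)%R -> (s < t)%R -> (t <= curve_len c)%R ->
    `|phi s - phi t| <= \int[lebesgue_measure]_(r in `[s, t]) (g1 \o curve_param c) r /\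
    `|phi s - phi t| < +oo.
  move=> s0 st tL; have rst := subcurve_rectifiable rc s0 st tL.
  have [] := hc1 _ rst (curve_integral_subcurve_lty oO rc h1fin.1 s0 st tL ch1).
  rewrite /= addr0 (addrC s) subrK (curve_integral_subcurve oO rc)// => b1 b2.
  by split => //; exact: le_lt_trans b2.
have sub2 s t : (0 <= s)%R -> (s < t)%R -> (t <= curve_len c)%R ->
    `|phi s - phi t| <= \int[lebesgue_measure]_(r in `[s, t]) (g2 \o curve_param c) r.
  move=> s0 st tL; have rst := subcurve_rectifiable rc s0 st tL.
  have [] := hc2 _ rst (curve_integral_subcurve_lty oO rc h2fin.1 s0 st tL ch2).
  by rewrite /= addr0 (addrC s) subrK (curve_integral_subcurve oO rc).
(* Every point of the curve is an end point of a subarc, which is again a good curve; hence [u] may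
   be treated as a real function along the curve. *)
have phifin t : (0 <= t)%R -> (t <= curve_len c)%R -> phi t \is a fin_num.
  move=> t0 tL; have [tl|tl] := ltP t (curve_len c).
    by have [_ /abse_sub_lty[]] := sub1 _ _ t0 tl (lexx _).
  have [_ /abse_sub_lty[_]] := sub1 _ _ (lexx _) L0 (lexx _).
  by rewrite (@le_anti _ _ t (curve_len c))// tL tl.
pose f t := fine (phi t).
have phif s t : (0 <= s)%R -> (s <= curve_len c)%R -> (0 <= t)%R ->
    (t <= curve_len c)%R -> `|phi s - phi t| = `|f s - f t|%:E.
  move=> s0 sL t0 tL; rewrite -(fineK (phifin _ s0 sL)) -(fineK (phifin _ t0 tL)).
  by rewrite -EFinB abse_EFin.
split; last first.
  by apply: le_lt_trans cg1; apply: (le_curve_integral oO rc) => // x Ox; rewrite ge_min lexx.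
rewrite -/(phi 0%R) -/(phi (curve_len c)) phif ?lexx ?(ltW L0)//.
apply: (@bounded_by_min _ _ f (g1 \o curve_param c) (g2 \o curve_param c)) => //.
- exact: (measurable_fun_curve oO rc g1b.1).
- exact: (measurable_fun_curve oO rc g2b.1).
- by move=> t /(curve_param_in rc)/g1b.2.
- by move=> t /(curve_param_in rc)/g2b.2.
- move=> s t s0 st tL; rewrite -phif//.
  + by have [] := sub1 _ _ s0 st tL.
  + by rewrite (le_trans _ tL)// ltW.
  + by rewrite (le_trans s0)// ltW.
- move=> s t s0 st tL; rewrite -phif//.
  + exact: sub2.
  + by rewrite (le_trans _ tL)// ltW.
  + by rewrite (le_trans s0)// ltW.
Qed.

(** One control function serves all the [g n]; along a good curve, dominated convergence with
    majorant [g 0] passes to the limit. *)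
Lemma weak_upper_gradient_inf u (g : nat -> X -> \bar R) :
  (forall n, weak_upper_gradient_in_space mu Omega Phi u (g n)) ->
  (forall x, nonincreasing_seq (g ^~ x)) ->
  weak_upper_gradient_in_space mu Omega Phi u
    (fun x => ereal_inf (range (g ^~ x))).
Proof.
move=> gu ni.
have {}gu n := (weak_upper_gradient_in_spaceP u (g n)).1 (gu n).
have gb n : nonneg_borel Omega (g n) by case: (gu n) => -[].
have ib := nonneg_borel_inf gb.
have ig0 x : ereal_inf (range (g ^~ x)) <= g 0%N x.
  by apply: ereal_inf_lbound; exists 0%N.
have exh n : exists h, modular_finite (mu := mu) (Omega := Omega) (Phi := Phi) h /\
  forall c, rectifiable_curve_in Omega c -> curve_integral c h < +oo ->
  `|u (curve_param c 0%R) - u (curve_param c (curve_len c))| <=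
  curve_integral c (g n) /\ curve_integral c (g n) < +oo.
  by case: (gu n) => _ [h ? ?]; exists h.
have [h hP] := boolp.choice exh.
have [k kfin kh] := modular_finite_countable oO bmu oPhi (fun n => (hP n).1).
apply/weak_upper_gradient_in_spaceP; split.
  split => //; case: (gu 0%N) => -[_ + _]; apply: le_lt_trans.
  apply: (modular_le_ae mO oPhi); try exact: (measurable_on_borel oO bmu).
  by apply: ae_onW => x Ox; rewrite !gee0_abs//; [exact: (gb 0%N).2|exact: ib.2].
exists k => // c rc ck.
have hn n := (hP n).2 _ rc (kh _ rc ck n).
have [_ cg0] := hn 0%N.
split; last by apply: le_lt_trans cg0; apply: (le_curve_integral oO rc).
have mg n := measurable_fun_curve oO rc (gb n).1.
have ni0 : (@lebesgue_measure R).-integrable `[0%R, curve_len c] (g 0%N \o curve_param c).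
  apply/integrableP; split; first exact: mg.
  by under eq_integral => t /[!inE] tI do
    rewrite gee0_abs ?((gb 0%N).2 _ (curve_param_in rc tI))//.
have [||_ _ cv] := @dominated_convergence _ _ R lebesgue_measure
  `[0%R, curve_len c] (measurable_itv _)
  (fun n => g n \o curve_param c)
  ((fun x => ereal_inf (range (g ^~ x))) \o curve_param c)
  (g 0%N \o curve_param c) mg (measurable_fun_curve oO rc ib.1) _ ni0 _.
- by apply: aeW => t tI /=; exact: ereal_nonincreasing_cvgn.
- apply: aeW => t n tI /=; rewrite gee0_abs; last first.
    exact: ((gb n).2 _ (curve_param_in rc tI)).
  exact: ni.
rewrite /curve_integral -(cvg_lim _ cv)//; apply: lime_ge.
  by apply/cvg_ex; eexists; exact: cv.
by near=> n; have [] := hn n.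
Unshelve. all: by end_near. Qed.

Lemma integral_modular_finite g : nonneg_borel Omega g ->
  modular mu Omega Phi g < +oo -> integral_on mu Omega g < +oo.
Proof.
move=> gb gfin; have mg := measurable_on_borel oO bmu gb.
apply: (@le_lt_trans _ _ (mu Omega + modular mu Omega Phi g)); last first.
  exact: lte_add_pinfty.
rewrite -(modularE gb).
apply: (@le_trans _ _ (integral_on mu Omega (fun x => 1 + Phi x (g x)))).
  apply: ge0_le_integral => //.
  - exact: gb.2.
  - apply: emeasurable_funD; first exact: measurable_cst.
    by apply: (orlicz_function_measurable oPhi) => //; exact: gb.2.
  - by move=> x Ox; apply: Phi_ge => //; exact: gb.2.
rewrite /integral_on ge0_integralD//; last 2 first.
- by move=> x Ox; apply: (orlicz_function_ge0 oPhi) => //; exact: gb.2.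
- by apply: (orlicz_function_measurable oPhi) => //; exact: gb.2.
by rewrite integral_cst// mul1e.
Qed.

Lemma minimal_gradient_exists u :
  (exists g, weak_upper_gradient_in_space mu Omega Phi u g) ->
  exists g, is_minimal_gradient mu Omega Phi u g.
Proof.
move=> [g0 g0u].
have inb g : weak_upper_gradient_in_space mu Omega Phi u g ->
    nonneg_borel Omega g.
  by move=> [[]].
have infin g : weak_upper_gradient_in_space mu Omega Phi u g ->
    integral_on mu Omega g \is a fin_num.
  move=> gu; rewrite ge0_fin_numE; last by apply: integral_ge0; exact: (inb _ gu).2.
  by apply: integral_modular_finite; [exact: inb|case: gu => _ []].
(* The plain integral is minimized, not the modular, because it is additive and so detects the
   excess [k] below. It is finite as [Omega] has finite measure. *)
pose S := [set integral_on mu Omega g | g in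
  [set g | weak_upper_gradient_in_space mu Omega Phi u g]].
pose i := ereal_inf S.
have i_le g : weak_upper_gradient_in_space mu Omega Phi u g ->
    i <= integral_on mu Omega g.
  by move=> gu; apply: ereal_inf_lbound; exists g.
have i0 : 0 <= i.
  by apply: le_ereal_inf_tmp => _ [g gu <-]; apply: integral_ge0; exact: (inb _ gu).2.
have ifin : i \is a fin_num.
  rewrite ge0_fin_numE// (le_lt_trans (i_le _ g0u))//.
  by rewrite -ge0_fin_numE ?infin// (le_trans i0)// i_le.
have exg n : exists g, weak_upper_gradient_in_space mu Omega Phi u g /\
    integral_on mu Omega g <= i + (n.+1%:R^-1)%:E.
  have [|_ [g gu <-] gi] := @lb_ereal_inf_adherent _ S (n.+1%:R^-1)%R _ ifin.
    by rewrite invr_gt0.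
  by exists g; split => //; exact: ltW.
have [g gP] := boolp.choice exg.
pose G := fix G n x := if n is n'.+1 then mine (G n' x) (g n x) else g 0%N x.
have Gu n : weak_upper_gradient_in_space mu Omega Phi u (G n).
  elim: n => [|n IH]; first exact: (gP 0%N).1.
  exact: weak_upper_gradient_min IH (gP n.+1).1.
have Gg n x : G n x <= g n x by case: n => //= n; rewrite ge_min lexx orbT.
have Gni x : nonincreasing_seq (G ^~ x).
  by apply/nonincreasing_seqP => n /=; rewrite ge_min lexx.
pose gm x := ereal_inf (range (G ^~ x)).
have gmu : weak_upper_gradient_in_space mu Omega Phi u gm.
  exact: weak_upper_gradient_inf.
have mon g' : weak_upper_gradient_in_space mu Omega Phi u g' ->
    measurable_on mu Omega g'.
  by move=> /inb; exact: measurable_on_borel.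
have gm_i : integral_on mu Omega gm <= i.
  apply/lee_addgt0Pr => e e0.
  have [n ne] : exists n : nat, (n.+1%:R^-1 <= e)%R.
    exists (Num.bound e^-1); rewrite invf_ple ?posrE//.
    by rewrite ltW// (lt_trans (archi_boundP _)) ?ltr_nat// invr_ge0 ltW.
  apply: (@le_trans _ _ (i + (n.+1%:R^-1)%:E)); last by rewrite leeD2l// lee_fin.
  apply: le_trans (gP n).2; apply: ge0_le_integral => //.
  - exact: (inb _ gmu).2.
  - exact: mon.
  - by apply: mon; exact: (gP n).1.
  - move=> x Ox; apply: le_trans (Gg n x).
    by apply: ereal_inf_lbound; exists n.
exists gm; split => // g' g'u.
pose F := Omega `&` [set x | g' x < gm x].
(* The excess of [gm] over its minimum with [g']. That minimum is again a weak upper gradient in the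
   space, so its integral is at least [i], which leaves 0 for the integral of [k]. *)
pose k x := if g' x < gm x then gm x - g' x else 0.
have k0 x : Omega x -> 0 <= k x.
  by move=> Ox; rewrite /k; case: ifPn => //; rewrite -sube_gt0 => /ltW.
have mk : measurable_on mu Omega k.
  apply: measurable_fun_if => //.
  - by apply: measurable_fun_lte; exact: mon.
  - apply: (@measurable_funS _ _ (caratheodory_type mu) _ Omega) => //.
    by apply: emeasurable_funB; exact: mon.
have gmE x : Omega x -> gm x = mine (gm x) (g' x) + k x.
  move=> Ox; rewrite /k; have [lt|le] := ltP (g' x) (gm x).
    rewrite addeC subeK// ge0_fin_numE; last exact: (inb _ g'u).2.
    by rewrite (lt_le_trans lt)// leey.
  by rewrite adde0.
have minu := weak_upper_gradient_min gmu g'u.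
have : integral_on mu Omega gm = integral_on mu Omega (fun x => mine (gm x) (g' x))
    + integral_on mu Omega k.
  rewrite /integral_on -ge0_integralD//.
  - by apply: eq_integral => x /[!inE] Ox; exact: gmE.
  - exact: (inb _ minu).2.
  - exact: mon.
move=> split_gm.
have k_int0 : integral_on mu Omega k = 0.
  apply/eqP; rewrite eq_le integral_ge0// andbT.
  have := le_trans (eq_ind _ (fun z => z <= i) gm_i _ split_gm)
    (i_le _ minu).
  have kfin := infin _ minu.
  by rewrite -[leRHS]adde0 leeD2lE.
have : ae_eq (mu : {measure set (caratheodory_type mu) -> \bar R}) Omega k (cst 0).
  apply/ae_eq_integral_abs => //; rewrite -[RHS]k_int0.
  by apply: eq_integral => x /[!inE] Ox; rewrite gee0_abs ?k0.
apply: filterS => x kx Ox; have /= := kx Ox.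
rewrite /k; case: ltP => //; rewrite -sube_gt0 => + gg0.
by rewrite gg0 ltxx.
Qed.

Lemma minimal_gradientP u :
  (exists g, weak_upper_gradient_in_space mu Omega Phi u g) ->
  is_minimal_gradient mu Omega Phi u (minimal_gradient mu Omega Phi u).
Proof. by move=> /minimal_gradient_exists; exact: xgetPex. Qed.

End minimal_gradient.

(** * Weak limits along an ultrafilter *)

Section weak_limits.
Context {R : realType}.

(** Compactness gives a cluster point; an ultrafilter contains the preimage of a neighbourhood or
    that of its complement, and clustering rules out the latter. *)
Lemma ultrafilter_cvg (F : set_system nat) (y : nat -> R) (K : R) :
  UltraFilter F -> (forall n, `|y n| <= K) -> cvg (y @ F).
Proof.
move=> UF yK; have FF : ProperFilter F by case: UF.
have [l [_ cl]] : `[- K, K]%classic `&` cluster (y @ F) !=set0.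
  apply: segment_compact; rewrite /nbhs/=; apply: filterE => n /=.
  by rewrite in_itv/= -ler_norml.
apply/cvg_ex; exists l => U nU.
have [//|FcU] := in_ultra_setVsetC (y @^-1` U) UF.
by have [r [? ?]] := cl (~` U) U FcU nU.
Qed.

(* The limit of [L (x n)] along an ultrafilter is a bounded functional of [L],
   hence, by reflexivity, evaluation at some vector. *)
Lemma reflexive_weak_limit (V : @seminormed R) (x : nat -> snvec V) (B : R) :
  (forall (c : R) (u : snvec V), snmem u ->
    snmem (snscale c u) /\ (snorm (snscale c u) <= `|c|%:E * snorm u)%E) ->
  (forall u : snvec V, snmem u -> (0 <= snorm u)%E) ->
  reflexive_space V -> (forall n, snmem (x n)) -> 0 < B ->
  (forall n, (snorm (x n) <= B%:E)%E) ->
  exists (F : set_system nat) (u : snvec V), [/\ ProperFilter F, \oo `<=` F,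
    snmem u & forall L : snvec V -> R, bounded_functional L ->
      L (x n) @[n --> F] --> L u].
Proof.
move=> scaleP norm0 reflV xV B0 xB.
have [F [UF ooF]] := @ultraFilterLemma nat \oo _.
have FF : ProperFilter F by case: UF.
(* [B^-1] times [x n] lies in the unit ball over which the dual norm is a supremum. *)
have LxB (L : snvec V -> R) n : bounded_functional L ->
    (`|L (x n)|%:E <= B%:E * snorm (L : snvec (dual_space V)))%E.
  move=> [_ LZ _]; have [cV cB] := scaleP B^-1 (x n) (xV n).
  have -> : L (x n) = B * L (snscale B^-1 (x n)).
    by rewrite LZ// mulrA divff ?gt_eqF// mul1r.
  rewrite normrM gtr0_norm// EFinM lee_wpmul2l ?lee_fin ?(ltW B0)//.
  apply: ereal_sup_ubound; exists (snscale B^-1 (x n)) => //; split => //.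
  apply: (le_trans cB); rewrite gtr0_norm ?invr_gt0//.
  by rewrite lee_pdivrMl// mule1.
have Lcvg L : bounded_functional L -> cvg (L (x n) @[n --> F]).
  move=> Lb; have [_ _ [C LC]] := Lb.
  apply: (@ultrafilter_cvg _ _ (`|C| * B)) => // n.
  rewrite -lee_fin (le_trans (LC _ (xV n)))//.
  apply: (@le_trans _ _ (`|C|%:E * snorm (x n))%E).
    by rewrite lee_wpmul2r ?norm0// lee_fin ler_norm.
  by rewrite EFinM lee_wpmul2l.
pose Phi (L : snvec V -> R) : R := lim (L (x n) @[n --> F]).
have [|u uV uPhi] := reflV Phi.
  split=> [L L' Lb L'b|c L Lb|].
  - by apply: cvg_lim => //; apply: cvgD; exact: Lcvg.
  - by apply: cvg_lim => //; apply: cvgM; [exact: cvg_cst|exact: Lcvg].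
  exists B => L Lb.
  have := fun n => LxB L n Lb; case: (snorm _) => [r| |] h.
  - rewrite -EFinM lee_fin; have cL := Lcvg _ Lb.
    have cn : `|L (x n)| @[n --> F] --> `|Phi L| by apply: cvg_norm; exact: cL.
    rewrite -(cvg_lim _ cn)//; apply: limr_le; first by apply/cvg_ex; eexists; exact: cn.
    by apply: nearW => n; rewrite -lee_fin EFinM h.
  - by rewrite gt0_muley ?lte_fin// leey.
  - by have := h 0%N; rewrite gt0_muleNy ?lte_fin.
exists F, u; split => // L Lb; rewrite -(uPhi _ Lb); exact: Lcvg.
Qed.

End weak_limits.

Lemma fine_scale (R : realType) (c : R) (x : \bar R) :
  fine (c%:E * x)%E = c * fine x.
Proof.
case: x => [r| |] //=; rewrite mulr0; have [c0|c0|->] := ltgtP c 0.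
- by rewrite lt0_muley ?lte_fin.
- by rewrite gt0_muley ?lte_fin.
- by rewrite mul0e.
- by rewrite lt0_muleNy ?lte_fin.
- by rewrite gt0_muleNy ?lte_fin.
- by rewrite mul0e.
Qed.

(** * Linear structure of the Newtonian space and its real-valued representatives *)

Section newtonian_linear.
Local Open Scope ereal_scope.
Context {R : realType} {X : completeMetricType R}
  {mu : {outer_measure set X -> \bar R}} {Omega : set X}
  {Phi : X -> \bar R -> \bar R} {P : nat}.
Hypotheses (oO : open Omega) (bmu : borel_regular mu)
  (oPhi : orlicz_function mu Omega Phi P) (muO : mu Omega < +oo)
  (Phi_ge : forall x xi, Omega x -> 0 <= xi -> xi <= 1 + Phi x xi).
Implicit Types (u v w g h : X -> \bar R) (c : curve R X).

Let mO : mu.-cara.-measurable Omega. Proof. exact: caratheodory_open. Qed.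

Local Notation inL := (orlicz_space mu Omega Phi).
Local Notation lux := (luxemburg_norm mu Omega Phi).
Local Notation wug := (weak_upper_gradient_in_space mu Omega Phi).
Local Notation N := (newtonian mu Omega Phi).
Local Notation G := (minimal_gradient mu Omega Phi).
Local Notation norm := (newtonian_norm mu Omega Phi).

Lemma orlicz_space_lin (s t : R) u v w : inL u -> inL v ->
  measurable_on mu Omega w -> (0 <= s)%R -> (0 <= t)%R ->
  ae_on mu Omega (fun x => `|w x| <= s%:E * `|u x| + t%:E * `|v x|) -> inL w.
Proof.
move=> [mu_ ufin] [mv vfin] mw s0 t0 wuv; split => //.
(* With [s] and [t] at most [k / 2], [w] is dominated by [k] times the midpoint [z]. *)
pose k := Num.max 1%R (2 * Num.max s t)%R.
have k1 : (1 <= k)%R by rewrite le_max lexx.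
have sk : (s <= k * 2^-1)%R.
  by rewrite ler_pdivlMr// mulrC le_max ler_pM2l// le_max lexx !orbT.
have tk : (t <= k * 2^-1)%R.
  by rewrite ler_pdivlMr// mulrC le_max ler_pM2l// le_max lexx !orbT.
pose z x := (2^-1)%:E * (`|u x| + `|v x|).
have mz : measurable_on mu Omega z.
  by apply: measurable_scale; apply: emeasurable_funD; exact: measurableT_comp.
have z0 x : 0 <= z x by rewrite mule_ge0// ?lee_fin// adde_ge0.
apply: (@le_lt_trans _ _ ((k ^+ P)%:E * modular mu Omega Phi z)).
  apply: (modular_growth mO oPhi) => //.
  apply: ae_onS wuv => x Ox wuv; apply: (le_trans wuv).
  rewrite (gee0_abs (z0 x)) /z muleA -EFinM ge0_muleDr//.
  by rewrite leeD// lee_wpmul2r// lee_fin.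
rewrite lte_mul_pinfty ?lee_fin ?exprn_ge0// ?(le_trans _ k1)//.
apply: (@le_lt_trans _ _ ((2^-1)%:E * modular mu Omega Phi u +
  (1 - 2^-1)%:E * modular mu Omega Phi v)).
  apply: (modular_convex_ae mO oPhi) => //; first by apply/andP; split; lra.
  apply: ae_onW => x Ox; have -> : (1 - 2^-1 = 2^-1 :> R)%R by lra.
  by rewrite (gee0_abs (z0 x)) -ge0_muleDr.
by rewrite lte_add_pinfty// lte_mul_pinfty// lee_fin; lra.
Qed.

Lemma luxemburg_lin (s t : R) u v w : inL u -> inL v ->
  measurable_on mu Omega w -> (0 <= s)%R -> (0 <= t)%R ->
  ae_on mu Omega (fun x => `|w x| <= s%:E * `|u x| + t%:E * `|v x|) ->
  lux w <= s%:E * lux u + t%:E * lux v.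
Proof.
move=> uL vL mw s0 t0 wuv; have [mu_ ufin] := uL; have [mv vfin] := vL.
have msu := measurable_scale s mu_; have mtv := measurable_scale t mv.
have uf := luxemburg_fin_num mO oPhi mu_ ufin.
have vf := luxemburg_fin_num mO oPhi mv vfin.
have su : inL (fun x => s%:E * u x).
  apply: (orlicz_space_lin uL uL msu s0 (lexx 0%R)).
  by apply: ae_onW => x Ox; rewrite mul0e adde0 abseM abse_EFin ger0_norm.
have tv : inL (fun x => t%:E * v x).
  apply: (orlicz_space_lin vL vL mtv t0 (lexx 0%R)).
  by apply: ae_onW => x Ox; rewrite mul0e adde0 abseM abse_EFin ger0_norm.
apply: (@le_trans _ _ (lux (fun x => s%:E * u x) + lux (fun x => t%:E * v x))).
  apply: (luxemburg_triangle_ae mO oPhi msu mtv mw).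
  - by apply: (luxemburg_fin_num mO oPhi) => //; exact: su.2.
  - by apply: (luxemburg_fin_num mO oPhi) => //; exact: tv.2.
  by apply: ae_onS wuv => x Ox; rewrite !abseM !abse_EFin !ger0_norm.
rewrite leeD//; apply: (luxemburg_scale_ae mO oPhi) => //.
  by apply: ae_onW => x Ox; rewrite abseM abse_EFin ger0_norm.
by apply: ae_onW => x Ox; rewrite abseM abse_EFin ger0_norm.
Qed.

(* Along non-exceptional curves a function with an upper gradient is finite at
   both end points, so only finite values matter. *)
Lemma weak_upper_gradient_lin (s t : R) u v w g h : wug u g -> wug v h ->
  (0 <= s)%R -> (0 <= t)%R ->
  (forall x y, u x \is a fin_num -> u y \is a fin_num ->
    v x \is a fin_num -> v y \is a fin_num ->
    `|w x - w y| <= s%:E * `|u x - u y| + t%:E * `|v x - v y|) ->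
  wug w (fun x => s%:E * g x + t%:E * h x).
Proof.
move=> /(weak_upper_gradient_in_spaceP oO bmu oPhi)[[gb gfin] [k kfin kc]].
move=> /(weak_upper_gradient_in_spaceP oO bmu oPhi)[[hb hfin] [l lfin lc]].
move=> s0 t0 wuv.
have sgb := nonneg_borelZ s0 gb; have thb := nonneg_borelZ t0 hb.
have sumb := nonneg_borelD sgb thb.
apply/(weak_upper_gradient_in_spaceP oO bmu oPhi); split.
  split => //.
  apply: (@orlicz_space_lin s t g h _ _ _ _ s0 t0 _).2.
  - by split => //; exact: (measurable_on_borel oO bmu).
  - by split => //; exact: (measurable_on_borel oO bmu).
  - exact: (measurable_on_borel oO bmu).
  apply: ae_onW => x Ox; rewrite gee0_abs; last exact: sumb.2.
  by rewrite !gee0_abs//; [exact: hb.2|exact: gb.2].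
exists (fun x => k x + l x); first exact: (modular_finiteD oO bmu oPhi).
move=> c rc; rewrite (curve_integralD oO rc kfin.1 lfin.1) => klfin.
have k0 := curve_integral_ge0 rc kfin.1; have l0 := curve_integral_ge0 rc lfin.1.
have [|uc gc] := kc _ rc; first by rewrite (le_lt_trans _ klfin)// leeDl.
have [|vc hc] := lc _ rc; first by rewrite (le_lt_trans _ klfin)// leeDr.
have [u0 u1] := abse_sub_lty (le_lt_trans uc gc).
have [v0 v1] := abse_sub_lty (le_lt_trans vc hc).
rewrite (curve_integralD oO rc)// !(curve_integralZ oO rc)//; split.
  apply: le_trans (wuv _ _ u0 u1 v0 v1) _.
  by rewrite leeD// lee_wpmul2l ?lee_fin.
by rewrite lte_add_pinfty// lte_mul_pinfty// ?lee_fin// ge0_fin_numE//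
  (curve_integral_ge0 rc).
Qed.

Lemma newtonian_gradient u : N u -> is_minimal_gradient mu Omega Phi u (G u).
Proof. by move=> [_ ug]; exact: (minimal_gradientP oO bmu oPhi). Qed.

Lemma gradient_orlicz u : N u -> inL (G u).
Proof. by move=> /newtonian_gradient[[]]. Qed.

Lemma gradient_ge0 u x : N u -> Omega x -> 0 <= G u x.
Proof. by move=> /newtonian_gradient[[[[_ +] _] _] _]; apply. Qed.

(** The right side is a weak upper gradient of [w], so minimality applies. Choices of [s], [t] and
    [w] yield convex combinations, differences and the passage to real values. *)
Lemma gradient_lin (s t : R) u v w : N u -> N v -> (0 <= s)%R -> (0 <= t)%R ->
  (forall x y, u x \is a fin_num -> u y \is a fin_num ->
    v x \is a fin_num -> v y \is a fin_num ->
    `|w x - w y| <= s%:E * `|u x - u y| + t%:E * `|v x - v y|) ->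
  ae_on mu Omega (fun x => G w x <= s%:E * G u x + t%:E * G v x).
Proof.
move=> uN vN s0 t0 wuv.
have [uG _] := newtonian_gradient uN; have [vG _] := newtonian_gradient vN.
have wG := weak_upper_gradient_lin uG vG s0 t0 wuv.
have [|_] := @minimal_gradientP _ _ mu Omega Phi P oO bmu oPhi muO Phi_ge w.
  by exists (fun x => s%:E * G u x + t%:E * G v x).
by apply.
Qed.

Lemma newtonian_lin (s t : R) u v w : N u -> N v ->
  measurable_on mu Omega w -> (0 <= s)%R -> (0 <= t)%R ->
  (forall x, u x \is a fin_num -> v x \is a fin_num ->
    `|w x| <= s%:E * `|u x| + t%:E * `|v x|) ->
  (forall x y, u x \is a fin_num -> u y \is a fin_num ->
    v x \is a fin_num -> v y \is a fin_num ->
    `|w x - w y| <= s%:E * `|u x - u y| + t%:E * `|v x - v y|) ->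
  N w /\ norm w <= s%:E * norm u + t%:E * norm v.
Proof.
move=> uN vN mw s0 t0 w_le w_lip.
have [uG _] := newtonian_gradient uN; have [vG _] := newtonian_gradient vN.
have wG := weak_upper_gradient_lin uG vG s0 t0 w_lip.
have w_ae : ae_on mu Omega (fun x => `|w x| <= s%:E * `|u x| + t%:E * `|v x|).
  apply: ae_onS2 (orlicz_space_ae_fin_num mO oPhi uN.1)
    (orlicz_space_ae_fin_num mO oPhi vN.1) => x _; exact: w_le.
have wN : N w.
  split; first exact: orlicz_space_lin uN.1 vN.1 mw s0 t0 w_ae.
  by exists (fun x => s%:E * G u x + t%:E * G v x).
split => //; rewrite /newtonian_norm.
have [uf vf] : lux u \is a fin_num /\ lux v \is a fin_num.
  by split; apply: (luxemburg_fin_num mO oPhi); [case: uN => -[]|case: uN => -[]|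
    case: vN => -[]|case: vN => -[]].
have lux0 z : 0 <= lux z by exact: luxemburg_ge0.
rewrite !ge0_muleDr// addeACA leeD//.
  exact: luxemburg_lin uN.1 vN.1 mw s0 t0 w_ae.
apply: (luxemburg_lin (gradient_orlicz uN) (gradient_orlicz vN) _ s0 t0 _).
  by case: (gradient_orlicz wN).
have := gradient_lin uN vN s0 t0 w_lip; apply: ae_onS => x Ox.
by rewrite !gee0_abs//; apply: gradient_ge0.
Qed.

Lemma newtonian_norm_ge0 u : 0 <= norm u.
Proof. by rewrite adde_ge0// luxemburg_ge0. Qed.

Lemma newtonian_norm_fin_num u : N u -> norm u \is a fin_num.
Proof.
move=> uN; rewrite fin_numD; apply/andP; split.
  by apply: (luxemburg_fin_num mO oPhi); case: uN => -[].
by have [mG fG] := gradient_orlicz uN; exact: (luxemburg_fin_num mO oPhi mG fG).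
Qed.

Lemma newtonian_measurable u : N u -> measurable_on mu Omega u.
Proof. by move=> [[]]. Qed.

Lemma newtonianD u v : N u -> N v -> N (fun x => u x + v x) /\
  norm (fun x => u x + v x) <= norm u + norm v.
Proof.
move=> uN vN; rewrite -(mul1e (norm u)) -(mul1e (norm v)).
apply: (newtonian_lin uN vN) => //.
- by apply: emeasurable_funD; exact: newtonian_measurable.
- by move=> x _ _; rewrite !mul1e lee_abs_add.
- move=> x y; rewrite !mul1e.
  case: (u x) => // ux; case: (u y) => // uy; case: (v x) => // vx;
    case: (v y) => // vy _ _ _ _.
  by rewrite -!EFinD lee_fin opprD addrACA ler_normD.
Qed.

Lemma newtonianZ (c : R) u : N u -> N (fun x => c%:E * u x) /\
  norm (fun x => c%:E * u x) <= `|c|%:E * norm u.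
Proof.
move=> uN; rewrite -[leRHS]adde0 -(mul0e (norm u)).
apply: newtonian_lin => //.
- by apply: measurable_funeM; exact: newtonian_measurable.
- by move=> x _ _; rewrite mul0e adde0 abseM.
- move=> x y ux uy _ _; rewrite mul0e adde0 -abse_EFin -abseM muleBr//.
  by rewrite fin_num_adde_defr.
Qed.

(** Only points where [u] is finite count, both a.e. and at the ends of good curves, and there
    nothing changes. *)
Lemma newtonian_fine u : N u -> N (EFin \o (fine \o u)) /\
  norm (EFin \o (fine \o u)) <= norm u.
Proof.
move=> uN; rewrite -[leRHS]adde0 -(mul0e (norm u)) -[X in X + _]mul1e.
apply: newtonian_lin => //.
- apply/measurable_EFinP; apply: (measurableT_comp _ (newtonian_measurable uN)).
  exact: fine_measurable.
- by move=> x ux _; rewrite mul0e adde0 mul1e /comp fineK.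
- by move=> x y ux uy _ _; rewrite mul0e adde0 mul1e /comp !fineK.
Qed.

Lemma gradient_fine u : N u ->
  ae_on mu Omega (fun x => G (EFin \o (fine \o u)) x = G u x).
Proof.
move=> uN; have [uN' _] := newtonian_fine uN.
have h1 : ae_on mu Omega (fun x => G (EFin \o (fine \o u)) x <= G u x).
  have : ae_on mu Omega (fun x => G (EFin \o (fine \o u)) x <=
      1%:E * G u x + 0%:E * G u x).
    apply: gradient_lin => // x y ux uy _ _.
    by rewrite mul0e adde0 mul1e /comp !fineK.
  by apply: ae_onS => x Ox; rewrite mul0e adde0 mul1e.
have h2 : ae_on mu Omega (fun x => G u x <= G (EFin \o (fine \o u)) x).
  have : ae_on mu Omega (fun x => G u x <=
      1%:E * G (EFin \o (fine \o u)) x + 0%:E * G u x).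
    apply: gradient_lin => // x y _ _ ux uy.
    by rewrite mul0e adde0 mul1e /comp !fineK.
  by apply: ae_onS => x Ox; rewrite mul0e adde0 mul1e.
by apply: ae_onS2 h1 h2 => x Ox h1 h2; apply/eqP; rewrite eq_le h1.
Qed.

(** Take both coefficients equal to 0. This disposes of identities, such as additivity of [fine],
    that fail only at infinite values. *)
Lemma newtonian_eq0 u v w : N u -> N v -> measurable_on mu Omega w ->
  (forall x, u x \is a fin_num -> v x \is a fin_num -> w x = 0) ->
  N w /\ norm w = 0.
Proof.
move=> uN vN mw w0.
have [||wN w_le] := newtonian_lin uN vN mw (lexx 0%R) (lexx 0%R).
- by move=> x ux vx; rewrite w0// abse0 !mul0e adde0.
- by move=> x y ux uy vx vy; rewrite !w0// sube0 abse0 !mul0e adde0.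
split; first exact: wN.
apply/eqP; rewrite eq_le newtonian_norm_ge0 andbT.
by move: w_le; move: (norm w) (norm u) (norm v) => a b c; rewrite !mul0e adde0.
Qed.

Lemma newtonian0 : N (cst 0).
Proof.
have rho0 : modular mu Omega Phi (cst 0) = 0.
  rewrite /modular /integral_on integral0_eq// => x Ox.
  by rewrite abse0 (orlicz_function0 oPhi).
have L0 : inL (cst 0) by split; [exact: measurable_cst|rewrite rho0].
split => //; exists (cst 0).
have f0 : modular_finite (mu := mu) (Omega := Omega) (Phi := Phi) (cst 0).
  by split; [exact: nonneg_borel0|rewrite rho0].
apply/(weak_upper_gradient_in_spaceP oO bmu oPhi); split => //.
exists (cst 0) => // c rc c0; split => //.
by rewrite sube0 abse0 (curve_integral_ge0 rc f0.1).
Qed.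

Local Notation V := (X -> R^o).

Definition real_newtonian : set V := [set u : V | N (EFin \o u)].

Definition real_newtonian_norm (u : V) : R := fine (norm (EFin \o u)).

Lemma real_newtonian0 : real_newtonian 0%R.
Proof. exact: newtonian0. Qed.

Lemma real_newtonianD (u v : V) : real_newtonian u -> real_newtonian v ->
  real_newtonian (u + v)%R.
Proof. by move=> uN vN; have [] := newtonianD uN vN. Qed.

Lemma real_newtonianZ (c : R) (u : V) : real_newtonian u ->
  real_newtonian (c *: u)%R.
Proof. by move=> uN; have [] := newtonianZ c uN. Qed.

Lemma real_newtonian_normE (u : V) : real_newtonian u ->
  (real_newtonian_norm u)%:E = norm (EFin \o u).
Proof. by move=> uN; rewrite fineK// newtonian_norm_fin_num. Qed.

Lemma real_newtonian_norm_ge0 (u : V) : (0 <= real_newtonian_norm u)%R.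
Proof. by rewrite fine_ge0// newtonian_norm_ge0. Qed.

Lemma real_newtonian_normZ (c : R) (u : V) : real_newtonian u ->
  (real_newtonian_norm (c *: u) <= `|c| * real_newtonian_norm u)%R.
Proof.
move=> uN; have := (newtonianZ c uN).2.
move: (real_newtonian_normE uN) (real_newtonian_normE (real_newtonianZ c uN)).
move: (real_newtonian_norm u) (real_newtonian_norm (c *: u)%R) => a b aE bE le_b.
by rewrite -lee_fin EFinM aE bE.
Qed.

Lemma real_newtonian_sublinear : sublinear_on real_newtonian real_newtonian_norm.
Proof.
split=> [u v uN vN|].
  have := (newtonianD uN vN).2.
  move: (real_newtonian_normE uN) (real_newtonian_normE vN)
    (real_newtonian_normE (real_newtonianD uN vN)).
  move: (real_newtonian_norm u) (real_newtonian_norm v)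
    (real_newtonian_norm (u + v)%R) => a b c aE bE cE le_c.
  by rewrite -lee_fin EFinD aE bE cE.
apply: sublinear_onZ => [c u uN||t u t0 uN].
- exact: real_newtonianZ.
- apply/eqP; rewrite eq_le real_newtonian_norm_ge0 andbT.
  by have := real_newtonian_normZ 0%R real_newtonian0; rewrite scale0r normr0 mul0r.
- by have := real_newtonian_normZ t uN; rewrite gtr0_norm.
Qed.

(** Brings a functional obtained by separation back to the extended-valued space. [fine] of a sum
    may differ from the sum of the [fine] parts, but by a function of seminorm 0, on which [L]
    vanishes. *)
Lemma real_newtonian_functional (L : V -> R) :
  (forall u v : V, real_newtonian u -> real_newtonian v ->
    L (u + v)%R = (L u + L v)%R) ->
  (forall (c : R) (u : V), real_newtonian u -> L (c *: u)%R = (c * L u)%R) ->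
  (forall u : V, real_newtonian u -> (L u <= real_newtonian_norm u)%R) ->
  @bounded_functional R (newtonian_space mu Omega Phi) (fun u => L (fine \o u)).
Proof.
move=> LD LZ Lb.
have Labs (u : V) : real_newtonian u -> (`|L u| <= real_newtonian_norm u)%R.
  move=> uN; rewrite ler_norml (Lb _ uN) andbT lerNl.
  have -> : (- L u = L ((-1) *: u))%R by rewrite LZ// mulN1r.
  apply: (le_trans (Lb _ (real_newtonianZ (-1) uN))).
  by have := real_newtonian_normZ (-1) uN; rewrite normrN1 mul1r.
have Leq (u v : V) : real_newtonian u -> real_newtonian v ->
    real_newtonian_norm (u - v)%R = 0%R -> L u = L v.
  move=> uN vN n0; have NvN : real_newtonian (- v)%R.
    by rewrite -scaleN1r; exact: real_newtonianZ.
  have := Labs _ (real_newtonianD uN NvN); rewrite n0 normr_le0 => /eqP.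
  by rewrite LD// -scaleN1r LZ// mulN1r => /eqP; rewrite subr_eq0 => /eqP.
split => /=.
- move=> u v uN vN; have [uvN _] := newtonianD uN vN.
  pose fu : V := fine \o u; pose fv : V := fine \o v.
  pose fuv : V := fine \o (fun x => u x + v x).
  have uN' : real_newtonian fu by exact: (newtonian_fine uN).1.
  have vN' : real_newtonian fv by exact: (newtonian_fine vN).1.
  have uvN' : real_newtonian fuv by exact: (newtonian_fine uvN).1.
  rewrite -[RHS](LD fu fv uN' vN'); apply: (Leq fuv _ uvN').
    exact: real_newtonianD.
  pose w : V := (fuv - (fu + fv))%R.
  have wN : real_newtonian w.
    apply: (real_newtonianD uvN'); rewrite -scaleN1r; apply: real_newtonianZ.
    exact: real_newtonianD.
  have [|_ w0] := newtonian_eq0 uN vN (newtonian_measurable wN).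
    move=> x ux vx; congr EFin; rewrite /w /fuv /fu /fv.
    by rewrite !fctE /= fineD// subrr.
  by rewrite /real_newtonian_norm -/w w0.
- move=> c u uN; have [uN' _] := newtonian_fine uN; rewrite -LZ//; congr L.
  by apply/funext => x; exact: fine_scale.
- exists 1%R => u uN; have [uN' le] := newtonian_fine uN.
  rewrite mul1e; apply: (le_trans _ le).
  rewrite -(fineK (newtonian_norm_fin_num uN')) lee_fin.
  exact: (Labs (fine \o u) uN').
Qed.

End newtonian_linear.

(** * Bounded functionals given by integration *)

Section dual_functional.
Local Open Scope ereal_scope.
Context {R : realType} {X : completeMetricType R}
  {mu m : {outer_measure set X -> \bar R}} {Omega D : set X}
  {Phi Psi : X -> \bar R -> \bar R} {P : nat}.
Hypotheses (mD : m.-cara.-measurable D) (oPsi : orlicz_function m D Psi P).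
Variables (S : (X -> \bar R) -> (X -> \bar R)) (f k : X -> \bar R).
Local Notation N := (newtonian mu Omega Phi).
Hypotheses (SL : forall u, N u -> orlicz_space m D Psi (S u))
  (ND : forall u v, N u -> N v -> N (fun x => u x + v x))
  (NZ : forall (c : R) u, N u -> N (fun x => c%:E * u x))
  (SD : forall u v, N u -> N v ->
    ae_on m D (fun z => S (fun x => u x + v x) z = S u z + S v z))
  (SZ : forall (c : R) u, N u ->
    ae_on m D (fun z => S (fun x => c%:E * u x) z = c%:E * S u z))
  (SB : exists C : R, forall u, N u ->
    luxemburg_norm m D Psi (S u) <= C%:E * newtonian_norm mu Omega Phi u)
  (mf : measurable_on m D f) (k0 : forall x, D x -> 0 <= k x)
  (kfin : integral_on m D k < +oo)
  (young : forall x xi, D x -> 0 <= xi -> `|f x| * xi <= k x + Psi x xi).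

Let integrable_dual u : N u -> integrable_on m D (fun z => f z * S u z).
Proof.
by move=> uN; have [] := integrable_orlicz_dual mD oPsi mf k0 kfin young (SL uN).
Qed.

Lemma dual_functional_fin_num u : N u ->
  integral_on m D (fun z => f z * S u z) \is a fin_num.
Proof. by move=> uN; apply: integrable_fin_num => //; exact: integrable_dual. Qed.

(** Where [f] is infinite, the Young inequality at [xi = 1] forces [k] to be infinite, since
    [Psi x 1] is finite. Finiteness of [f] is what makes it distribute over sums. *)
Let dual_fin_num_ae : ae_on m D (fun z => f z \is a fin_num).
Proof.
pose h x : \bar R := if `|f x| == +oo then +oo else 0.
have h0 x : 0 <= h x by rewrite /h; case: ifPn.
have mh : measurable_on m D h.
  apply: measurable_fun_if => //.
  - apply: measurable_fun_eqe; first exact: measurableT_comp.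
    exact: measurable_cst.
have ih : integrable_on m D h.
  apply/integrableP; split => //; apply: le_lt_trans kfin.
  apply: ge0_le_lower_integral => [x Dx|x Dx]; first exact: abse_ge0.
  rewrite gee0_abs// /h; case: ifPn => [/eqP foo|_]; last exact: k0.
  have := young Dx (@lee01 R); rewrite mule1 foo.
  have := orlicz_function_lty oPsi 1%R Dx.
  have := orlicz_function_ge0 oPsi Dx (@lee01 R).
  case: (Psi x 1) => [r| |]// _ _; have := k0 Dx.
  by case: (k x).
have : ae_on m D (fun x => h x \is a fin_num) by exact: (integrable_ae mD ih).
apply: ae_onS => x Dx.
by rewrite /h; case: ifPn => // /negP foo _; move: foo; case: (f x).
Qed.

(** Serves for the boundary term, with [S] the trace, and for the mean, with [S] the identity.
    Linearity of [S] is only a.e., which the integral does not see. *)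
Lemma dual_functional_bounded :
  @bounded_functional R (newtonian_space mu Omega Phi)
    (fun u => fine (integral_on m D (fun z => f z * S u z))).
Proof.
have mfS u : N u -> measurable_on m D (fun z => f z * S u z).
  by move=> /integrable_dual/integrableP[].
split => /=.
- move=> u v uN vN; rewrite -fineD ?dual_functional_fin_num//; congr fine.
  rewrite /integral_on -integralD//; [|exact: integrable_dual..].
  apply: ae_eq_integral => //.
  + exact/mfS/ND.
  + by apply: emeasurable_funD; exact: mfS.
  have : ae_on m D (fun z => f z \is a fin_num /\ S v z \is a fin_num).
    by apply: ae_onS2 dual_fin_num_ae (orlicz_space_ae_fin_num mD oPsi (SL vN)).
  apply: ae_onS2 (SD uN vN) => z Dz sz [fz svz].
  by rewrite sz muleDr// fin_num_adde_defl.
- move=> c u uN.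
  have -> : (c * fine (integral_on m D (fun z => (f z * S u z)%E)))%R =
      fine (c%:E * integral_on m D (fun z => f z * S u z)).
    by rewrite fineM ?dual_functional_fin_num.
  congr fine; rewrite /integral_on -integralZl//; last exact: integrable_dual.
  apply: ae_eq_integral => //.
  + exact/mfS/NZ.
  + by apply: measurable_funeM; exact: mfS.
  by apply: ae_onS (SZ c uN) => z Dz ->; rewrite muleCA.
- have [C SC] := SB.
  have kint0 : 0 <= integral_on m D k by exact: integral_ge0.
  have M0 : 0 <= (fine (integral_on m D k) + 1)%:E.
    by rewrite lee_fin addr_ge0// fine_ge0.
  exists ((fine (integral_on m D k) + 1) * C)%R => u uN.
  rewrite -abse_EFin fineK ?dual_functional_fin_num//.
  apply: le_trans (orlicz_dual_bound mD oPsi mf k0 kfin young (SL uN)) _.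
  by rewrite EFinM -muleA lee_wpmul2l// SC.
Qed.

End dual_functional.

(** * Two elementary real estimates *)

Section coercivity.
Context {R : realType}.

Lemma superlinear_bound (r K M : R) : 1 < r -> 0 <= K -> 0 <= M ->
  exists B : R, forall y : R,
    (forall t, 1 <= t -> t < y -> t `^ r <= K * y + M) -> y <= B.
Proof.
move=> r1 K0 M0; pose Q := 2 * (K + M).
have Q0 : 0 <= Q by rewrite mulr_ge0// addr_ge0.
exists (Num.max 2 (2 * Q `^ (r - 1)^-1)) => y h.
rewrite le_max; have [//|y2 /=] := leP y 2.
have r0 : 0 < r - 1 by rewrite subr_gt0.
have t0 : 0 < y / 2 by rewrite divr_gt0//; lra.
rewrite -ler_pdivrMl// mulrC.
have -> : y / 2 = ((y / 2) `^ (r - 1)) `^ (r - 1)^-1.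
  by rewrite -powRrM divff ?gt_eqF// powRr1// ltW.
apply: ge0_ler_powR; rewrite ?nnegrE ?powR_ge0// ?invr_ge0 ?(ltW r0)//.
have := h (y / 2); have -> : (y / 2) `^ r = (y / 2) * (y / 2) `^ (r - 1).
  rewrite -{2}(powRr1 (ltW t0)) -powRD; last by rewrite (gt_eqF t0) implybT.
  by rewrite addrC subrK.
move=> /(_ _ _)/le_trans => h'.
rewrite -(ler_pM2l t0) h'//; [lra|lra|].
rewrite /Q; have : M <= M * y by rewrite ler_peMr//; lra.
by move=> ?; rewrite mulrA; lra.
Qed.

(** The right side tends to [M] as [k] decreases to 1. *)
Lemma le_poly_right (e M : R) (P : nat) :
  (forall k, 1 < k -> e <= k ^+ P * M + (k - 1)) -> e <= M.
Proof.
move=> h; rewrite leNgt; apply/negP => Me.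
have cv : (fun k : R => k ^+ P * M + (k - 1)) @ 1^'+ --> 1 ^+ P * M + (1 - 1).
  apply: cvg_at_right_filter; apply: cvgD.
    by apply: cvgM; [exact: exprn_continuous|exact: cvg_cst].
  by apply: cvgB; [exact: cvg_id|exact: cvg_cst].
rewrite expr1n mul1r subrr addr0 in cv.
have : \forall k \near 1^'+, k ^+ P * M + (k - 1) < e by exact: (cvgr_lt _ cv).
move=> near_lt.
have [k [k1 ke]] : exists k : R, 1 < k /\ k ^+ P * M + (k - 1) < e.
  near (1 : R)^'+ => k; exists k; split; first by near: k; exact: nbhs_right_gt.
  by near: k.
by have := h _ k1; rewrite leNgt ke.
Unshelve. all: by end_near. Qed.

End coercivity.

(** * The gradient energy: convexity, closed sublevel sets, coercivity *)

Section gradient_energy.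
Local Open Scope ereal_scope.
Context {R : realType} {X : completeMetricType R}
  {mu : {outer_measure set X -> \bar R}} {Omega : set X} {p q a : X -> R}
  {p0 : R} {P : nat}.
Hypotheses (oO : open Omega) (bmu : borel_regular mu) (muO : mu Omega < +oo)
  (dp : double_phase_on mu Omega p q a p0 P).

Let Phi := double_phase p q a.
Let A := energy_density p q a.
Let mO : mu.-cara.-measurable Omega. Proof. exact: caratheodory_open. Qed.
Let oPhi : orlicz_function mu Omega Phi P := double_phase_orlicz mO dp.
Let oA : orlicz_function mu Omega A P := energy_density_orlicz mO dp.
Let Phi_ge x xi : Omega x -> 0 <= xi -> xi <= 1 + Phi x xi.
Proof. exact: (double_phase_ge mO dp). Qed.

Local Notation N := (newtonian mu Omega Phi).
Local Notation G := (minimal_gradient mu Omega Phi).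
Local Notation lux := (luxemburg_norm mu Omega Phi).

Definition gradient_energy (u : X -> \bar R) : \bar R :=
  modular mu Omega A (G u).

Let gradient_measurable u : N u -> measurable_on mu Omega (G u).
Proof. by move=> /(gradient_orlicz oO bmu oPhi muO Phi_ge)[]. Qed.

Let modular_A_le g : measurable_on mu Omega g ->
  modular mu Omega A g <= modular mu Omega Phi g.
Proof.
move=> mg; apply: ge0_le_integral => //.
- by move=> x Ox; exact: (orlicz_function_ge0 oA).
- exact: (measurable_modular oA).
- exact: (measurable_modular oPhi).
- by move=> x Ox; exact: (energy_density_le dp).
Qed.

Lemma gradient_energy_ge0 u : 0 <= gradient_energy u.
Proof. exact: (modular_ge0 oA). Qed.

Lemma gradient_energy_fin_num u : N u -> gradient_energy u \is a fin_num.
Proof.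
move=> uN; rewrite ge0_fin_numE ?gradient_energy_ge0//.
apply: le_lt_trans (modular_A_le (gradient_measurable uN)) _.
by have [] := gradient_orlicz oO bmu oPhi muO Phi_ge uN.
Qed.

Lemma gradient_energy_fine u : N u ->
  gradient_energy (EFin \o (fine \o u)) = gradient_energy u.
Proof.
move=> uN; have [uN' _] := newtonian_fine oO bmu oPhi muO Phi_ge uN.
have mG := gradient_measurable uN; have mG' := gradient_measurable uN'.
have GE := gradient_fine oO bmu oPhi muO Phi_ge uN.
by apply/eqP; rewrite eq_le; apply/andP; split; apply: (modular_le_ae mO oA) => //;
  apply: ae_onS GE => x Ox ->.
Qed.

Lemma gradient_energy_convex (M : R) :
  convex_subset [set u : X -> R^o | N (EFin \o u) /\
    gradient_energy (EFin \o u) <= M%:E].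
Proof.
move=> t u v t01 [uN uM] [vN vM]; have [t0 t1] := andP t01.
have t1' : (0 <= 1 - t)%R by rewrite subr_ge0.
have wN : N (EFin \o (t *: u + (1 - t) *: v : X -> R^o)%R).
  by apply: (real_newtonianD oO bmu oPhi muO Phi_ge);
    apply: (real_newtonianZ oO bmu oPhi muO Phi_ge).
split; first exact: wN.
apply: (@le_trans _ _ (t%:E * gradient_energy (EFin \o u) +
    (1 - t)%:E * gradient_energy (EFin \o v))).
  apply: (modular_convex_ae mO oA (gradient_measurable uN)
    (gradient_measurable vN) (gradient_measurable wN) t01).
  have := @gradient_lin _ _ _ _ _ _ oO bmu oPhi muO Phi_ge t (1 - t)%R _ _
    (EFin \o (t *: u + (1 - t) *: v : X -> R^o)%R) uN vN t0 t1'.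
  have h x y : `|(t * u x + (1 - t) * v x)%:E - (t * u y + (1 - t) * v y)%:E| <=
      t%:E * `|(u x)%:E - (u y)%:E| + (1 - t)%:E * `|(v x)%:E - (v y)%:E|.
    rewrite -!EFinB !abse_EFin -!EFinM -EFinD lee_fin.
    rewrite opprD addrACA -!mulrBr (le_trans (ler_normD _ _))//.
    by rewrite !normrM (ger0_norm t0) (ger0_norm t1').
  move=> /(_ (fun x y _ _ _ _ => h x y)); apply: ae_onS => x Ox.
  rewrite !gee0_abs//; apply: (gradient_ge0 oO bmu oPhi muO Phi_ge) => //.
have -> : M%:E = t%:E * M%:E + (1 - t)%:E * M%:E.
  by rewrite -!EFinM -EFinD -mulrDl addrC subrK mul1r.
by apply: leeD; [apply: lee_wpmul2l uM|apply: lee_wpmul2l vM]; rewrite lee_fin.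
Qed.

(* With [k = (1 - l)^-1], the gradient of [u] is dominated by the convex
   combination [(1 - l) (k g_v) + l (l^-1 g_(v - u))]. *)
Lemma gradient_energy_closed (M : R) (u : X -> R^o) : N (EFin \o u) ->
  (forall e : R, (0 < e)%R -> exists2 v : X -> R^o,
    N (EFin \o v) /\ gradient_energy (EFin \o v) <= M%:E &
    newtonian_norm mu Omega Phi (EFin \o (v - u)%R) < e%:E) ->
  gradient_energy (EFin \o u) <= M%:E.
Proof.
move=> uN approx; rewrite -(fineK (gradient_energy_fin_num uN)) lee_fin.
apply: (@le_poly_right _ _ _ P) => k k1.
have k0 : (0 < k)%R by rewrite (lt_trans _ k1).
(* A distance below [l] makes the modular of [g_(v - u) / l] at most 1, so this part contributes at
   most [l <= k - 1]; the other costs at most the factor [k ^+ P]. *)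
pose l := (1 - k^-1)%R.
have l0 : (0 < l)%R by rewrite subr_gt0 invf_lt1.
have l1 : (l <= 1)%R by rewrite gerBl invr_ge0 ltW.
have [v [vN vM] vu] := approx l l0.
have dN : N (EFin \o (v - u : X -> R^o)%R).
  apply: (real_newtonianD oO bmu oPhi muO Phi_ge vN); rewrite -scaleN1r.
  exact: (real_newtonianZ oO bmu oPhi muO Phi_ge).
set d := EFin \o _ in vu dN.
have mu_ := gradient_measurable uN; have mv := gradient_measurable vN.
have md := gradient_measurable dN.
have [_ d1] : (0 < l)%R /\ modular mu Omega Phi (fun x => (l^-1)%:E * G d x) <= 1.
  apply: (luxemburg_lt mO oPhi md); apply: le_lt_trans vu.
  by rewrite leeDr// luxemburg_ge0.
have mkv := measurable_scale k mv; have mld := measurable_scale l^-1%R md.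
have l01 : (0 <= 1 - l <= 1)%R by apply/andP; split; lra.
have lE : (1 - l = k^-1)%R by rewrite /l opprB addrC subrK.
rewrite -lee_fin fineK ?gradient_energy_fin_num// EFinD.
apply: (@le_trans _ _ ((1 - l)%:E * modular mu Omega A (fun x => k%:E * G (EFin \o v) x) +
    (1 - (1 - l))%:E * modular mu Omega A (fun x => (l^-1)%:E * G d x))).
  apply: (modular_convex_ae mO oA mkv mld mu_ l01).
  have := @gradient_lin _ _ _ _ _ _ oO bmu oPhi muO Phi_ge 1%R 1%R _ _
    (EFin \o u) vN dN ler01 ler01.
  have h x y : `|(u x)%:E - (u y)%:E| <=
      1 * `|(v x)%:E - (v y)%:E| + 1 * `|(v x - u x)%:E - (v y - u y)%:E|.
    rewrite !mul1e -!EFinB !abse_EFin -EFinD lee_fin.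
    have -> : (u x - u y = (v x - v y) - ((v x - u x) - (v y - u y)))%R by lra.
    by rewrite (le_trans (ler_normB _ _)).
  move=> /(_ (fun x y _ _ _ _ => h x y)); apply: ae_onS => x Ox.
  rewrite !mul1e => le_G.
  have G0 w : N w -> 0 <= G w x.
    by move=> wN; exact: (gradient_ge0 oO bmu oPhi muO Phi_ge).
  rewrite !abseM !abse_EFin !gee0_abs ?G0// !gtr0_norm ?invr_gt0//.
  rewrite !muleA -!EFinM lE mulVf ?gt_eqF// (_ : 1 - k^-1 = l)%R//.
  by rewrite divff ?gt_eqF// !mul1e.
rewrite (_ : 1 - (1 - l) = l)%R; last by rewrite opprB addrC subrK.
rewrite leeD//.
  rewrite lE lee_pdivrMl//.
  apply: (@le_trans _ _ ((k ^+ P)%:E * gradient_energy (EFin \o v))).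
    apply: (modular_growth mO oA mv mkv (ltW k1)).
    by apply: ae_onW => x Ox; rewrite abseM abse_EFin gtr0_norm.
  apply: (@le_trans _ _ ((k ^+ P)%:E * M%:E)).
    by rewrite lee_wpmul2l// lee_fin exprn_ge0// ltW.
  have M0 : (0 <= M)%R.
    by rewrite -lee_fin (le_trans (gradient_energy_ge0 _) vM).
  rewrite -!EFinM lee_fin; apply: ler_peMl; last exact: ltW.
  by rewrite mulr_ge0// exprn_ge0// ltW.
apply: (@le_trans _ _ (l%:E * 1)).
  by rewrite lee_wpmul2l ?lee_fin ?(ltW l0)// (le_trans (modular_A_le mld)).
rewrite mule1 lee_fin (_ : l = (k - 1) * k^-1)%R; last first.
  by rewrite mulrBl divff ?gt_eqF// mul1r.
by rewrite ler_piMr ?subr_ge0 ?(ltW k1)// invf_le1// ltW.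
Qed.

Lemma gradient_energy_coercive (K M : R) : (0 <= K)%R -> (0 <= M)%R ->
  exists B : R, forall u, N u ->
  gradient_energy u <= K%:E * lux (G u) + M%:E -> lux (G u) <= B%:E.
Proof.
move=> K0 M0.
have P0 : (0 <= P%:R :> R)%R by [].
have [B HB] := superlinear_bound (double_phase_lower_gt1 dp)
  (mulr_ge0 P0 K0) (mulr_ge0 P0 M0).
exists B => u uN uKM.
have [mG Gfin] := gradient_orlicz oO bmu oPhi muO Phi_ge uN.
have luxfin := luxemburg_fin_num mO oPhi mG Gfin.
rewrite -(fineK luxfin) lee_fin; apply: HB => t t1 ty.
have t0 : (0 < t)%R by rewrite (lt_le_trans _ t1).
have gt1 : 1 <= modular mu Omega Phi (fun x => (t^-1)%:E * G u x).
  rewrite leNgt; apply/negP => /ltW/(luxemburg_le t0).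
  by rewrite leNgt -(fineK luxfin) lte_fin ty.
have mZ := measurable_scale t^-1%R mG.
have : (t `^ p0)%:E * modular mu Omega Phi (fun x => (t^-1)%:E * G u x) <=
    modular mu Omega Phi (G u).
  rewrite /modular /integral_on -ge0_integralZl_EFin//; last 3 first.
  - by move=> x Ox; exact: (orlicz_function_ge0 oPhi).
  - exact: (measurable_modular oPhi).
  - exact: powR_ge0.
  apply: ae_ge0_le_integral => //.
  - by move=> x Ox; rewrite mule_ge0 ?lee_fin ?powR_ge0//; exact: (orlicz_function_ge0 oPhi).
  - by apply: measurable_funeM; exact: (measurable_modular oPhi).
  - by move=> x Ox; exact: (orlicz_function_ge0 oPhi).
  - exact: (measurable_modular oPhi).
  have := double_phase_lower_growth dp; apply: ae_onS => x Ox gr.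
  have -> : `|G u x| = t%:E * `|(t^-1)%:E * G u x|.
    rewrite abseM abse_EFin gtr0_norm ?invr_gt0// muleA -EFinM.
    by rewrite divff ?gt_eqF// mul1e.
  exact: gr.
have : modular mu Omega Phi (G u) <= P%:R%:E * gradient_energy u.
  rewrite /gradient_energy /modular /integral_on -ge0_integralZl_EFin//; last 2 first.
  - by move=> x Ox; exact: (orlicz_function_ge0 oA).
  - exact: (measurable_modular oA).
  apply: ae_ge0_le_integral => //.
  - by move=> x Ox; exact: (orlicz_function_ge0 oPhi).
  - exact: (measurable_modular oPhi).
  - by move=> x Ox; rewrite mule_ge0 ?lee_fin//; exact: (orlicz_function_ge0 oA).
  - by apply: measurable_funeM; exact: (measurable_modular oA).
  by have := energy_density_ge dp; apply: ae_onS => x Ox; apply.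
move=> le2 le1.
rewrite -lee_fin EFinD !EFinM (fineK luxfin).
apply: (@le_trans _ _ ((t `^ p0)%:E * 1)); first by rewrite mule1.
apply: (@le_trans _ _ ((t `^ p0)%:E *
    modular mu Omega Phi (fun x => (t^-1)%:E * G u x))).
  by rewrite lee_wpmul2l// lee_fin powR_ge0.
apply: (le_trans le1); apply: (le_trans le2).
rewrite -!muleA -ge0_muleDr ?lee_fin//.
  by rewrite lee_wpmul2l// lee_fin.
by rewrite mule_ge0 ?lee_fin// luxemburg_ge0.
Qed.

End gradient_energy.

(** * Weak continuity of the mean and weak lower semicontinuity of the energy *)

Section minimization.
Local Open Scope ereal_scope.
Context {R : realType} {X : completeMetricType R}
  {mu : {outer_measure set X -> \bar R}} {Omega : set X} {p q a : X -> R}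
  {p0 : R} {P : nat}.
Hypotheses (oO : open Omega) (bmu : borel_regular mu) (muO : mu Omega < +oo)
  (dp : double_phase_on mu Omega p q a p0 P).

Let Phi := double_phase p q a.
Let mO : mu.-cara.-measurable Omega. Proof. exact: caratheodory_open. Qed.
Let oPhi : orlicz_function mu Omega Phi P := double_phase_orlicz mO dp.
Let Phi_ge x xi : Omega x -> 0 <= xi -> xi <= 1 + Phi x xi.
Proof. exact: (double_phase_ge mO dp). Qed.

Local Notation N := (newtonian mu Omega Phi).
Local Notation V := (newtonian_space mu Omega Phi).
Local Notation E := (@gradient_energy R X mu Omega p q a).

Lemma newtonian_space_scale (c : R) (u : snvec V) : snmem u ->
  snmem (snscale c u) /\ snorm (snscale c u) <= `|c|%:E * snorm u.
Proof. exact: (newtonianZ oO bmu oPhi muO Phi_ge). Qed.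

(** The case [f = k = 1] of integration against a dual function; the Young inequality becomes
    [Phi_ge], and [k] is integrable as [Omega] has finite measure. *)
Lemma mean_functional_bounded :
  @bounded_functional R V (fun u => fine (integral_on mu Omega u)).
Proof.
have := @dual_functional_bounded R X mu mu Omega Omega Phi Phi P mO oPhi id
  (cst 1) (cst 1).
have -> : (fun u : X -> \bar R => fine (integral_on mu Omega (fun z => cst 1 z * id u z))) =
    (fun u => fine (integral_on mu Omega u)).
  apply/funext => u; congr fine; apply: eq_integral => x _.
  by rewrite /= mul1e.
apply.
- by move=> u [].
- by move=> u v uN vN; case: (newtonianD oO bmu oPhi muO Phi_ge uN vN).
- by move=> c u uN; case: (newtonianZ oO bmu oPhi muO Phi_ge c uN).
- by move=> u v _ _; exact: ae_onW.
- by move=> c u _; exact: ae_onW.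
- exists 1%R => u uN; rewrite mul1e leeDl// luxemburg_ge0//.
- exact: measurable_cst.
- by [].
- by rewrite /integral_on integral_cst// mul1e.
- by move=> x xi Ox xi0; rewrite abse1 mul1e; exact: Phi_ge.
Qed.

Lemma integral_newtonian_fin_num u : N u -> integral_on mu Omega u \is a fin_num.
Proof.
move=> [uL _]; apply: integrable_fin_num => //.
have [|||] := @integrable_orlicz_dual R X mu Omega Phi P mO oPhi
  (cst 1) (cst 1) u (measurable_cst _) _ _ _ uL.
- by [].
- by rewrite /integral_on integral_cst// mul1e.
- by move=> x xi Ox xi0; rewrite abse1 mul1e; exact: Phi_ge.
by move=> + _; apply: eq_integrable => // x _; rewrite mul1e.
Qed.

(* Mazur: by Hahn-Banach, the weak limit lies in the closure of every convex
   set containing the sequence frequently; apply this to sublevel sets of [E]. *)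
Lemma gradient_energy_weak_lsc (F : set_system nat) (x : nat -> X -> \bar R)
    (u : X -> \bar R) (M : R) : ProperFilter F ->
  (forall n, N (x n)) -> N u ->
  (forall L, @bounded_functional R V L -> L (x n) @[n --> F] --> L u) ->
  (\forall n \near F, E (x n) <= M%:E) -> E u <= M%:E.
Proof.
move=> FF xN uN weak xM.
pose W := @real_newtonian R X mu Omega Phi.
pose nrm := @real_newtonian_norm R X mu Omega Phi.
have W0 : W 0%R := real_newtonian0 oO bmu oPhi.
have WD : forall u v : X -> R^o, W u -> W v -> W (u + v)%R :=
  real_newtonianD oO bmu oPhi muO Phi_ge.
have WZ : forall (c : R) (u : X -> R^o), W u -> W (c *: u)%R :=
  real_newtonianZ oO bmu oPhi muO Phi_ge.
have snrm : sublinear_on W nrm := real_newtonian_sublinear oO bmu oPhi muO Phi_ge.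
pose fu : X -> R^o := fine \o u.
have fuN : W fu := (newtonian_fine oO bmu oPhi muO Phi_ge uN).1.
pose C := [set v : X -> R^o | N (EFin \o v) /\ E (EFin \o v) <= M%:E].
have CW : C `<=` W by move=> v [].
have xC : \forall n \near F, C (fine \o x n : X -> R^o).
  apply: filterS xM => n xnM; split.
    exact: (newtonian_fine oO bmu oPhi muO Phi_ge (xN n)).1.
  by rewrite (gradient_energy_fine oO bmu muO dp (xN n)).
have [n0 Cn0] := filter_ex xC.
rewrite -(gradient_energy_fine oO bmu muO dp uN).
apply: (gradient_energy_closed oO bmu muO dp fuN) => e e0.
(* Otherwise the sublevel set stays at distance at least [e] from [fu], and separation gives a
   bounded [L] exceeding [L fu + e] on it, against the convergence of [L (x n)]. *)
apply: contrapT => far.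
have dist v : C v -> (e <= nrm (v - fu)%R)%R.
  move=> Cv; rewrite leNgt; apply/negP => lt; apply: far; exists v => //.
  have vuN : W (v - fu)%R.
    by apply: WD; [exact: CW|rewrite -scaleN1r; exact: WZ].
  by rewrite -(real_newtonian_normE oO bmu oPhi muO Phi_ge vuN) lte_fin.
have [L [LD LZ Lb Lsep]] := convex_separation W0 WD WZ snrm CW
  (ex_intro _ _ Cn0) (gradient_energy_convex oO bmu muO dp (M := M)) fuN dist.
have bL := real_newtonian_functional oO bmu oPhi muO Phi_ge LD LZ Lb.
have cvL := weak _ bL.
have : (L fu + e <= L fu)%R.
  rewrite -[leRHS](cvg_lim _ cvL)//; apply: limr_ge.
    by apply/cvg_ex; eexists; exact: cvL.
  by apply: filterS xC => n Cn; exact: Lsep.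
by rewrite gerDl leNgt e0.
Qed.

End minimization.

(** * Measurability of the boundary and finiteness on bounded sets *)

Section borel_sets.
Context {R : realType} {X : completeMetricType R}.
Implicit Types (m : {outer_measure set X -> \bar R}) (A : set X).

Lemma caratheodory_closed m A : borel_regular m -> closed A ->
  m.-cara.-measurable A.
Proof.
move=> [bm _] cA; rewrite -(setCK A); apply: measurableC; apply: bm.
by apply: sub_sigma_algebra; exact: closed_openC.
Qed.

Lemma caratheodory_boundary m A : borel_regular m ->
  m.-cara.-measurable (boundary A).
Proof.
move=> bm; apply: measurableD.
  by apply: caratheodory_closed => //; exact: closed_closure.
by apply: bm.1; apply: sub_sigma_algebra; exact: open_interior.
Qed.

Lemma outer_measure_bounded_lty m A : (forall (x : X) (r : R), 0 < r ->
    (m (ball x r) < +oo)%E) -> bounded_in_metric A -> (m A < +oo)%E.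
Proof.
move=> mball [x [r Ar]].
(* The given radius may be zero or negative. *)
apply: (@le_lt_trans _ _ (m (ball x (`|r| + 1)))).
  apply: le_outer_measure; apply: (subset_trans Ar) => y; rewrite !ballEmdist/=.
  by move=> /lt_trans; apply; rewrite (le_lt_trans (ler_norm r))// ltrDl.
by apply: mball; rewrite ltr_wpDl.
Qed.

End borel_sets.

(** * Existence of a minimizer *)

Unset Implicit Arguments.
Set Strict Implicit.

Theorem theorem4p1 (R : realType) (X : completeMetricType R)
  (mu nu : {outer_measure set X -> \bar R}) (Omega : set X) (theta : R)
  (p q a : X -> R) (T : (X -> \bar R) -> (X -> \bar R)) (f : X -> \bar R)
  (hmu : ambient_measure mu)
  (hOmega : domain Omega)
  (hdoubling : restricted_doubling mu Omega)
  (htheta : 0 <= theta < 1)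
  (hnu : boundary_measure nu Omega)
  (hcodim : upper_codimension mu nu Omega theta)
  (hdata_closure : double_phase_data mu (closure Omega) p q a)
  (hdata_boundary : double_phase_data nu (boundary Omega) p q a)
  (hbounded : bounded_in_metric Omega)
  (hcomparability : local_comparability (double_phase p q a) (closure Omega))
  (hpoincare : weak_11_poincare mu Omega (double_phase p q a))
  (hglobal : global_poincare mu Omega (double_phase p q a))
  (hreflexive : reflexive_space (newtonian_space mu Omega (double_phase p q a)))
  (hT : trace_operator mu Omega (double_phase p q a) nu T)
  (hf : orlicz_space nu (boundary Omega)
          (complementary (double_phase p q a)) f)
  (hf0 : integral_on nu (boundary Omega) f = 0%E) :
  let N := newtonian_mean0 mu Omega (double_phase p q a) in
  let J := energy mu nu Omega p q a T f in
  exists2 u0 : X -> \bar R, N u0 & J u0 = ereal_inf [set J u | u in N].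
Proof.
move=> N J.
have bmu : borel_regular mu by case: hmu.
have bnu : borel_regular nu by case: hnu.
have oO : open Omega by case: hOmega.
have muO : (mu Omega < +oo)%E.
  apply: outer_measure_bounded_lty hbounded => x r r0.
  by case: hmu => _ _ /(_ x r r0)/andP[].
have mO := caratheodory_open oO bmu.
have [p0 [P dp]] := double_phase_dataW (caratheodory_closed bmu (@closed_closure _ Omega))
  mO (@subset_closure _ Omega) hdata_closure.
have mbd : nu.-cara.-measurable (boundary Omega) by exact: caratheodory_boundary.
(* The boundary has its own essential bounds, taken with respect to [nu]. *)
have [p0' [P' dp']] := double_phase_dataW mbd mbd (@subset_refl _ _) hdata_boundary.
pose Phi := double_phase p q a.
have oPhi : orlicz_function mu Omega Phi P := double_phase_orlicz mO dp.
have oPhi' : orlicz_function nu (boundary Omega) Phi P' := double_phase_orlicz mbd dp'.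
have Phi_ge x xi : Omega x -> (0 <= xi -> xi <= 1 + Phi x xi)%E :=
  @double_phase_ge _ _ _ _ _ _ _ _ _ mO dp x xi.
pose ell u := fine (integral_on nu (boundary Omega) (fun z => f z * T u z)%E).
pose E := @gradient_energy R X mu Omega p q a.
case: hT => TL [TD TZ] TB _.
have ND u v : newtonian mu Omega Phi u -> newtonian mu Omega Phi v ->
    newtonian mu Omega Phi (fun x => u x + v x)%E.
  by move=> uN vN; case: (newtonianD oO bmu oPhi muO Phi_ge uN vN).
have NZ (c : R) u : newtonian mu Omega Phi u ->
    newtonian mu Omega Phi (fun x => c%:E * u x)%E.
  by move=> uN; case: (newtonianZ oO bmu oPhi muO Phi_ge c uN).
case: hf => mf ffin.
have f0 x : boundary Omega x ->
    (0 <= complementary (double_phase p q a) x `|f x|)%E.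
  exact: (complementary_ge0 mbd dp').
have young x xi : boundary Omega x -> (0 <= xi)%E ->
    (`|f x| * xi <= complementary Phi x `|f x| + Phi x xi)%E.
  exact: (complementary_young mbd dp').
have ellb : @bounded_functional R (newtonian_space mu Omega Phi) ell.
  exact: (dual_functional_bounded mbd oPhi' TL ND NZ TD TZ TB mf f0 ffin young).
have ellE u : newtonian mu Omega Phi u ->
    integral_on nu (boundary Omega) (fun z => f z * T u z)%E = (ell u)%:E.
  move=> uN; rewrite fineK//.
  exact: (dual_functional_fin_num mbd oPhi' TL mf f0 ffin young uN).
have JE u : newtonian mu Omega Phi u -> J u = (fine (E u) + ell u)%:E.
  move=> uN; rewrite EFinD (fineK (gradient_energy_fin_num oO bmu muO dp uN)) -ellE//.
  congr (_ + _)%E; apply: eq_integral => x /[!inE] Ox.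
  by rewrite gee0_abs//; exact: (gradient_ge0 oO bmu oPhi muO Phi_ge).
have E0 u : 0 <= fine (E u).
  by rewrite fine_ge0//; exact: (gradient_energy_ge0 oO bmu dp).
have [K0 ellK] : exists K : R, forall u, newtonian mu Omega Phi u ->
    (`|ell u|%:E <= K%:E * newtonian_norm mu Omega Phi u)%E.
  by case: ellb.
pose lux u := luxemburg_norm mu Omega Phi (minimal_gradient mu Omega Phi u).
have [C C0 poincare] := hglobal.
(* For mean zero, the Poincare inequality bounds [u] itself, so the gradient controls the whole
   norm. *)
have norm_le u : N u -> (newtonian_norm mu Omega Phi u <= (C + 1)%:E * lux u)%E.
  move=> [uN um0].
  rewrite EFinD ge0_muleDl ?lee_fin ?(ltW C0)// mul1e leeD2r//.
  have := poincare u uN.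
  have -> : (fun x => u x - average mu Omega u)%E = u.
    by apply/funext => x; rewrite /average um0 mule0 sube0.
  by [].
pose K := `|K0| * (C + 1).
have K_ge0 : 0 <= K by rewrite mulr_ge0// addr_ge0// ltW.
have ell_le u : N u -> (`|ell u|%:E <= K%:E * lux u)%E.
  move=> uN; apply: (le_trans (ellK u uN.1)).
  apply: (@le_trans _ _ (`|K0|%:E * newtonian_norm mu Omega Phi u)%E).
    by rewrite lee_wpmul2r ?lee_fin ?ler_norm// newtonian_norm_ge0.
  rewrite EFinM -muleA lee_wpmul2l ?lee_fin//; exact: norm_le.
have lux0 u : (0 <= lux u)%E by exact: luxemburg_ge0.
have coercive M : 0 <= M -> exists2 B : R, 0 < B & forall u, N u ->
    fine (E u) + ell u <= M -> (lux u <= B%:E)%E.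
  move=> M0; have [B HB] := gradient_energy_coercive oO bmu muO dp K_ge0 M0.
  exists (`|B| + 1); first by rewrite ltr_wpDl.
  move=> u uN uM; apply: (@le_trans _ _ B%:E); last first.
    by rewrite lee_fin (le_trans (ler_norm B))// lerDl.
  have [uN1 _] := uN; apply: HB => //.
  rewrite -(fineK (gradient_energy_fin_num oO bmu muO dp uN1)).
  apply: (@le_trans _ _ ((`|ell u|)%:E + M%:E)%E); last by rewrite leeD2r// ell_le.
  by rewrite -EFinD lee_fin -/(E u); have := ler_norm (- ell u); rewrite normrN; lra.
have N0 : N (cst 0%E).
  split; first exact: (newtonian0 oO bmu oPhi).
  by rewrite /integral_on integral0.
pose S := [set J u | u in N].
(* The value at the zero function. Functions of energy at most [J0 + 1] have gradient norm at most
   [B1]; this bounds [J] from below and, since [j + n.+1%:R^-1 <= J0 + 1], also the minimizing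
   sequence. The absolute value supplies the nonnegative level that [coercive] asks for. *)
pose J0 := fine (E (cst 0%E)) + ell (cst 0%E).
have [B1 B10 HB1] := coercive `|J0 + 1| (normr_ge0 _).
have J_ge u : N u -> fine (E u) + ell u <= J0 + 1 -> - (K * B1) <= fine (E u) + ell u.
  move=> uN uJ.
  have := HB1 u uN (le_trans uJ (ler_norm _)) => uB.
  have : `|ell u| <= K * B1.
    rewrite -lee_fin EFinM (le_trans (ell_le _ uN))// lee_wpmul2l ?lee_fin//.
  by have := E0 u; rewrite ler_norml => ? /andP[? _]; lra.
have infS_fin : ereal_inf S \is a fin_num.
  rewrite fin_numE; apply/andP; split; last first.
    rewrite lt_eqF// (@le_lt_trans _ _ (J (cst 0%E)))//.
      by apply: ereal_inf_lbound; exists (cst 0%E).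
    by rewrite JE ?ltry//; case: N0.
  rewrite gt_eqF// (@lt_le_trans _ _ (Num.min (J0 + 1) (- (K * B1)))%:E) ?ltNyr//.
  apply: le_ereal_inf_tmp => _ [u uN <-]; rewrite JE; last by case: uN.
  rewrite lee_fin ge_min; have [//|uJ/=] := leP (J0 + 1) (fine (E u) + ell u).
  by apply: J_ge => //; exact: ltW.
pose j := fine (ereal_inf S).
have j_le u : N u -> j <= fine (E u) + ell u.
  move=> uN; rewrite -lee_fin fineK// -JE; last by case: uN.
  by apply: ereal_inf_lbound; exists u.
have exu n : exists u, N u /\ fine (E u) + ell u <= j + n.+1%:R^-1.
  have [|_ [u uN <-] uj] := @lb_ereal_inf_adherent _ S n.+1%:R^-1 _ infS_fin.
    by rewrite invr_gt0.
  exists u; split => //; rewrite -lee_fin -JE; last by case: uN.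
  by rewrite EFinD fineK// ltW.
have [u uP] := boolp.choice exu.
have uN n : newtonian mu Omega Phi (u n) by case: (uP n) => -[].
pose B := (C + 1) * B1.
have B0 : 0 < B by rewrite mulr_gt0// addr_gt0.
have j0 : j <= J0 by exact: j_le.
have uB n : (newtonian_norm mu Omega Phi (u n) <= B%:E)%E.
  apply: (le_trans (norm_le _ (uP n).1)).
  rewrite EFinM lee_wpmul2l ?lee_fin ?addr_ge0 ?(ltW C0)//.
  apply: HB1; first exact: (uP n).1.
  apply: (le_trans (uP n).2); apply: le_trans (ler_norm _); apply: lerD => //.
  by rewrite invf_le1 ?ler1n// ltr0n.
have [F [u0 [FF ooF u0N weak]]] := @reflexive_weak_limit R
  (newtonian_space mu Omega Phi) u B
  (newtonian_space_scale oO bmu muO dp)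
  (fun v _ => newtonian_norm_ge0 v) hreflexive uN B0 uB.
have mean0 : integral_on mu Omega u0 = 0%E.
  have := weak _ (mean_functional_bounded oO bmu muO dp).
  have -> : (fun n => fine (integral_on mu Omega (u n))) = cst 0.
    by apply/funext => n; case: (uP n) => -[_ ->].
  move=> /(cvg_lim (@Rhausdorff R)); rewrite lim_cst// => mean_lim.
  by rewrite -(fineK (integral_newtonian_fin_num oO bmu muO dp u0N)) -mean_lim.
have Nu0 : N u0 by [].
exists u0 => //; rewrite -/S -(fineK infS_fin) -/j JE//; congr EFin.
apply/eqP; rewrite eq_le j_le// andbT.
apply/ler_addgt0Pr => e e0.
have : (E u0 <= (j - ell u0 + e)%:E)%E.
  (* Along [F], [E (u n)] is at most [j + n.+1%:R^-1 - ell (u n)]: half of [e] absorbs the fraction,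
     the other half the convergence of [ell (u n)] to [ell u0]. *)
  apply: (gradient_energy_weak_lsc oO bmu muO dp FF uN u0N weak).
  have e2 : 0 < e / 2 by rewrite divr_gt0.
  have near1 : \forall n \near F, ell u0 - e / 2 < ell (u n).
    by apply: (cvgr_gt _ (weak _ ellb)); rewrite gtrBl.
  have near2 : \forall n \near F, n.+1%:R^-1 < e / 2.
    apply: ooF; exists (Num.bound (e / 2)^-1) => //= n /= ne.
    rewrite invf_plt ?posrE// (lt_trans (archi_boundP _)) ?invr_ge0 ?(ltW e2)//.
    by rewrite ltr_nat ltnS.
  apply: filterS2 near1 near2 => n n1 n2.
  rewrite -(fineK (gradient_energy_fin_num oO bmu muO dp (uN n))) lee_fin.
  have := (uP n).2; move: (n.+1%:R^-1) n2 => d n2 un.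
  by have : fine (E (u n)) <= j - ell u0 + e by lra.
have Efin : E u0 \is a fin_num := gradient_energy_fin_num oO bmu muO dp u0N.
by rewrite -(fineK Efin) lee_fin; lra.
Qed.
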